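(* There exists a function $\varphi:\mathbb N\to\mathbb C$ such that the multiplier $M_\varphi$ is completely bounded on $H^1$ (equivalently, such that the matrix $(\varphi(i+j))_{i,j\ge0}$ is a bounded Schur multiplier of $B(\ell_2)$), but such that $M_\varphi$ is not shift-bounded on $H^1$.
   Context: $\mathbb N=\{0,1,2,\dots\}$, and $m$ is normalized Lebesgue measure on the unit circle. For a Banach space $B$, $H^1(B)$ is the completion of the $B$-valued polynomials $f(z)=\sum_{n\ge0}x_nz^n$ ($x_n\in B$) for the norm $\|f\|_{H^1(B)}=\int\|f(z)\|_B\,dm(z)$; $H^1=H^1(\mathbb C)$ is the classical Hardy space. $S_1$ is the Banach space of trace class operators on $\ell_2$, with norm $\|x\|_{S_1}=\mathrm{tr}(|x|)$. For $\varphi:\mathbb N\to\mathbb C$, $M_\varphi$ is the multiplier $\sum a_nz^n\mapsto\sum a_n\varphi(n)z^n$. It is called completely bounded on $H^1$ if the same formula (with coefficients $a_n\in S_1$) defines a bounded operator on $H^1(S_1)$. A multiplier $M_\varphi$ that is bounded on $H^1$ is called shift-bounded on $H^1$ if for every $x=\sum_{n\ge0}x_nz^n$ in $H^1$, $$\int\sup_{k\ge0}\big|M_\varphi(z^kx)\big|\,dm(z)=\int\sup_{k\ge0}\Big|\sum_{n\ge0}x_n\varphi(n+k)z^n\Big|\,dm(z)<\infty .$$ A matrix $(a_{ij})_{i,j\ge 0}$ is a bounded Schur multiplier of $B(\ell_2)$ if $(b_{ij})\mapsto(a_{ij}b_{ij})$ is a bounded map from $B(\ell_2)$ to itself. *)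

(* Defs.v *)
From HB Require Import structures.
From mathcomp Require Import all_boot all_order all_algebra.
From mathcomp Require Export complex.
From mathcomp Require Import all_classical all_reals all_analysis.
From mathcomp Require Import ring lra.

Set Implicit Arguments.
Unset Strict Implicit.
Unset Printing Implicit Defensive.

Import Order.TTheory GRing.Theory Num.Theory.
Import numFieldNormedType.Exports.

Local Open Scope classical_set_scope.
Local Open Scope ring_scope.
Local Open Scope complex_scope.

(** * The Hilbert space l_2 over the complex numbers *)

(* The modulus of a complex number, as an element of [R] ([`|z|] lives in
   [R[i]]). *)
Definition modc (R : realType) (z : R[i]) : R := complex.Re `|z|.

Definition ell2_sum (R : realType) (x : nat -> R[i]^o) : \bar R :=
  (\sum_(n <oo) (modc (x n) ^+ 2)%:E)%E.

Definition ell2_pred (R : realType) : {pred (nat -> R[i]^o)} :=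
  fun x => `[< (ell2_sum x < +oo)%E >].

Section Ell2Module.
Variable R : realType.

Let modc_ge0 (z : R[i]) : 0 <= modc z.
Proof. by rewrite /modc normc_def /= sqrtr_ge0. Qed.

Let modcC (z : R[i]) : (modc z)%:C = `|z|.
Proof. by rewrite /modc normc_def. Qed.

Let modcM (a b : R[i]) : modc (a * b) = modc a * modc b.
Proof.
by apply: (@complexI R); rewrite rmorphM/= !modcC normrM.
Qed.

Let modcD2 (a b : R[i]) :
  modc (a + b) ^+ 2 <= 2 * modc a ^+ 2 + 2 * modc b ^+ 2.
Proof.
have h : modc (a + b) <= modc a + modc b.
  by rewrite -lecR rmorphD/= !modcC ler_normD.
have h2 : modc (a + b) ^+ 2 <= (modc a + modc b) ^+ 2.
  by rewrite ler_sqr ?nnegrE ?addr_ge0.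
have := sqr_ge0 (modc a - modc b); nra.
Qed.

Lemma ell2_submod_closed : submod_closed (@ell2_pred R).
Proof.
have ge0 (x : nat -> R[i]^o) n : (0 <= (modc (x n) ^+ 2)%:E)%E.
  by rewrite lee_fin sqr_ge0.
split.
  apply/asboolP; rewrite /ell2_sum eseries0 ?ltry// => n _ _.
  by rewrite /modc normr0 /= expr0n.
move=> a x y /asboolP hx /asboolP hy; apply/asboolP.
apply: (@le_lt_trans _ _ (\sum_(n <oo)
  ((2 * modc a ^+ 2)%:E * (modc (x n) ^+ 2)%:E + 2%:E * (modc (y n) ^+ 2)%:E))%E).
  apply: lee_nneseries => n *; first exact: ge0.
  rewrite -!EFinM -EFinD lee_fin.
  apply: (le_trans (modcD2 _ _)).
  by rewrite modcM exprMn mulrA.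
rewrite nneseriesD; last 2 first.
- by move=> *; rewrite mule_ge0// lee_fin ?mulr_ge0 ?sqr_ge0.
- by move=> *; rewrite mule_ge0// lee_fin ?sqr_ge0.
rewrite !nneseriesZl//; try by move=> *; exact: ge0.
have fin (z : nat -> R[i]^o) (c : R) : (ell2_sum z < +oo)%E ->
    (c%:E * ell2_sum z < +oo)%E.
  move=> hz; have : ell2_sum z \is a fin_num.
    by rewrite ge0_fin_numE// nneseries_ge0.
  by move=> /fineK <-; rewrite -EFinM ltry.
by rewrite lte_add_pinfty//; apply: fin.
Qed.

HB.instance Definition _ :=
  GRing.isSubmodClosed.Build R[i] (nat -> R[i]^o) (@ell2_pred R)
    ell2_submod_closed.

Record ell2 := Ell2 {
  ell2_fun :> nat -> R[i]^o ;
  _ : ell2_fun \in @ell2_pred R }.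

HB.instance Definition _ := [isSub for ell2_fun].
HB.instance Definition _ := [Choice of ell2 by <:].
HB.instance Definition _ := [SubChoice_isSubLmodule of ell2 by <:].

Lemma ell2_basis_subproof (n : nat) :
  (fun k => (k == n)%:R : R[i]^o) \in @ell2_pred R.
Proof.
apply/asboolP; rewrite /ell2_sum (@nneseries_split _ _ 0 n.+1)//; last first.
  by move=> *; rewrite lee_fin sqr_ge0.
rewrite [X in (_ + X)%E]eseries0 ?adde0.
  by rewrite sumEFin ltry.
by move=> k; rewrite add0n => nk _; rewrite gtn_eqF// /modc normr0 /= expr0n.
Qed.

Definition ell2_basis (n : nat) : ell2 := Ell2 (ell2_basis_subproof n).

End Ell2Module.

(** * Bounded operators on l_2 *)

Section Operators.
Variable R : realType.
Local Notation H := (ell2 R).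
Implicit Types (T P S : H -> H).

Definition ell2_norm (x : H) : R := Num.sqrt (fine (ell2_sum x)).

(* Linear in the first variable; the real and imaginary parts of the
   (absolutely convergent) series are summed separately. *)
Definition ell2_inner (x y : H) : R[i] :=
  limn (series (fun n => complex.Re (x n * (y n)^*))) +i*
  limn (series (fun n => complex.Im (x n * (y n)^*))).

Definition bounded_op : set (H -> H) :=
  [set T | linear T /\ exists M : R, forall x, ell2_norm (T x) <= M * ell2_norm x].

Definition op_norm T : R := sup [set ell2_norm (T x) | x in [set x | ell2_norm x <= 1]].

Definition op_entry T (i j : nat) : R[i] :=
  ell2_inner (T (ell2_basis R j)) (ell2_basis R i).

(* [op_adjoint] and [op_abs] are chosen in sets which are singletons as soon as
   [T] is a bounded operator; the default value [0] is then irrelevant. *)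
Definition op_adjoint T : H -> H :=
  xget (0 : H -> H) [set S | bounded_op S /\
    forall x y, ell2_inner (T x) y = ell2_inner x (S y)].

Definition positive_op T : Prop :=
  bounded_op T /\ forall x, 0 <= ell2_inner (T x) x.

(* |T|, the positive square root of T^* T *)
Definition op_abs T : H -> H :=
  xget (0 : H -> H) [set P | positive_op P /\ P \o P = op_adjoint T \o T].

Definition pos_trace P : \bar R :=
  (\sum_(n <oo) (complex.Re (op_entry P n n))%:E)%E.

Definition trace_norm T : \bar R := pos_trace (op_abs T).

Definition trace_class : set (H -> H) :=
  [set T | bounded_op T /\ (trace_norm T < +oo)%E].

End Operators.

(** * Hardy spaces of vector valued functions *)

(* The circle is parametrized by t in [0, 1], so that m becomes the Lebesgue
   measure of [0, 1]. *)
Definition circle_pt (R : realType) (t : R) : R[i] :=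
  cos (2 * pi * t) +i* sin (2 * pi * t).

Definition circle_int (R : realType) (h : R -> \bar R) : \bar R :=
  (\int[@lebesgue_measure R]_(t in `[0%R, 1%R]) h t)%E.

(* The Banach space is given as a subspace [B] of a vector space [V] together
   with a function [N] on [V] which restricts to its norm on [B]. *)
Section Hardy.
Variables (R : realType) (V : lmodType R[i]) (B : set V) (N : V -> \bar R).

(* A polynomial is given by the sequence of its coefficients, a formal sequence
   of polynomials by a function [nat -> seq V]. *)
Definition bpoly (p : seq V) : Prop := forall n, B p`_n.

Definition bpoly_eval (p : seq V) (z : R[i]) : V :=
  \sum_(n < size p) z ^+ n *: p`_n.

Definition bpoly_norm (p : seq V) : \bar R :=
  circle_int (fun t => N (bpoly_eval p (circle_pt t))).

Definition bpoly_dist (p q : seq V) : \bar R :=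
  circle_int (fun t =>
    N (bpoly_eval p (circle_pt t) - bpoly_eval q (circle_pt t))).

(* The completion H^1(B): its elements are the Cauchy sequences of polynomials,
   two of them being identified when their distance tends to 0. *)
Definition hardy1 : set (nat -> seq V) :=
  [set F | (forall k, bpoly (F k)) /\
    forall e : R, 0 < e -> exists K, forall j k, (K <= j)%N -> (K <= k)%N ->
      (bpoly_dist (F j) (F k) < e%:E)%E].

Definition hardy1_norm (F : nat -> seq V) : \bar R :=
  limn (fun k => bpoly_norm (F k)).

(* The n-th coefficient of an element of H^1(B) is the limit in [B] of the n-th
   coefficients of an approximating sequence; an element of H^1(B) is determined
   by its coefficients.  [multiplier_image phi F G] says that those of [G] are
   the [phi n] times those of [F], i.e. that [M_phi F = G]. *)
Definition multiplier_image (phi : nat -> R[i]) (F G : nat -> seq V) : Prop :=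
  forall n, (fun k => N (phi n *: (F k)`_n - (G k)`_n)) @ \oo --> 0%E.

Definition bounded_multiplier (phi : nat -> R[i]) : Prop :=
  exists C : R, forall F, hardy1 F ->
    exists G, [/\ hardy1 G, multiplier_image phi F G &
      (hardy1_norm G <= C%:E * hardy1_norm F)%E].

(* multiplication by z^k *)
Definition hardy1_shift (k : nat) (F : nat -> seq V) : nat -> seq V :=
  fun j => nseq k 0 ++ F j.

End Hardy.

Section Multipliers.
Variable R : realType.

Definition cnorm (z : R[i]^o) : \bar R := (modc z)%:E.

Definition H1 : set (nat -> seq R[i]^o) := hardy1 [set: R[i]^o] cnorm.

(* [f] is the function on the circle (in the variable t, and up to a null set)
   defined by the element [F] of H^1: the limit of [F] in L^1(m). *)
Definition H1_function (F : nat -> seq R[i]^o) (f : R -> R[i]) : Prop :=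
  [/\ measurable_fun `[0%R : R, 1%R] (fun t => complex.Re (f t)),
      measurable_fun `[0%R : R, 1%R] (fun t => complex.Im (f t)) &
      (fun k => circle_int (fun t =>
         cnorm (bpoly_eval (F k) (circle_pt t) - f t))) @ \oo --> 0%E].

Definition bounded_on_H1 (phi : nat -> R[i]) : Prop :=
  bounded_multiplier [set: R[i]^o] cnorm phi.

Definition completely_bounded_on_H1 (phi : nat -> R[i]) : Prop :=
  bounded_multiplier (@trace_class R) (@trace_norm R) phi.

(* The functions [g k] are the M_phi(z^k F); as k ranges over a countable set,
   the integral does not depend on the choice of representatives. *)
Definition shift_bounded_on_H1 (phi : nat -> R[i]) : Prop :=
  bounded_on_H1 phi /\
  forall (F : nat -> seq R[i]^o) (G : nat -> nat -> seq R[i]^o)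
    (g : nat -> R -> R[i]),
    H1 F ->
    (forall k, [/\ H1 (G k),
       multiplier_image cnorm phi (hardy1_shift k F) (G k) &
       H1_function (G k) (g k)]) ->
    (circle_int (fun t => ereal_sup [set cnorm (g k t) | k in [set: nat]])
      < +oo)%E.

Definition schur_multiplier (a : nat -> nat -> R[i]) : Prop :=
  exists C : R, forall T : ell2 R -> ell2 R, bounded_op T ->
    exists S : ell2 R -> ell2 R,
      [/\ bounded_op S,
          forall i j, op_entry S i j = a i j * op_entry T i j &
          op_norm S <= C * op_norm T].

End Multipliers.

(* Main.v *)
Require Import Defs.
From mathcomp Require Import all_boot all_order all_algebra.
From mathcomp Require Import all_classical all_reals all_analysis.
From mathcomp Require Import measurable_realfun.
From mathcomp Require Import ring lra zify.

(** The trace norm is dual to the operator norm: [trace_norm T] is the supremum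
    of the pairings of its matrix with contractive forms on finitely many
    coordinates ([trace_normE]).  Everything about [H^1(S_1)] is reduced by this to
    finite matrices, and, since the integral over the circle averages the
    values on the cosets of the [K]-th roots of unity ([circle_int_le_roots]),
    to finite sums.

    From [H^1(S_1)] to Schur multipliers ([cb_hankel_bound]).  The polynomial
    [f(z) = (sum_i z^i xi_i e_i) (x) (sum_j z^j eta_j e_j)] has rank one at each
    point, so its norm is at most [|xi| |eta|], and the matrix of its [n]-th
    coefficient lives on the antidiagonal [i + j = n].  Pairing [M_phi f] with
    [z^-(i+j) Y i j] and averaging over the circle gives
    [sum phi(i+j) Y i j xi_i eta_j], which is thus at most [C |xi| |eta|] as soon
    as [Y] is contractive.

    From Schur multipliers to [H^1(S_1)] ([discrete_multiplier]).  In the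
    classical proof [f] in [H^1(S_1)] is a product of two functions of
    [H^2(S_2)], whose coefficients form a Hankel pattern on which the Schur
    multiplier acts.  Here the factorization takes place on finite matrices: the
    coefficients of a polynomial of degree less than [N] fill a lower triangular
    block Toeplitz matrix [L] with [2 N] block rows and [N] block columns; a
    triangular factorization [L = G H] with Hilbert-Schmidt factors
    ([triangular_factorization]) replaces outer functions, and in
    [L i j = sum_k G i k H k j] with [j <= k <= i] the symbol [phi(i - j)] is
    [phi((i - k) + (k - j))], a Hankel symbol.  The ratio [2 N / N] accounts for
    the constant [2] in the resulting bound.

    The counterexample ([symbol]).  A sequence with
    [sum_(j <= n <= 2 j) |phi n|^2] bounded gives a Hankel Schur multiplier
    ([hankel_schur_criterion]).  Let [phi] be supported by lacunary windows
    starting at [8 q_m], with constant modulus [sqrt(2 / L_m)] on the window [m] of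
    length [L_m], and let the phases on the windows run through all finite
    patterns of the four numbers [+-1 +- i].  Take
    [x = sum_j 2^-j N_j^-1 z^(N_j) (sum_(n < N_j) z^n)^2] with [N_j = q_j >= 16^j].
    Its [j]-th block has norm [2^-j] in [H^1], so [x] is in [H^1], and its
    coefficients are nonnegative.  Shifting [x] by [k = 8 q_m] aligns the window
    [m] with the first [L_m] coefficients of [x]; the other terms of the first
    blocks, and all later blocks, fall into the gaps between the windows.  At a
    given point [z] of the circle, choose the pattern [s] of length [3 N_j] whose
    phases turn every [z^n] towards the positive real axis: then
    [|M_phi (z^k x)|] at [z] is at least the sum of the coefficients of the block
    [j] divided by [sqrt(3 N_j)], that is [2^-j sqrt(N_j / 3) >= 2^j / 2].  Hence
    the maximal function is infinite at every point
    ([symbol_not_shift_bounded]). *)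

Set Implicit Arguments.
Unset Strict Implicit.
Unset Printing Implicit Defensive.

Import Order.TTheory GRing.Theory Num.Theory.
Import numFieldNormedType.Exports.

Local Open Scope classical_set_scope.
Local Open Scope ring_scope.
Local Open Scope complex_scope.

(** * The modulus of a complex number *)

Section Modulus.
Variable R : realType.
Implicit Types z w : R[i].

Lemma modcC z : (modc z)%:C = `|z|.
Proof. by rewrite /modc normc_def. Qed.

Lemma modc_ge0 z : 0 <= modc z.
Proof. by rewrite /modc normc_def /= sqrtr_ge0. Qed.

Lemma sqr_modc z : modc z ^+ 2 = complex.Re z ^+ 2 + complex.Im z ^+ 2.
Proof.
by rewrite /modc normc_def /= sqr_sqrtr// addr_ge0// sqr_ge0.
Qed.

Lemma modcM z w : modc (z * w) = modc z * modc w.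
Proof. by apply: (@complexI R); rewrite rmorphM/= !modcC normrM. Qed.

Lemma modcD z w : modc (z + w) <= modc z + modc w.
Proof. by rewrite -lecR rmorphD/= !modcC ler_normD. Qed.

Lemma modc0 : modc (0 : R[i]) = 0.
Proof. by rewrite /modc normr0. Qed.

Lemma modc1 : modc (1 : R[i]) = 1.
Proof. by rewrite /modc normr1. Qed.

Lemma modcN z : modc (- z) = modc z.
Proof. by rewrite /modc normrN. Qed.

Lemma modcB z w : modc (z - w) = modc (w - z).
Proof. by rewrite -modcN opprB. Qed.

Lemma modcX z n : modc (z ^+ n) = modc z ^+ n.
Proof. by elim: n => [|n ih]; rewrite ?modc1// !exprS modcM ih. Qed.

Lemma modcJ z : modc z^* = modc z.
Proof. by rewrite /modc normcJ. Qed.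

Lemma modc_eq0 z : (modc z == 0) = (z == 0).
Proof. by rewrite -(normr_eq0 z) -modcC fmorph_eq0. Qed.

Lemma modc_real (x : R) : modc x%:C = `|x|.
Proof. by rewrite /modc normc_def /= expr0n addr0 sqrtr_sqr. Qed.

Lemma sqr_modcC z : ((modc z) ^+ 2)%:C = z * z^*.
Proof. by rewrite rmorphXn/= modcC sqr_normc. Qed.

Lemma modc_sum (I : Type) (r : seq I) (P : pred I) (f : I -> R[i]) :
  modc (\sum_(i <- r | P i) f i) <= \sum_(i <- r | P i) modc (f i).
Proof.
elim/big_rec2 : _ => [|i y1 y2 Pi h]; first by rewrite modc0.
by apply: (le_trans (modcD _ _)); rewrite lerD2l.
Qed.

Lemma Re_le_modc z : `|complex.Re z| <= modc z.
Proof.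
rewrite -(@ler_pXn2r _ 2)// ?nnegrE ?modc_ge0//.
by rewrite real_normK ?num_real// sqr_modc lerDl sqr_ge0.
Qed.

Lemma Im_le_modc z : `|complex.Im z| <= modc z.
Proof.
rewrite -(@ler_pXn2r _ 2)// ?nnegrE ?modc_ge0//.
by rewrite real_normK ?num_real// sqr_modc lerDr sqr_ge0.
Qed.

Lemma modc_le_ReIm z : modc z <= `|complex.Re z| + `|complex.Im z|.
Proof.
rewrite -(@ler_pXn2r _ 2)// ?nnegrE ?modc_ge0// ?addr_ge0//.
rewrite sqr_modc sqrrD !real_normK ?num_real//.
by rewrite -addrA lerD2l lerDr mulrn_wge0// mulr_ge0.
Qed.

End Modulus.

(** * Bilinear forms on finite-dimensional Hilbert spaces *)

Section FiniteL2.
Variable R : realType.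

Definition l2norm (I : finType) (f : I -> R[i]) : R :=
  Num.sqrt (\sum_i modc (f i) ^+ 2).

Lemma sqr_l2norm (I : finType) (f : I -> R[i]) :
  l2norm f ^+ 2 = \sum_i modc (f i) ^+ 2.
Proof. by rewrite sqr_sqrtr// sumr_ge0// => i _; rewrite sqr_ge0. Qed.

Lemma l2norm_ge0 (I : finType) (f : I -> R[i]) : 0 <= l2norm f.
Proof. exact: sqrtr_ge0. Qed.

Lemma real_cauchy_schwarz (I : finType) (a b : I -> R) :
  (\sum_i a i * b i) ^+ 2 <= (\sum_i a i ^+ 2) * (\sum_i b i ^+ 2).
Proof.
have h : 0 <= \sum_i \sum_j (a i * b j - a j * b i) ^+ 2.
  by apply: sumr_ge0 => i _; apply: sumr_ge0 => j _; exact: sqr_ge0.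
have e : \sum_i \sum_j (a i * b j - a j * b i) ^+ 2 =
  (\sum_i a i ^+ 2) * (\sum_i b i ^+ 2) *+ 2 - (\sum_i a i * b i) ^+ 2 *+ 2.
  transitivity (\sum_i \sum_j (a i ^+ 2 * b j ^+ 2 + b i ^+ 2 * a j ^+ 2
     - (a i * b i) * (a j * b j) *+ 2)).
    by apply: eq_bigr => i _; apply: eq_bigr => j _; ring.
  under eq_bigr do rewrite sumrB big_split/= -!mulr_sumr.
  rewrite sumrB big_split/= -!mulr_suml.
  rewrite [X in _ - X](_ : _ = (\sum_i a i * b i) ^+ 2 *+ 2); last first.
    rewrite expr2 mulr_suml -sumrMnl; apply: eq_bigr => i _.
    by rewrite sumrMnl -mulr_sumr.
  by rewrite mulr2n; congr (_ - _); rewrite [X in _ + X]mulrC.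
by move: h; rewrite e -mulrnBl pmulrn_lge0// subr_ge0.
Qed.

Lemma le_sqrt_sqrt (x u v : R) : 0 <= u -> x ^+ 2 <= u * v ->
  x <= Num.sqrt u * Num.sqrt v.
Proof.
move=> u0 h; rewrite -sqrtrM//; apply: (le_trans (ler_norm _)).
by rewrite -sqrtr_sqr ler_wsqrtr.
Qed.

Lemma real_cauchy_schwarz_sqrt (I : finType) (a b : I -> R) :
  \sum_i a i * b i <=
    Num.sqrt (\sum_i a i ^+ 2) * Num.sqrt (\sum_i b i ^+ 2).
Proof.
apply: le_sqrt_sqrt; last exact: real_cauchy_schwarz.
by apply: sumr_ge0 => i _; exact: sqr_ge0.
Qed.

Lemma l2norm_cauchy_schwarz (I : finType) (f g : I -> R[i]) :
  modc (\sum_i f i * g i) <= l2norm f * l2norm g.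
Proof.
apply: (le_trans (modc_sum _ _ _)).
under eq_bigr do rewrite modcM.
exact: real_cauchy_schwarz_sqrt.
Qed.

Lemma eq_l2norm (I : finType) (f g : I -> R[i]) : f =1 g -> l2norm f = l2norm g.
Proof. by move=> fg; rewrite /l2norm; under eq_bigr do rewrite fg. Qed.

Lemma l2normJ (I : finType) (f : I -> R[i]) :
  l2norm (fun i => (f i)^*) = l2norm f.
Proof. by rewrite /l2norm; under eq_bigr do rewrite modcJ. Qed.

Lemma ler_l2norm (I J : finType) (f : I -> R[i]) (g : J -> R[i]) :
  \sum_i modc (f i) ^+ 2 <= \sum_j modc (g j) ^+ 2 -> l2norm f <= l2norm g.
Proof. exact: ler_wsqrtr. Qed.

(** The bilinear form with matrix [Y] has norm at most [c]; this is also the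
    operator norm of [Y], without reference to adjoints. *)
Definition form_bound (I J : finType) (c : R) (Y : I -> J -> R[i]) :=
  forall xi eta, modc (\sum_i \sum_j Y i j * xi i * eta j) <=
    c * l2norm xi * l2norm eta.

Lemma eq_form_bound (I J : finType) (c : R) (Y Z : I -> J -> R[i]) :
  (forall i j, Y i j = Z i j) -> form_bound c Y -> form_bound c Z.
Proof.
move=> h hY xi eta; under eq_bigr do under eq_bigr do rewrite -h.
exact: hY.
Qed.

Lemma form_bound_row (I J : finType) (c : R) (Y : I -> J -> R[i]) : 0 <= c ->
  (forall eta, \sum_i modc (\sum_j Y i j * eta j) ^+ 2 <=
     c ^+ 2 * \sum_j modc (eta j) ^+ 2) -> form_bound c Y.
Proof.
move=> c0 h xi eta.
have -> : \sum_i \sum_j Y i j * xi i * eta j =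
   \sum_i xi i * (\sum_j Y i j * eta j).
  apply: eq_bigr => i _; rewrite mulr_sumr; apply: eq_bigr => j _; ring.
apply: (le_trans (l2norm_cauchy_schwarz _ _)).
rewrite -mulrA mulrCA ler_wpM2l ?l2norm_ge0//.
rewrite -(ger0_norm c0) -sqrtr_sqr -sqrtrM ?sqr_ge0//.
exact: ler_wsqrtr.
Qed.

(** Test the form on the conjugate of the image of [eta]. *)
Lemma form_boundP (I J : finType) (c : R) (Y : I -> J -> R[i]) : 0 <= c ->
  form_bound c Y -> forall eta, \sum_i modc (\sum_j Y i j * eta j) ^+ 2 <=
     c ^+ 2 * \sum_j modc (eta j) ^+ 2.
Proof.
move=> c0 h eta; set w := fun i => \sum_j Y i j * eta j.
rewrite -2!sqr_l2norm.
have [->|w0] := eqVneq (l2norm w) 0.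
  by rewrite expr0n /= mulr_ge0 ?sqr_ge0.
have wgt0 : 0 < l2norm w by rewrite lt_def w0 l2norm_ge0.
have := h (fun i => (w i)^*) eta.
have -> : \sum_i \sum_j Y i j * (w i)^* * eta j = ((l2norm w) ^+ 2)%:C.
  rewrite sqr_l2norm rmorph_sum/=; apply: eq_bigr => i _.
  rewrite sqr_modcC {2}/w mulr_suml; apply: eq_bigr => j _; ring.
rewrite modc_real ger0_norm ?sqr_ge0// l2normJ => le.
have {}le : l2norm w <= c * l2norm eta.
  by rewrite -(ler_pM2r wgt0) -expr2 mulrAC.
by rewrite -exprMn ler_pXn2r// nnegrE ?mulr_ge0 ?l2norm_ge0.
Qed.

Lemma form_boundZ (I J : finType) (c : R) (a : R[i]) (Y : I -> J -> R[i]) :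
  form_bound c Y -> form_bound (modc a * c) (fun i j => a * Y i j).
Proof.
move=> h xi eta.
have -> : \sum_i \sum_j a * Y i j * xi i * eta j =
  a * \sum_i \sum_j Y i j * xi i * eta j.
  rewrite mulr_sumr; apply: eq_bigr => i _; rewrite mulr_sumr.
  by apply: eq_bigr => j _; rewrite !mulrA.
by rewrite modcM -!mulrA ler_wpM2l ?modc_ge0// mulrA.
Qed.

End FiniteL2.

(** * Triangular factorization with Hilbert-Schmidt factors *)

Section Factorization.
Variable R : realType.

Lemma conj_real (x : R) : (x%:C)^* = x%:C :> R[i].
Proof. exact: conjc_real. Qed.

Lemma conj_div_real (z : R[i]) (x : R) : (z / x%:C)^* = z^* / x%:C.
Proof. by rewrite rmorphM fmorphV; congr (_ * _^-1); exact: conj_real. Qed.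

(** Expand the squared distance of [eta] to [sum_k c_k B_k], where [c_k] is the
    coefficient of [eta] along [B_k]; since the [B_k] are orthogonal of norm at
    most 1, it is at most [|eta|^2 - sum_k |c_k|^2]. *)
Lemma bessel (K J : finType) (B : K -> J -> R[i]) (eta : J -> R[i]) :
  (forall k l, k != l -> \sum_j B k j * (B l j)^* = 0) ->
  (forall k, \sum_j modc (B k j) ^+ 2 <= 1) ->
  \sum_k modc (\sum_j (B k j)^* * eta j) ^+ 2 <= \sum_j modc (eta j) ^+ 2.
Proof.
move=> orth nB; set c := fun k => \sum_j (B k j)^* * eta j.
pose b k := \sum_j modc (B k j) ^+ 2.
have e1 k : \sum_j eta j * (c k * B k j)^* = (modc (c k) ^+ 2)%:C.
  rewrite sqr_modcC mulrC {2}/c mulr_sumr; apply: eq_bigr => j _.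
  by rewrite rmorphM/=; ring.
have e2 k : \sum_j c k * B k j * (eta j)^* = (modc (c k) ^+ 2)%:C.
  rewrite sqr_modcC {3}/c rmorph_sum mulr_sumr; apply: eq_bigr => j _.
  by rewrite rmorphM/= conjCK mulrA.
have e3 k l : \sum_j (c k * B k j) * (c l * B l j)^* =
    if k == l then (modc (c k) ^+ 2 * b k)%:C else 0.
  have -> : \sum_j (c k * B k j) * (c l * B l j)^* =
      c k * (c l)^* * \sum_j B k j * (B l j)^*.
    by rewrite mulr_sumr; apply: eq_bigr => j _; rewrite rmorphM/=; ring.
  case: eqVneq => [<-|/orth ->]; last by rewrite mulr0.
  rewrite -sqr_modcC [RHS]rmorphM/= /b rmorph_sum/=; congr (_ * _).
  by apply: eq_bigr => j _; rewrite sqr_modcC.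
have key : \sum_j modc (eta j - \sum_k c k * B k j) ^+ 2 =
  \sum_j modc (eta j) ^+ 2 - \sum_k modc (c k) ^+ 2 - \sum_k modc (c k) ^+ 2
   + \sum_k modc (c k) ^+ 2 * b k.
  apply: (@complexI R); rewrite rmorph_sum/=.
  transitivity (\sum_j (eta j * (eta j)^* - \sum_k eta j * (c k * B k j)^*
     - \sum_k c k * B k j * (eta j)^*
     + \sum_k \sum_l (c k * B k j) * (c l * B l j)^*)).
    apply: eq_bigr => j _; rewrite sqr_modcC rmorphB/= rmorph_sum/=.
    by rewrite -big_distrlr/= -mulr_sumr -mulr_suml; ring.
  rewrite !big_split/= !sumrN !rmorphD/= !rmorphN/= !rmorph_sum/=.
  congr (_ - _ - _ + _).
  - by apply: eq_bigr => j _; rewrite sqr_modcC.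
  - by rewrite exchange_big/=; apply: eq_bigr => k _; exact: e1.
  - by rewrite exchange_big/=; apply: eq_bigr => k _; exact: e2.
  - rewrite exchange_big/=; apply: eq_bigr => k _.
    rewrite exchange_big/=; under eq_bigr do rewrite e3.
    by rewrite -big_mkcond/= (big_pred1 k)//= => l; rewrite eq_sym.
have : 0 <= \sum_j modc (eta j - \sum_k c k * B k j) ^+ 2.
  by apply: sumr_ge0 => j _; exact: sqr_ge0.
rewrite key; have : \sum_k modc (c k) ^+ 2 * b k <= \sum_k modc (c k) ^+ 2.
  by apply: ler_sum => k _; rewrite ler_piMr ?sqr_ge0// nB.
by lra.
Qed.

Section Matrices.
Variables (n m : nat) (L : 'M[R[i]]_(n, m)) (tau eps : R).
Hypothesis eps0 : 0 < eps.
Hypothesis dualL : forall Y : 'I_n -> 'I_m -> R[i], form_bound 1 Y ->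
  modc (\sum_i \sum_j Y i j * L i j) <= tau.

Local Open Scope sesquilinear_scope.

Lemma mulmx_trmxC_sum p q (A : 'M[R[i]]_(p, q)) i :
  (A *m A ^t*) i i = (\sum_j modc (A i j) ^+ 2)%:C.
Proof.
rewrite mxE rmorph_sum/=; apply: eq_bigr => j _.
by rewrite !mxE -sqr_modcC.
Qed.

Lemma unitary_row_norm p q (U : 'M[R[i]]_(p, q)) k : U \is unitarymx ->
  \sum_i modc (U k i) ^+ 2 = 1.
Proof.
move=> /unitarymxP UU; apply: (@complexI R).
by rewrite -mulmx_trmxC_sum UU mxE eqxx mulr1n.
Qed.

Lemma unitary_bessel (U : 'M[R[i]]_n) (xi : 'I_n -> R[i]) : U \is unitarymx ->
  \sum_k modc (\sum_i U k i * xi i) ^+ 2 <= \sum_i modc (xi i) ^+ 2.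
Proof.
move=> uU; have /unitarymxP UU := uU.
pose B (k i : 'I_n) := (U k i)^*.
have -> : \sum_k modc (\sum_i U k i * xi i) ^+ 2 =
    \sum_k modc (\sum_i (B k i)^* * xi i) ^+ 2.
  by under [RHS]eq_bigr do under eq_bigr do rewrite conjCK.
apply: bessel => [k l kl|k].
  have /matrixP/(_ l k) := UU; rewrite !mxE eq_sym (negbTE kl) mulr0n => e.
  by rewrite -[RHS]e; apply: eq_bigr => i _; rewrite !mxE conjCK mulrC.
under eq_bigr do rewrite modcJ.
by rewrite unitary_row_norm.
Qed.

(** Split the singular values [s] evenly between the two factors.  With
    [L L^* = U^* diag(s^2) U], take [A = U^* diag(sqrt(s+eps))] and
    [D = A^-1 L]: the squared Hilbert-Schmidt norms are [sum (s+eps)] and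
    [sum s^2/(s+eps)], and the latter is the value of [L] on an explicit form
    of norm at most 1.  The summand [eps] makes [A] invertible. *)
Lemma square_root_factorization :
  exists (A : 'M[R[i]]_n) (D : 'M[R[i]]_(n, m)),
   [/\ L = A *m D, A \in unitmx,
     \sum_i \sum_j modc (A i j) ^+ 2 <= tau + 2 * n%:R * eps &
     \sum_i \sum_j modc (D i j) ^+ 2 <= tau].
Proof.
pose U := spectralmx (L *m L ^t*).
have uU : U \is unitarymx by exact: spectral_unitarymx.
have /unitarymxP UU := uU.
have UU' : U ^t* *m U = 1%:M by rewrite -invmx_unitary// mulVmx// unitarymx_unit.
pose V := U *m L.
pose d := spectral_diag (L *m L ^t*).
have VV : V *m V ^t* = diag_mx d.
  have : L *m L ^t* \is normalmx.
    apply/normalmxP; rewrite trmx_mul map_mxM/=.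
    by rewrite map_trmx trmxK -map_mx_comp (map_mx_id (@conjCK _)).
  move=> /orthomx_spectralP; rewrite -/U -/d invmx_unitary// => e.
  rewrite /V trmx_mul map_mxM/= mulmxA -(mulmxA U) e.
  by rewrite !mulmxA UU mul1mx -mulmxA UU mulmx1.
pose lam k := \sum_j modc (V k j) ^+ 2.
have lam0 k : 0 <= lam k by apply: sumr_ge0 => j _; exact: sqr_ge0.
pose s k := Num.sqrt (lam k).
have s0 k : 0 <= s k by exact: sqrtr_ge0.
have s2 k : s k ^+ 2 = lam k by exact: sqr_sqrtr.
have sp k : 0 < s k + eps by rewrite ltr_wpDl.
have orthV k l : k != l -> \sum_j V k j * (V l j)^* = 0.
  move=> kl; have /matrixP/(_ k l) := VV; rewrite !mxE (negbTE kl) mulr0n => e.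
  by rewrite -[RHS]e; apply: eq_bigr => j _; rewrite !mxE.
pose al k := Num.sqrt (s k + eps).
have al2 k : al k ^+ 2 = s k + eps by rewrite sqr_sqrtr// ltW.
have al0 k : 0 < al k by rewrite sqrtr_gt0.
pose A := \matrix_(i < n, k < n) ((U k i)^* * (al k)%:C).
pose D := \matrix_(k < n, j < m) ((al k)^-1%:C * V k j).
have eV k j : V k j = \sum_i U k i * L i j by rewrite mxE.
have eA i k : A i k = (U k i)^* * (al k)%:C by rewrite mxE.
have eD k j : D k j = (al k)^-1%:C * V k j by rewrite mxE.
have LAD : L = A *m D.
  rewrite -[LHS]mul1mx -UU' -mulmxA; apply/matrixP => i j.
  rewrite [LHS]mxE [RHS]mxE; apply: eq_bigr => k _; rewrite -/V eA eD.
  have h : (al k)%:C * (al k)^-1%:C = 1 :> R[i].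
    by rewrite -rmorphM/= divff ?gt_eqF.
  have -> : (U ^t*) i k = (U k i)^* by rewrite !mxE.
  by rewrite -[LHS]mul1r -h; ring.
have tauE : \sum_k lam k / (s k + eps) <= tau.
  (* [Y] is [U] followed by the nearly orthonormal rows [V k / (s k + eps)]:
     both act as contractions *)
  pose Y (i : 'I_n) (j : 'I_m) := \sum_k U k i * (V k j / (s k + eps)%:C)^*.
  have := @dualL Y; have -> : \sum_i \sum_j Y i j * L i j =
      (\sum_k lam k / (s k + eps))%:C.
    rewrite rmorph_sum/=.
    transitivity (\sum_k \sum_j \sum_i
       U k i * (V k j / (s k + eps)%:C)^* * L i j).
      under [LHS]eq_bigr do under eq_bigr do rewrite mulr_suml.
      rewrite exchange_big/=; under [LHS]eq_bigr do rewrite exchange_big/=.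
      by rewrite exchange_big.
    apply: eq_bigr => k _; rewrite rmorphM/= fmorphV/= /lam rmorph_sum/=.
    rewrite mulr_suml; apply: eq_bigr => j _.
    rewrite sqr_modcC {2}eV !mulr_suml; apply: eq_bigr => i _.
    transitivity (U k i * ((V k j)^* / (s k + eps)%:C) * L i j); last by ring.
    by congr (_ * _ * _); exact: conj_div_real.
  rewrite modc_real ger0_norm; last first.
    by apply: sumr_ge0 => k _; rewrite divr_ge0// ltW.
  apply; move=> xi eta.
  have -> : \sum_i \sum_j Y i j * xi i * eta j =
     \sum_k (\sum_i U k i * xi i) * (\sum_j (V k j / (s k + eps)%:C)^* * eta j).
    transitivity (\sum_k \sum_i \sum_j
        U k i * (V k j / (s k + eps)%:C)^* * xi i * eta j).
      under [LHS]eq_bigr do under eq_bigr do rewrite -mulrA mulr_suml.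
      under [LHS]eq_bigr do rewrite exchange_big/=.
      rewrite exchange_big/=; apply: eq_bigr => k _; apply: eq_bigr => i _.
      by apply: eq_bigr => j _; ring.
    apply: eq_bigr => k _; rewrite mulr_suml; apply: eq_bigr => i _.
    by rewrite mulr_sumr; apply: eq_bigr => j _; ring.
  apply: (le_trans (l2norm_cauchy_schwarz _ _)); rewrite mul1r.
  apply: ler_pM; rewrite ?l2norm_ge0//.
    by apply: ler_l2norm; exact: unitary_bessel.
  apply: ler_l2norm; apply: bessel => [k l kl|k].
    have -> : \sum_j V k j / (s k + eps)%:C * (V l j / (s l + eps)%:C)^* =
      ((s k + eps)^-1 * (s l + eps)^-1)%:C * \sum_j V k j * (V l j)^*.
      rewrite mulr_sumr; apply: eq_bigr => j _.
      transitivity (V k j / (s k + eps)%:C * ((V l j)^* / (s l + eps)%:C)).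
        by congr (_ * _); exact: conj_div_real.
      by rewrite rmorphM/= !fmorphV/=; ring.
    by rewrite orthV// mulr0.
  have -> : \sum_j modc (V k j / (s k + eps)%:C) ^+ 2 =
     (s k + eps)^-2 * lam k.
    rewrite /lam mulr_sumr; apply: eq_bigr => j _.
    rewrite modcM -fmorphV/= modc_real exprMn mulrC; congr (_ * _).
    by rewrite ger0_norm ?exprVn// invr_ge0 ltW.
  rewrite mulrC ler_pdivrMr ?exprn_gt0// mul1r -s2.
  by rewrite ler_pXn2r ?nnegrE ?s0 ?(ltW (sp k))// lerDl ltW.
exists A, D; split => //.
- rewrite -(mulmx1 A); have -> : A = U ^t* *m diag_mx (\row_k (al k)%:C).
    apply/matrixP => i k; rewrite mul_mx_diag !mxE; ring.
  rewrite mulmx1 unitmx_mul unitarymx_unit ?trmxC_unitary//=.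
  rewrite unitmxE det_diag unitfE; apply/prodf_neq0 => k _.
  by rewrite mxE fmorph_eq0 gt_eqF.
- rewrite exchange_big/=; apply: (@le_trans _ _ (\sum_k (s k + eps))).
    apply: ler_sum => k _.
    under eq_bigr do rewrite eA modcM modcJ modc_real exprMn real_normK ?num_real// al2.
    rewrite -mulr_suml ler_piMl ?(ltW (sp _))//.
    by rewrite unitary_row_norm.
  apply: (@le_trans _ _ (\sum_k (lam k / (s k + eps) + 2 * eps))).
    apply: ler_sum => k _; rewrite -s2 -lerBlDr ler_pdivlMr//.
    have := s0 k; have := eps0; nra.
  rewrite big_split/= sumr_const card_ord; apply: lerD => //.
  by rewrite -mulr_natl; lra.
- apply: le_trans tauE; apply: ler_sum => k _.
  under eq_bigr do rewrite eD modcM modc_real exprMn real_normK ?num_real//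
    exprVn al2.
  by rewrite -mulr_sumr mulrC.
Qed.

End Matrices.
Local Open Scope sesquilinear_scope.

(** The first [i + 1] rows of [A] lie in the span of the first [i + 1] vectors
    of its Gram-Schmidt basis. *)
Lemma row_schmidt_orth n (A : 'M[R[i]]_n) (i k : 'I_n) : (i < k)%N ->
  (A *m (schmidt A) ^t*) i k = 0.
Proof.
move=> ik; set W := schmidt A.
have uW : W \is unitarymx by exact: schmidt_unitarymx.
suff : (row i A <= kermx ((row k W) ^t*))%MS.
  move=> /sub_kermxP /matrixP/(_ 0 0); rewrite !mxE => e; rewrite -[RHS]e.
  by apply: eq_bigr => j _; rewrite !mxE.
apply: (submx_trans (row_schmidt_sub A i)); apply/sumsmx_subP => l li.
rewrite genmxE; apply/sub_kermxP/matrixP => a b; rewrite !ord1 !mxE.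
have /unitarymxP/matrixP/(_ l k) := uW; rewrite !mxE -val_eqE/=.
rewrite ltn_eqF ?(leq_ltn_trans li)// mulr0n => e; rewrite -[RHS]e.
by apply: eq_bigr => j _; rewrite !mxE.
Qed.

(** Row by row: in row [i] of [G X = 1] only the term [G i i * X i k] is left. *)
Lemma inverse_lower_triangular n (G X : 'M[R[i]]_n) : X *m G = 1%:M ->
  (forall i k : 'I_n, (i < k)%N -> G i k = 0) ->
  forall i k : 'I_n, (i < k)%N -> X i k = 0.
Proof.
move=> XG Glow.
have GX : G *m X = 1%:M by exact: mulmx1C.
have Gd i : G i i != 0.
  have : \det G != 0.
    rewrite -unitfE -unitmxE; exact: (mulmx1_unit GX).1.
  rewrite det_trig; last by apply/is_trig_mxP => a b; exact: Glow.
  by move=> /prodf_neq0/(_ i isT).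
move=> i k; move: {2}(i : nat).+1 (ltnSn i) => N; elim: N i => // N ih i iN ik.
have /matrixP/(_ i k) := GX; rewrite !mxE -val_eqE/= ltn_eqF// mulr0n.
rewrite (bigD1 i)//= big1 ?addr0 => [/eqP|j ji].
  by rewrite mulf_eq0 (negbTE (Gd i))/= => /eqP.
have [ij|ij] := ltnP i j; first by rewrite Glow// mul0r.
have {}ij : (j < i)%N by rewrite ltn_neqAle ij andbT; exact: ji.
by rewrite ih ?mulr0//; [exact: leq_trans ij iN | exact: ltn_trans ij ik].
Qed.

(** Write [L = A D] as above and let [W] be the unitary matrix of the
    Gram-Schmidt basis of the rows of [A]: then [G = A W^*] is lower triangular
    with the Hilbert-Schmidt norm of [A], and [H = W D] with that of [D].
    Moreover [H = X L] for the lower triangular [X = G^-1], so that [H] inherits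
    the zeros of [L] for any grading of the columns. *)
Lemma triangular_matrix_factorization n m (L : 'M[R[i]]_(n, m)) (tau eps : R) :
  0 < eps ->
  (forall Y : 'I_n -> 'I_m -> R[i], form_bound 1 Y ->
    modc (\sum_i \sum_j Y i j * L i j) <= tau) ->
  exists G X : 'M[R[i]]_n, let H := X *m L in
   [/\ L = G *m H, (forall i k : 'I_n, (i < k)%N -> G i k = 0 /\ X i k = 0),
     \sum_i \sum_j modc (G i j) ^+ 2 <= tau + eps &
     \sum_i \sum_j modc (H i j) ^+ 2 <= tau].
Proof.
move=> eps0 hL.
have d0 : 0 < 2 * n%:R + 1 :> R by rewrite ltr_wpDl// mulr_ge0.
have e'0 : 0 < eps / (2 * n%:R + 1) by rewrite divr_gt0.
have [A [D [LAD uA nA nD]]] := square_root_factorization e'0 hL.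
pose W := schmidt A.
have uW : W \is unitarymx by exact: schmidt_unitarymx.
have WW : W ^t* *m W = 1%:M by rewrite -invmx_unitary// mulVmx// unitarymx_unit.
have /unitarymxP WW' := uW.
pose G := A *m W ^t*; pose X := W *m invmx A.
have XG : X *m G = 1%:M by rewrite /X /G mulmxA mulmxKV.
have Glow (i k : 'I_n) : (i < k)%N -> G i k = 0 by exact: row_schmidt_orth.
have HE : X *m L = W *m D by rewrite LAD /X -mulmxA mulKmx.
exists G, X; split.
- by rewrite mulmxA (mulmx1C XG) mul1mx.
- by move=> i k ik; split; [exact: Glow | exact: (inverse_lower_triangular XG)].
- apply: (@le_trans _ _ (tau + 2 * n%:R * (eps / (2 * n%:R + 1)))); last first.
    by rewrite lerD2l mulrCA ger_pMr// ler_pdivrMr// mul1r lerDl.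
  apply: le_trans nA; apply: ler_sum => i _.
  have := @unitary_bessel n (map_mx Num.conj W) (fun j => A i j).
  rewrite conjC_unitary => /(_ uW); apply: le_trans.
  apply: ler_sum => k _; rewrite le_eqVlt; apply/orP; left; apply/eqP.
  congr (modc _ ^+ 2); rewrite mxE; apply: eq_bigr => j _.
  by rewrite !mxE mulrC.
- rewrite HE; apply: le_trans nD.
  rewrite exchange_big/= [leRHS]exchange_big/=; apply: ler_sum => j _.
  apply: le_trans (unitary_bessel (fun i => D i j) uW).
  by apply: ler_sum => k _; rewrite mxE.
Qed.

(** Reduces block triangular matrices, with blocks given by degrees, to
    triangular ones. *)
Lemma graded_enumeration (I : finType) (deg : I -> nat) :
  exists2 e : 'I_#|I| -> I, bijective e &
    forall r s : 'I_#|I|, (r <= s)%N -> (deg (e r) <= deg (e s))%N.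
Proof.
pose t := sort_tuple (fun x y => (deg x <= deg y)%N) (enum_tuple I).
exists (tnth t).
  apply: inj_card_bij; last by rewrite card_ord.
  apply/tuple_uniqP; rewrite sort_uniq; exact: enum_uniq.
move=> r s rs; have x0 := tnth t r; rewrite !(tnth_nth x0).
pose leD x y := (deg x <= deg y)%N.
have leD_trans : transitive leD by move=> y x z; exact: leq_trans.
have leD_refl : reflexive leD by move=> x; exact: leqnn.
have st : sorted leD t by apply: sort_sorted => x y; exact: leq_total.
by apply: (sorted_leq_nth leD_trans leD_refl x0 st); rewrite ?inE ?size_tuple.
Qed.

(** The factorization of a block lower triangular [L] into a sum of rank one
    matrices [g r (x) h r], each of which is supported by the rectangle
    [degJ j <= k r <= degI i]. *)
Lemma triangular_factorization (I J : finType) (degI : I -> nat)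
    (degJ : J -> nat) (L : I -> J -> R[i]) (tau eps : R) : 0 < eps ->
  (forall Y : I -> J -> R[i], form_bound 1 Y ->
    modc (\sum_i \sum_j Y i j * L i j) <= tau) ->
  (forall i j, (degI i < degJ j)%N -> L i j = 0) ->
  exists n (g : 'I_n -> I -> R[i]) (h : 'I_n -> J -> R[i]) (k : 'I_n -> nat),
   [/\ forall i j, L i j = \sum_r g r i * h r j,
       forall r i, (degI i < k r)%N -> g r i = 0,
       forall r j, (k r < degJ j)%N -> h r j = 0,
       \sum_r \sum_i modc (g r i) ^+ 2 <= tau + eps &
       \sum_r \sum_j modc (h r j) ^+ 2 <= tau].
Proof.
move=> eps0 hL Llow.
have [e be emono] := graded_enumeration degI.
have [f bf _] := graded_enumeration degJ.
have [ei eK Ke] := be; have [fi fK Kf] := bf.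
pose L' := \matrix_(r, c) L (e r) (f c).
have hL' (Y : 'I_#|I| -> 'I_#|J| -> R[i]) : form_bound 1 Y ->
    modc (\sum_i \sum_j Y i j * L' i j) <= tau.
  move=> hY; have := hL (fun i j => Y (ei i) (fi j)).
  have sumE (F : I -> J -> R[i]) : \sum_i \sum_j F i j =
      \sum_r \sum_c F (e r) (f c).
    rewrite (reindex e) /=; last exact: onW_bij.
    by apply: eq_bigr => r _; rewrite (reindex f)//=; exact: onW_bij.
  rewrite sumE => le; apply: le_trans (le _).
    under [in leRHS]eq_bigr do under eq_bigr do rewrite eK fK.
    by under [in leLHS]eq_bigr do under eq_bigr do rewrite mxE.
  move=> xi eta; rewrite sumE.
  under [in leLHS]eq_bigr do under eq_bigr do rewrite eK fK.
  have := hY (xi \o e) (eta \o f) => /le_trans; apply.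
  rewrite [l2norm xi](_ : _ = l2norm (xi \o e)); last first.
    by rewrite /l2norm (reindex e)//=; exact: onW_bij.
  rewrite [l2norm eta](_ : _ = l2norm (eta \o f))//.
  by rewrite /l2norm (reindex f)//=; exact: onW_bij.
have [G [X []]] := triangular_matrix_factorization eps0 hL'.
set H := X *m L' => LGH low nG nH.
exists #|I|, (fun r i => G (ei i) r), (fun r j => H r (fi j)), (degI \o e).
split.
- move=> i j; have /matrixP/(_ (ei i) (fi j)) := LGH.
  by rewrite !mxE Ke Kf => ->.
- move=> r i /=; rewrite -{1}(Ke i) ltnNge => ir.
  rewrite (low _ _ _).1//; rewrite ltnNge; apply: contra ir; exact: emono.
- move=> r j /= rj; rewrite mxE; apply: big1 => s _.
  have [rs|sr] := ltnP r s; first by rewrite (low _ _ rs).2 mul0r.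
  rewrite mxE Llow ?mulr0// Kf; apply: leq_ltn_trans rj; exact: emono.
- apply: le_trans nG; rewrite exchange_big/= (reindex e)/=; last exact: onW_bij.
  by apply: ler_sum => r _; rewrite eK.
- apply: le_trans nH; apply: ler_sum => r _; rewrite (reindex f)/=; last exact: onW_bij.
  by apply: ler_sum => c _; rewrite fK.
Qed.

End Factorization.

(** * Schur multipliers acting on block forms *)

Section HankelSchur.
Variable R : realType.

(** The Hankel matrix of [phi] has norm at most [c] as a Schur multiplier of
    finite matrices. *)
Definition hankel_schur_bound (phi : nat -> R[i]) (c : R) :=
  forall n (Y : 'I_n -> 'I_n -> R[i]), form_bound 1 Y ->
    form_bound c (fun i j : 'I_n => phi (i + j)%N * Y i j).

Lemma l2norm_sum_fibres (P : finType) n (al : P -> 'I_n) (s : 'I_n -> R[i])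
    (u : P -> R[i]) : (forall i, \sum_(p | al p == i) modc (u p) ^+ 2 <= 1) ->
  l2norm (fun p => s (al p) * u p) <= l2norm s.
Proof.
move=> hu; apply: ler_l2norm; rewrite (partition_big al xpredT)//=.
apply: ler_sum => i _; under eq_bigr => p /eqP -> do rewrite modcM exprMn.
by rewrite -mulr_sumr ler_piMr ?sqr_ge0.
Qed.

Lemma normalize_fibres (P : finType) n (al : P -> 'I_n) (xi : P -> R[i]) :
  exists (s : 'I_n -> R[i]) (u : P -> R[i]),
    [/\ forall p, xi p = s (al p) * u p,
        forall i, \sum_(p | al p == i) modc (u p) ^+ 2 <= 1 &
        l2norm s = l2norm xi].
Proof.
pose sr i := Num.sqrt (\sum_(p | al p == i) modc (xi p) ^+ 2).
have s2 i : sr i ^+ 2 = \sum_(p | al p == i) modc (xi p) ^+ 2.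
  by rewrite sqr_sqrtr// sumr_ge0// => p _; rewrite sqr_ge0.
exists (fun i => (sr i)%:C), (fun p => (sr (al p))^-1%:C * xi p); split.
- move=> p; rewrite mulrA -rmorphM/=.
  have [s0|s0] := eqVneq (sr (al p)) 0; last by rewrite divff ?mul1r.
  rewrite s0 mul0r mul0r; apply/eqP; rewrite -modc_eq0 -sqrf_eq0.
  have := s2 (al p); rewrite s0 expr0n/= => /esym/eqP.
  rewrite psumr_eq0 => [/allP/(_ p (mem_index_enum p))|q _]; last exact: sqr_ge0.
  by rewrite eqxx.
- move=> i; under eq_bigr => p /eqP -> do rewrite modcM modc_real exprMn.
  rewrite -mulr_sumr -s2 real_normK ?num_real//.
  have [->|s0] := eqVneq (sr i) 0; first by rewrite invr0 expr0n/= mul0r.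
  by rewrite -exprMn mulVf ?expr1n.
- rewrite /l2norm; congr (Num.sqrt _).
  rewrite [RHS](partition_big al xpredT)//=; apply: eq_bigr => i _.
  by rewrite modc_real real_normK ?num_real.
Qed.

(** A Schur multiplier acts on block forms with the same bound: write the
    arguments as [xi p = s (al p) * u p] with [u] of norm at most 1 on each block;
    pairing each block of [Z] with [u] and [v] leaves a contractive form [b] with
    scalar entries, to be evaluated on [s] and [t]. *)
Lemma schur_block (phi : nat -> R[i]) (c : R) (P Q : finType) n
    (al : P -> 'I_n) (be : Q -> 'I_n) (Z : P -> Q -> R[i]) :
  hankel_schur_bound phi c -> form_bound 1 Z ->
  form_bound c (fun p q => phi (al p + be q)%N * Z p q).
Proof.
move=> hphi hZ xi eta.
have [s [u [xiE nu <-]]] := normalize_fibres al xi.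
have [t [v [etaE nv <-]]] := normalize_fibres be eta.
pose b (i j : 'I_n) := \sum_(p | al p == i) \sum_(q | be q == j)
   Z p q * u p * v q.
have fibre (F : P -> Q -> R[i]) : \sum_p \sum_q F p q =
   \sum_i \sum_j \sum_(p | al p == i) \sum_(q | be q == j) F p q.
  rewrite (partition_big al xpredT)//=; apply: eq_bigr => i _.
  rewrite [RHS]exchange_big/=; apply: eq_bigr => p _.
  by rewrite (partition_big be xpredT).
have bound_b : form_bound 1 b.
  move=> x y; have := hZ (fun p => x (al p) * u p) (fun q => y (be q) * v q).
  rewrite fibre.
  have -> : \sum_i \sum_j b i j * x i * y j = \sum_(i < n) \sum_(j < n)
     \sum_(p | al p == i) \sum_(q | be q == j)
     Z p q * (x (al p) * u p) * (y (be q) * v q).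
    apply: eq_bigr => i _; apply: eq_bigr => j _.
    rewrite mulr_suml mulr_suml; apply: eq_bigr => p /eqP ->.
    rewrite mulr_suml mulr_suml; apply: eq_bigr => q /eqP ->; ring.
  move=> /le_trans; apply; rewrite !mul1r.
  by apply: ler_pM; rewrite ?l2norm_ge0// l2norm_sum_fibres.
have := hphi _ _ bound_b s t; rewrite fibre => h.
apply: le_trans h; rewrite le_eqVlt; apply/orP; left; apply/eqP; congr modc.
apply: eq_bigr => i _; apply: eq_bigr => j _.
rewrite /b mulr_sumr !mulr_suml; apply: eq_bigr => p /eqP pi.
rewrite mulr_sumr !mulr_suml; apply: eq_bigr => q /eqP qj.
by rewrite xiE etaE pi qj; ring.
Qed.

End HankelSchur.

(** * Multipliers of polynomials sampled at roots of unity *)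

Section RootsOfUnity.
Variables (R : realType) (K : nat) (w : R[i]).

(** Satisfied by the primitive [K]-th roots of unity. *)
Definition orthogonal_powers := forall i j, (i < K)%N -> (j < K)%N ->
  \sum_(q < K) (w ^+ (q * i)) * (w ^+ (q * j))^* = (if i == j then K%:R else 0).

Hypothesis w1 : modc w = 1.
Hypothesis ow : orthogonal_powers.

Lemma modc_unit_pow n : modc (w ^+ n) = 1.
Proof. by rewrite modcX w1 expr1n. Qed.

Lemma unit_pow_conj n : w ^+ n * (w ^+ n)^* = 1.
Proof. by rewrite -sqr_modcC modc_unit_pow expr1n. Qed.

Lemma sum_pair (V : nmodType) (I A : finType) (F : I * A -> V) :
  \sum_p F p = \sum_i \sum_a F (i, a).
Proof. by rewrite pair_bigA/=; apply: eq_bigr => -[]. Qed.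

Lemma sum_pair2 (V : nmodType) (I J A B : finType) (F : I * A -> J * B -> V) :
  \sum_p \sum_r F p r = \sum_a \sum_b \sum_i \sum_j F (i, a) (j, b).
Proof.
rewrite sum_pair exchange_big/=; apply: eq_bigr => a _.
under eq_bigr do rewrite sum_pair exchange_big/=.
by rewrite exchange_big.
Qed.

Lemma l2norm_tensor (A : finType) m (u : 'I_m -> R[i]) (xi : A -> R[i]) :
  (forall i, modc (u i) = 1) ->
  l2norm (fun p => u p.1 * xi p.2) = Num.sqrt m%:R * l2norm xi.
Proof.
move=> u1; rewrite /l2norm -sqrtrM ?ler0n//; congr Num.sqrt.
rewrite sum_pair/= -[m in RHS]card_ord -sumr_const mulr_suml.
apply: eq_bigr => i _; rewrite mul1r; apply: eq_bigr => a _.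
by rewrite modcM u1 mul1r.
Qed.

Lemma parseval (A : finType) m (x : 'I_m * A -> R[i]) : (m <= K)%N ->
  \sum_(q < K) \sum_a modc (\sum_(i < m) w ^+ (q * i) * x (i, a)) ^+ 2 =
  K%:R * \sum_p modc (x p) ^+ 2.
Proof.
move=> mK; rewrite sum_pair exchange_big/= [in RHS]exchange_big/= mulr_sumr.
apply: eq_bigr => a _; apply: (@complexI R).
rewrite !rmorphM/= !rmorph_sum/= rmorph_nat.
transitivity (\sum_(q < K) \sum_(i < m) \sum_(j < m)
    (x (i, a) * (x (j, a))^*) * ((w ^+ (q * i)) * (w ^+ (q * j))^*)).
  apply: eq_bigr => q _; rewrite sqr_modcC rmorph_sum/= big_distrlr/=.
  apply: eq_bigr => i _; apply: eq_bigr => j _; rewrite rmorphM/=; ring.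
rewrite exchange_big/= mulr_sumr; apply: eq_bigr => i _.
rewrite exchange_big/= (bigD1 i)//= [X in _ + X]big1 ?addr0 => [|j ji].
  by rewrite -mulr_sumr ow ?eqxx ?(leq_trans (ltn_ord _) mK)// -sqr_modcC mulrC.
rewrite -mulr_sumr ow ?(leq_trans (ltn_ord _) mK)//.
by rewrite val_eqE eq_sym (negbTE ji) mulr0.
Qed.

(** Let [f(z) = sum_(n < N) z^n c n], with matrix coefficients, be sampled at
    the powers of [w], where its values have dual norms at most [tau].  Its block
    Toeplitz matrix [L], with [K = 2 N] block rows and [N] block columns, has
    dual norm at most [sum tau] ([L_dual]).  Functionals [Y q] on the values of
    [M_phi f] combine into a contractive block form [Z] of the same size, and
    their total on [M_phi f] is [K/N = 2] times the pairing of [Z] with the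
    product of [phi (i - j)] and [L] ([toeplitz_pairing]). *)
Section DiscreteMultiplier.
Variables (A B : finType) (N : nat) (c : nat -> A -> B -> R[i]).
Variables (phi : nat -> R[i]) (C : R) (tau : 'I_K -> R).
Hypothesis K2 : K = N.*2.
Hypothesis N0 : (0 < N)%N.
Hypothesis C0 : 0 <= C.
Hypothesis hphi : hankel_schur_bound phi C.

Let NK : (N <= K)%N.
Proof. by rewrite K2 -addnn leq_addr. Qed.

Let K0 : K%:R != 0 :> R[i].
Proof. by rewrite pnatr_eq0 -lt0n (leq_trans N0 NK). Qed.

Let K0R : 0 < K%:R :> R.
Proof. by rewrite ltr0n (leq_trans N0 NK). Qed.

Let modcKV : modc (K%:R^-1 : R[i]) = K%:R^-1.
Proof.
rewrite -(rmorph_nat (real_complex R)) -fmorphV modc_real ger0_norm//.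
Qed.

Hypothesis htau : forall (q : 'I_K) (Y : A -> B -> R[i]), form_bound 1 Y ->
  modc (\sum_a \sum_b Y a b * \sum_(n < N) w ^+ (q * n) * c n a b) <= tau q.

Let L (p : 'I_K * A) (r : 'I_N * B) : R[i] :=
  \sum_(n < N) (p.1 == (r.1 + n)%N :> nat)%:R * c n p.2 r.2.

Let L_lower (p : 'I_K * A) (r : 'I_N * B) : (p.1 < r.1)%N -> L p r = 0.
Proof.
move=> pr; apply: big1 => n _.
by rewrite ltn_eqF ?mul0r// (leq_trans pr)// leq_addr.
Qed.

(** A form [X] on the blocks restricts to forms [Xq q] on the values of [f], by
    restriction to vectors of the type [(w^(q i) xi)_i]. *)
Let L_dual (X : 'I_K * A -> 'I_N * B -> R[i]) : form_bound 1 X ->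
  modc (\sum_p \sum_r X p r * L p r) <= \sum_q tau q.
Proof.
move=> hX.
pose Xq (q : 'I_K) a b := \sum_(i < K) \sum_(j < N)
  K%:R^-1 * (w ^+ (q * i))^* * w ^+ (q * j) * X (i, a) (j, b).
have -> : \sum_p \sum_r X p r * L p r =
   \sum_q \sum_a \sum_b Xq q a b * \sum_(n < N) w ^+ (q * n) * c n a b.
  rewrite sum_pair2 [RHS]exchange_big/=; apply: eq_bigr => a _.
  rewrite [RHS]exchange_big/=; apply: eq_bigr => b _.
  transitivity (\sum_(q < K) \sum_(i < K) \sum_(j < N) \sum_(n < N)
      X (i, a) (j, b) * c n a b * K%:R^-1 *
        (w ^+ (q * (j + n)) * (w ^+ (q * i))^*)); last first.
    apply: eq_bigr => q _; rewrite mulr_suml; apply: eq_bigr => i _.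
    rewrite mulr_suml; apply: eq_bigr => j _; rewrite mulr_sumr.
    by apply: eq_bigr => n _; rewrite mulnDr exprD; ring.
  rewrite [RHS]exchange_big/=; apply: eq_bigr => i _.
  rewrite [RHS]exchange_big/=; apply: eq_bigr => j _.
  rewrite [RHS]exchange_big/= mulr_sumr; apply: eq_bigr => n _.
  have jn : (j + n < K)%N by rewrite K2 -addnn -addSn leq_add// ltnW.
  rewrite -mulr_sumr ow// eq_sym; case: eqP => _; last by rewrite !(mul0r,mulr0).
  by rewrite mul1r -mulrA mulVf ?mulr1.
apply: (le_trans (modc_sum _ _ _)); apply: ler_sum => q _; apply: htau.
move=> xi eta.
have := hX (fun p => (w ^+ (q * p.1))^* * xi p.2)
           (fun r => w ^+ (q * r.1) * eta r.2).
rewrite mul1r.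
rewrite (@l2norm_tensor A K (fun i => (w ^+ (q * i))^*) xi) => [|i]; last first.
  by rewrite modcJ modc_unit_pow.
rewrite (@l2norm_tensor B N (fun j => w ^+ (q * j)) eta) => [|j]; last first.
  by rewrite modc_unit_pow.
set S := \sum_p _ => hS.
have -> : \sum_a \sum_b Xq q a b * xi a * eta b = K%:R^-1 * S.
  rewrite /S sum_pair2 mulr_sumr; apply: eq_bigr => a _.
  rewrite mulr_sumr; apply: eq_bigr => b _.
  rewrite mulr_sumr !mulr_suml; apply: eq_bigr => i _.
  rewrite mulr_sumr !mulr_suml; apply: eq_bigr => j _.
  by rewrite /=; ring.
rewrite modcM modcKV mul1r; apply: (le_trans (ler_wpM2l _ hS)).
  by rewrite invr_ge0 ltW.
rewrite [leLHS](_ : _ = K%:R^-1 * (Num.sqrt K%:R *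
  Num.sqrt N%:R) * (l2norm xi * l2norm eta)); last by ring.
apply: (@le_trans _ _ (1 * (l2norm xi * l2norm eta))); last by rewrite !mul1r.
apply: ler_wpM2r; first by rewrite mulr_ge0 ?l2norm_ge0.
rewrite mulrC ler_pdivrMr// mul1r -[leRHS]sqr_sqrtr ?ler0n// expr2.
by rewrite ler_wpM2l ?sqrtr_ge0// ler_wsqrtr// ler_nat.
Qed.

Variable Y : 'I_K -> A -> B -> R[i].
Hypothesis hY : forall q, form_bound 1 (Y q).

Let Z (p : 'I_K * A) (r : 'I_N * B) : R[i] :=
  K%:R^-1 * \sum_(q < K) w ^+ (q * p.1) * (w ^+ (q * r.1))^* * Y q p.2 r.2.

Let parsevalJ (x : 'I_N * B -> R[i]) :
  \sum_(q < K) \sum_b modc (\sum_(j < N) (w ^+ (q * j))^* * x (j, b)) ^+ 2 =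
  K%:R * \sum_p modc (x p) ^+ 2.
Proof.
have := parseval (fun p => (x p)^*) NK.
under [X in _ = _ * X]eq_bigr do rewrite modcJ.
move=> <-; apply: eq_bigr => q _; apply: eq_bigr => b _; congr (_ ^+ 2).
rewrite -modcJ rmorph_sum/=; congr modc; apply: eq_bigr => j _.
by rewrite rmorphM/=; congr (_ * _); rewrite ?conjCK//; exact: conjCK.
Qed.

Let hZ : form_bound 1 Z.
Proof.
move=> xi eta.
pose x q a := \sum_(i < K) w ^+ (q * i) * xi (i, a).
pose y q b := \sum_(j < N) (w ^+ (q * j))^* * eta (j, b).
have -> : \sum_p \sum_r Z p r * xi p * eta r =
  K%:R^-1 * \sum_(q < K) \sum_a \sum_b Y q a b * x q a * y q b.
  rewrite mulr_sumr sum_pair2.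
  under [RHS]eq_bigr do rewrite mulr_sumr.
  rewrite [RHS]exchange_big/=; apply: eq_bigr => a _.
  under [RHS]eq_bigr do rewrite mulr_sumr.
  rewrite [RHS]exchange_big/=; apply: eq_bigr => b _.
  transitivity (\sum_(q < K) \sum_(i < K) \sum_(j < N) K%:R^-1 *
      (w ^+ (q * i) * (w ^+ (q * j))^* * Y q a b * xi (i, a) * eta (j, b))).
    rewrite [RHS]exchange_big/=; apply: eq_bigr => i _.
    rewrite [RHS]exchange_big/=; apply: eq_bigr => j _.
    rewrite /Z/= -mulr_sumr -!mulr_suml; ring.
  apply: eq_bigr => q _; rewrite -[in RHS](mulrA (Y q a b)) /x /y.
  rewrite big_distrlr/= [in RHS]mulr_sumr [RHS]mulr_sumr.
  apply: eq_bigr => i _; rewrite [in RHS]mulr_sumr [RHS]mulr_sumr.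
  by apply: eq_bigr => j _; ring.
rewrite modcM modcKV mulrC ler_pdivrMr// mul1r.
apply: (le_trans (modc_sum _ _ _)).
apply: (@le_trans _ _ (\sum_(q < K) l2norm (x q) * l2norm (y q))).
  by apply: ler_sum => q _; have := hY q (x q) (y q); rewrite mul1r.
apply: (le_trans (real_cauchy_schwarz_sqrt _ _)).
under eq_bigr do rewrite sqr_l2norm.
under [X in _ * Num.sqrt X]eq_bigr do rewrite sqr_l2norm.
rewrite parseval// parsevalJ !sqrtrM ?ler0n// mulrACA.
by rewrite -expr2 sqr_sqrtr ?ler0n// mulrC.
Qed.

Lemma toeplitz_pairing :
  N%:R * (\sum_q \sum_a \sum_b Y q a b *
     \sum_(n < N) phi n * w ^+ (q * n) * c n a b) =
  K%:R * \sum_(p : 'I_K * A) \sum_(r : 'I_N * B) phi (p.1 - r.1)%N * Z p r * L p r.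
Proof.
rewrite sum_pair2 exchange_big/= mulr_sumr [RHS]mulr_sumr.
apply: eq_bigr => a _.
rewrite exchange_big/= mulr_sumr [RHS]mulr_sumr; apply: eq_bigr => b _.
rewrite [in RHS]exchange_big/= [RHS]mulr_sumr.
have NE (x : R[i]) : N%:R * x = \sum_(j < N) x.
  by rewrite sumr_const card_ord mulr_natl.
rewrite NE; apply: eq_bigr => j _.
transitivity (\sum_(n < N) \sum_(q < K)
    Y q a b * (phi n * w ^+ (q * n) * c n a b)).
  by rewrite [RHS]exchange_big/=; apply: eq_bigr => q _; rewrite mulr_sumr.
transitivity (K%:R * \sum_(n < N) \sum_(i < K) phi (i - j)%N * Z (i, a) (j, b) *
    ((i == (j + n)%N :> nat)%:R * c n a b)); last first.
  rewrite exchange_big/=; congr (_ * _); apply: eq_bigr => i _.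
  by rewrite /L/= mulr_sumr.
rewrite mulr_sumr; apply: eq_bigr => n _.
have jn : (j + n < K)%N by rewrite K2 -addnn -addSn leq_add// ltnW.
rewrite [in RHS](bigD1 (Ordinal jn))//= [X in _ + X]big1 ?addr0 => [|i]; last first.
  by move=> /negbTE ij; rewrite (_ : (_ == _ :> nat) = false) ?mul0r ?mulr0.
rewrite eqxx mul1r addKn /Z/=.
transitivity (K%:R * K%:R^-1 * (\sum_(q < K) phi n * c n a b * w ^+ (q * n) *
    (w ^+ (q * j) * (w ^+ (q * j))^*) * Y q a b)).
  rewrite divff// mul1r; apply: eq_bigr => q _; rewrite unit_pow_conj; ring.
rewrite 3!(mulr_sumr, mulr_suml) [in RHS]mulr_suml [RHS]mulr_sumr.
apply: eq_bigr => q _.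
by rewrite mulnDr exprD; ring.
Qed.

(** In a triangular factorization [L = sum_r g r (x) h r], the [r]-th term only
    involves the entries with [j <= k r <= i], where the Toeplitz symbol
    [phi (i - j)] is the Hankel symbol [phi ((i - k r) + (k r - j))], so that
    [schur_block] applies; then sum over [r] by Cauchy-Schwarz. *)
Lemma discrete_multiplier :
  modc (\sum_q \sum_a \sum_b Y q a b *
     \sum_(n < N) phi n * w ^+ (q * n) * c n a b) <= 2 * C * \sum_q tau q.
Proof.
set S := \sum_q _; set T := \sum_q tau q.
suff h e : 0 < e -> modc S <= 2 * C * T + e.
  by apply/ler_addgt0Pr => e; exact: h.
move=> e0.
have e'0 : 0 < e / (2 * C + 1) by rewrite divr_gt0// ltr_wpDl// mulr_ge0.
suff : modc S <= 2 * (C * (T + e / (2 * C + 1))).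
  move=> /le_trans; apply; rewrite mulrA mulrDr lerD2l mulrCA ger_pMr//.
  by rewrite ler_pdivrMr ?mul1r ?lerDl// ltr_wpDl// mulr_ge0.
have [m [g [h [k [LE gk hk ng nh]]]]] := triangular_factorization
  (degI := fun p : 'I_K * A => p.1) (degJ := fun r : 'I_N * B => r.1)
  e'0 L_dual L_lower.
have bound r : modc (\sum_(p : 'I_K * A) \sum_(s : 'I_N * B) phi (p.1 - s.1)%N * Z p s * g r p * h r s)
    <= C * l2norm (g r) * l2norm (h r).
  pose n := (K + k r)%N.
  pose al (p : 'I_K * A) : 'I_n.+1 := inord (p.1 - k r).
  pose be (s : 'I_N * B) : 'I_n.+1 := inord (k r - s.1).
  have alE p : al p = (p.1 - k r)%N :> nat.
    by rewrite inordK// ltnS (leq_trans (leq_subr _ _))// /n ltnW// ltn_addr.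
  have beE s : be s = (k r - s.1)%N :> nat.
    by rewrite inordK// ltnS (leq_trans (leq_subr _ _))// leq_addl.
  have := schur_block al be hphi hZ (g r) (h r).
  apply: le_trans; rewrite le_eqVlt; apply/orP; left; apply/eqP; congr modc.
  apply: eq_bigr => p _; apply: eq_bigr => s _; rewrite alE beE.
  have [pk|kp] := ltnP p.1 (k r); first by rewrite gk// !(mul0r, mulr0).
  have [ks|sk] := ltnP (k r) s.1; first by rewrite hk// !mulr0.
  by rewrite addnBA// subnK.
have KN : K%:R = 2 * N%:R :> R by rewrite K2 -mul2n natrM.
have : N%:R * modc S <= K%:R * (C * (T + e / (2 * C + 1))).
  have -> : N%:R * modc S = modc (N%:R * S).
    by rewrite modcM -(rmorph_nat (real_complex R)) modc_real ger0_norm ?ler0n.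
  rewrite toeplitz_pairing modcM -(rmorph_nat (real_complex R)) modc_real.
  rewrite ger0_norm ?ler0n// ler_wpM2l ?ler0n//.
  have -> : \sum_(p : 'I_K * A) \sum_(r : 'I_N * B) phi (p.1 - r.1)%N * Z p r * L p r =
      \sum_r \sum_(p : 'I_K * A) \sum_(s : 'I_N * B) phi (p.1 - s.1)%N * Z p s * g r p * h r s.
    rewrite [RHS]exchange_big/=; apply: eq_bigr => p _.
    rewrite [RHS]exchange_big/=; apply: eq_bigr => s _.
    by rewrite LE mulr_sumr; apply: eq_bigr => r _; rewrite mulrA.
  apply: (le_trans (modc_sum _ _ _)); apply: (le_trans (ler_sum _ (fun r _ => bound r))).
  under eq_bigr do rewrite -mulrA.
  rewrite -mulr_sumr ler_wpM2l//; apply: (le_trans (real_cauchy_schwarz_sqrt _ _)).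
  under eq_bigr do rewrite sqr_l2norm.
  under [X in _ * Num.sqrt X]eq_bigr do rewrite sqr_l2norm.
  have Te : 0 <= T + e / (2 * C + 1).
    apply: le_trans ng; apply: sumr_ge0 => r _; apply: sumr_ge0 => p _; exact: sqr_ge0.
  rewrite -[leRHS]sqr_sqrtr// expr2; apply: ler_pM; rewrite ?sqrtr_ge0 ?ler_wsqrtr//.
  by apply: (le_trans nh); rewrite lerDl ltW.
have N0R : 0 < N%:R :> R by rewrite ltr0n.
by rewrite KN [2 * _]mulrC -mulrA ler_pM2l.
Qed.

End DiscreteMultiplier.
End RootsOfUnity.

(** * Convergent sequences of complex numbers *)

Section ComplexConvergence.
Variable R : realType.
Implicit Types (u v : nat -> R[i]) (a b c : R[i]).

Definition cconv u a := (fun n => modc (u n - a)) @ \oo --> (0 : R).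

Lemma cvg_ext (T : topologicalType) (u v : nat -> T) (l : T) : (forall n, v n = u n) ->
  u @ \oo --> l -> v @ \oo --> l.
Proof. by move=> /funext ->. Qed.

Lemma squeeze0 (f g : nat -> R) : (forall n, 0 <= f n <= g n) ->
  g @ \oo --> (0 : R) -> f @ \oo --> (0 : R).
Proof.
move=> fg g0; apply: (@squeeze_cvgr _ _ _ _ (fun=> 0) g) => //.
  by near=> n; exact: fg.
exact: cvg_cst.
Unshelve. all: by end_near. Qed.

Lemma ReB a b : complex.Re (a - b) = complex.Re a - complex.Re b.
Proof. by case: a b => ? ? [? ?]. Qed.

Lemma ImB a b : complex.Im (a - b) = complex.Im a - complex.Im b.
Proof. by case: a b => ? ? [? ?]. Qed.

Lemma cconv_ReIm u a : (fun n => complex.Re (u n)) @ \oo --> complex.Re a ->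
  (fun n => complex.Im (u n)) @ \oo --> complex.Im a -> cconv u a.
Proof.
move=> hRe hIm.
apply: (@squeeze0 _ (fun n => `|complex.Re (u n) - complex.Re a| +
                       `|complex.Im (u n) - complex.Im a|)).
  move=> n; rewrite modc_ge0/=; apply: le_trans (modc_le_ReIm _) _.
  by rewrite ReB ImB.
rewrite -[0]addr0; apply: cvgD; rewrite -(normr0 R); apply: cvg_norm.
  by rewrite -(subrr (complex.Re a)); apply: cvgB => //; exact: cvg_cst.
by rewrite -(subrr (complex.Im a)); apply: cvgB => //; exact: cvg_cst.
Qed.

Lemma cconv_cst a : cconv (fun=> a) a.
Proof. by rewrite /cconv; under eq_fun do rewrite subrr modc0; exact: cvg_cst. Qed.

Lemma cconv_ext u v a : (forall n, v n = u n) -> cconv u a -> cconv v a.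
Proof. by move=> /funext ->. Qed.

Lemma cconvD u v a b : cconv u a -> cconv v b ->
  cconv (fun n => u n + v n) (a + b).
Proof.
move=> ua vb; apply: (@squeeze0 _ (fun n => modc (u n - a) + modc (v n - b))).
  by move=> n; rewrite modc_ge0/= opprD addrACA modcD.
by rewrite -[0]addr0; exact: cvgD.
Qed.

Lemma cconvZ u a c : cconv u a -> cconv (fun n => c * u n) (c * a).
Proof.
move=> ua; rewrite /cconv; under eq_fun do rewrite -mulrBr modcM.
by rewrite -[0](mulr0 (modc c)); apply: cvgMr.
Qed.

Lemma cconvB u v a b : cconv u a -> cconv v b ->
  cconv (fun n => u n - v n) (a - b).
Proof.
move=> ua vb; apply: cconvD => //; rewrite -mulN1r.
by apply: cconv_ext (@cconvZ _ _ (-1) vb) => n; rewrite mulN1r.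
Qed.

Lemma cconvJ u a : cconv u a -> cconv (fun n => (u n)^*) a^*.
Proof.
move=> ua; rewrite /cconv; apply: cvg_ext ua => n.
by rewrite -rmorphB/= modcJ.
Qed.

Lemma cconv_sum (I : Type) (r : seq I) (f : I -> nat -> R[i]) (a : I -> R[i]) :
  (forall i, cconv (f i) (a i)) ->
  cconv (fun n => \sum_(i <- r) f i n) (\sum_(i <- r) a i).
Proof.
move=> h; elim: r => [|i r ih].
  by rewrite big_nil; apply: cconv_ext (cconv_cst 0) => n; rewrite big_nil.
by rewrite big_cons; apply: cconv_ext (cconvD (h i) ih) => n; rewrite big_cons.
Qed.

Lemma cconv_unique u a b : cconv u a -> cconv u b -> a = b.
Proof.
move=> ua ub; apply/eqP; rewrite -subr_eq0 -modc_eq0.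
have := cconvB ua ub; rewrite /cconv.
under eq_fun do rewrite subrr sub0r modcN.
by move=> /(cvg_unique _ (@cvg_cst _ _ _ _ _))-> //; exact: norm_hausdorff.
Qed.

Lemma modc_dist a b : `|modc a - modc b| <= modc (a - b).
Proof.
rewrite ler_norml; apply/andP; split.
  by have := modcD (b - a) a; rewrite subrK modcB; lra.
by rewrite lerBlDr; have := modcD (a - b) b; rewrite subrK.
Qed.

Lemma cconv_modc u a : cconv u a -> (fun n => modc (u n)) @ \oo --> modc a.
Proof.
move=> ua; apply/cvgrPdist_le => e e0; move/cvgrPdist_le : ua => /(_ e e0).
apply: filterS => n; rewrite sub0r normrN ger0_norm ?modc_ge0//.
by apply: le_trans; rewrite (modcB (u n)) modc_dist.
Qed.

Lemma cconv_le u a (B : R) : cconv u a -> (forall n, modc (u n) <= B) ->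
  modc a <= B.
Proof.
move=> /cconv_modc ua h; rewrite -(cvg_lim _ ua)//.
by apply: limr_le; [apply/cvg_ex; exists (modc a)|near=> n; exact: h].
Unshelve. all: by end_near. Qed.

End ComplexConvergence.

(** * The Hilbert space of square summable sequences *)

Section Ell2.
Variable R : realType.
Local Notation H := (ell2 R).
Implicit Types (x y z : H) (a b : R[i]).

Let sq_ge0 (f : nat -> R[i]^o) n : (0 <= (modc (f n) ^+ 2)%:E)%E.
Proof. by rewrite lee_fin sqr_ge0. Qed.

Lemma ell2_sum_fin_num x : ell2_sum x \is a fin_num.
Proof.
case: x => f /= hf; rewrite ge0_fin_numE ?nneseries_ge0//.
by move: hf => /asboolP.
Qed.

Lemma sqr_ell2_norm x : (ell2_norm x ^+ 2)%:E = ell2_sum x.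
Proof.
rewrite /ell2_norm sqr_sqrtr ?fineK ?ell2_sum_fin_num// fine_ge0//.
exact: nneseries_ge0.
Qed.

Lemma ell2_norm_ge0 x : 0 <= ell2_norm x.
Proof. exact: sqrtr_ge0. Qed.

Lemma partial_sum_le_norm x n :
  \sum_(k < n) modc (x k) ^+ 2 <= ell2_norm x ^+ 2.
Proof.
rewrite -lee_fin sqr_ell2_norm -sumEFin.
have := @nneseries_lim_ge R (fun k => (modc (x k) ^+ 2)%:E) xpredT 0 n.
by rewrite big_mkord; apply => k _ _; exact: sq_ge0.
Qed.

Lemma ell2_sum_le (f : nat -> R[i]^o) (B : R) :
  (forall n, \sum_(k < n) modc (f k) ^+ 2 <= B) -> (ell2_sum f <= B%:E)%E.
Proof.
move=> h; apply: lime_le; first exact: is_cvg_nneseries.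
by near=> n; rewrite big_mkord sumEFin lee_fin.
Unshelve. all: by end_near. Qed.

Lemma norm_le_partial_sum x (B : R) : 0 <= B ->
  (forall n, \sum_(k < n) modc (x k) ^+ 2 <= B ^+ 2) -> ell2_norm x <= B.
Proof.
move=> B0 /ell2_sum_le; rewrite -sqr_ell2_norm lee_fin.
by rewrite ler_pXn2r// nnegrE ?ell2_norm_ge0.
Qed.

Lemma bounded_partial_sums_ell2 (f : nat -> R[i]^o) (B : R) :
  (forall n, \sum_(k < n) modc (f k) ^+ 2 <= B) -> f \in @ell2_pred R.
Proof. by move=> h; apply/asboolP/(le_lt_trans (ell2_sum_le h)); rewrite ltry. Qed.

Lemma partial_sum_cvg_norm x :
  (fun n => \sum_(k < n) modc (x k) ^+ 2) @ \oo --> ell2_norm x ^+ 2.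
Proof.
have := @is_cvg_nneseries R (fun k => (modc (x k) ^+ 2)%:E) xpredT 0
  (fun k _ _ => sq_ge0 _ _).
rewrite -[X in cvgn X]/(fun n => (\sum_(0 <= k < n) (modc (x k) ^+ 2)%:E)%E).
move=> /cvg_ex[l hl]; have le : l = (ell2_norm x ^+ 2)%:E.
  by rewrite sqr_ell2_norm; apply/esym/cvg_lim.
move: hl; rewrite le => /fine_cvg; move=> hcv; apply: (cvg_ext _ hcv) => n.
by rewrite /= big_mkord sumEFin.
Qed.

Arguments partial_sum_cvg_norm : clear implicits.

Lemma ell2P x y : (forall k, x k = y k) -> x = y.
Proof. by move=> h; apply: val_inj; apply/funext => k; exact: h. Qed.

Lemma ell2DE x y k : (x + y) k = x k + y k.
Proof. by []. Qed.

Lemma ell2ZE a x k : (a *: x) k = a * x k.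
Proof. by []. Qed.

Lemma ell2NE x k : (- x) k = - x k.
Proof. by []. Qed.

Lemma ell2_0E k : (0 : H) k = 0.
Proof. by []. Qed.

Lemma ell2_basisE i k : ell2_basis R i k = (k == i)%:R.
Proof. by []. Qed.

Lemma ell2_sumE (I : Type) (r : seq I) (f : I -> H) k :
  (\sum_(i <- r) f i) k = \sum_(i <- r) f i k.
Proof. by elim: r => [|i r ih]; rewrite ?big_nil// !big_cons ell2DE ih. Qed.

Lemma coord_le_norm x k : modc (x k) <= ell2_norm x.
Proof.
rewrite -(@ler_pXn2r _ 2)// ?nnegrE ?modc_ge0 ?ell2_norm_ge0//.
apply: le_trans (partial_sum_le_norm x k.+1).
by rewrite big_ord_recr/= lerDr sumr_ge0// => i _; rewrite sqr_ge0.
Qed.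

Definition partial_inner x y n := \sum_(k < n) x k * (y k)^*.

Lemma inner_cconv x y : cconv (partial_inner x y) (ell2_inner x y).
Proof.
have sumcvg (f : nat -> R) : (forall k, `|f k| <= modc (x k) * modc (y k)) ->
    (fun n => \sum_(k < n) f k) @ \oo --> limn (series f).
  move=> hf.
  have cf : cvgn (series f).
    apply: normed_cvg; apply: (@series_le_cvg _ _
      (fun k => modc (x k) ^+ 2 + modc (y k) ^+ 2)) => [k|k|k|].
    - exact: normr_ge0.
    - by rewrite addr_ge0 ?sqr_ge0.
    - apply: (le_trans (hf k)).
      by have := sqr_ge0 (modc (x k) - modc (y k)); have := modc_ge0 (x k); have := modc_ge0 (y k); nra.
    - apply/cvg_ex; exists (ell2_norm x ^+ 2 + ell2_norm y ^+ 2).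
      rewrite (_ : series _ = (fun n => \sum_(k < n) modc (x k) ^+ 2) \+
        (fun n => \sum_(k < n) modc (y k) ^+ 2)); last first.
        by apply/funext => n; rewrite /series/= big_mkord big_split.
      exact: cvgD (partial_sum_cvg_norm x) (partial_sum_cvg_norm y).
  move: cf => /[dup] /cvg_ex[l hl]; rewrite (cvg_lim _ hl)// => _.
  by apply: cvg_ext hl => n; rewrite /series/= big_mkord.
have prodE k : modc (x k) * modc (y k) = modc (x k * (y k)^*).
  by rewrite modcM modcJ.
apply: cconv_ReIm => /=.
  under eq_fun do rewrite /partial_inner (raddf_sum (@complex.Re R : Rcomplex R -> R)).
  by apply: sumcvg => k; rewrite prodE Re_le_modc.
under eq_fun do rewrite /partial_inner (raddf_sum (@complex.Im R : Rcomplex R -> R)).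
by apply: sumcvg => k; rewrite prodE Im_le_modc.
Qed.

Arguments inner_cconv : clear implicits.

Lemma innerDl x y z : ell2_inner (x + y) z = ell2_inner x z + ell2_inner y z.
Proof.
apply: cconv_unique (inner_cconv _ _) _.
have := cconvD (inner_cconv x z) (inner_cconv y z).
congr cconv; apply/funext => n; rewrite /partial_inner -big_split/=.
by apply: eq_bigr => k _; rewrite mulrDl.
Qed.

Lemma innerZl a x z : ell2_inner (a *: x) z = a * ell2_inner x z.
Proof.
apply: cconv_unique (inner_cconv _ _) _.
have := @cconvZ _ _ _ a (inner_cconv x z).
congr cconv; apply/funext => n; rewrite /partial_inner mulr_sumr.
by apply: eq_bigr => k _; rewrite mulrA.
Qed.

Lemma inner_conj x y : ell2_inner y x = (ell2_inner x y)^*.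
Proof.
apply: cconv_unique (inner_cconv _ _) _.
have := cconvJ (inner_cconv x y).
congr cconv; apply/funext => n; rewrite /partial_inner rmorph_sum/=.
by apply: eq_bigr => k _; rewrite rmorphM/= mulrC; congr (_ * _); exact: conjCK.
Qed.

Lemma inner_self x : ell2_inner x x = (ell2_norm x ^+ 2)%:C.
Proof.
apply: cconv_unique (inner_cconv _ _) _; apply: cconv_ReIm => /=.
  have := partial_sum_cvg_norm x; move=> hcv; apply: (cvg_ext _ hcv) => n.
  by rewrite /partial_inner; under eq_bigr do rewrite -sqr_modcC; rewrite -rmorph_sum.
apply: cvg_ext (@cvg_cst _ (0 : R) _ _ _) => n.
by rewrite /partial_inner; under eq_bigr do rewrite -sqr_modcC; rewrite -rmorph_sum.
Qed.

Lemma inner_cauchy_schwarz x y :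
  modc (ell2_inner x y) <= ell2_norm x * ell2_norm y.
Proof.
apply: cconv_le (inner_cconv _ _) _ => n.
apply: (le_trans (l2norm_cauchy_schwarz _ _)).
apply: ler_pM; rewrite ?l2norm_ge0//.
  rewrite -(@ler_pXn2r _ 2)// ?nnegrE ?l2norm_ge0 ?ell2_norm_ge0//.
  by rewrite sqr_l2norm partial_sum_le_norm.
rewrite l2normJ -(@ler_pXn2r _ 2)// ?nnegrE ?l2norm_ge0 ?ell2_norm_ge0//.
by rewrite sqr_l2norm partial_sum_le_norm.
Qed.

Lemma innerDr x y z : ell2_inner z (x + y) = ell2_inner z x + ell2_inner z y.
Proof. by rewrite inner_conj innerDl rmorphD/=; congr (_ + _); exact/esym/inner_conj. Qed.

Lemma innerZr a x z : ell2_inner z (a *: x) = a^* * ell2_inner z x.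
Proof. by rewrite inner_conj innerZl rmorphM/=; congr (_ * _); exact/esym/inner_conj. Qed.

Lemma innerNl x z : ell2_inner (- x) z = - ell2_inner x z.
Proof. by rewrite -scaleN1r innerZl mulN1r. Qed.

Lemma innerNr x z : ell2_inner z (- x) = - ell2_inner z x.
Proof. by rewrite inner_conj innerNl rmorphN/=; congr (- _); exact/esym/inner_conj. Qed.

Lemma innerBl x y z : ell2_inner (x - y) z = ell2_inner x z - ell2_inner y z.
Proof. by rewrite innerDl innerNl. Qed.

Lemma innerBr x y z : ell2_inner z (x - y) = ell2_inner z x - ell2_inner z y.
Proof. by rewrite innerDr innerNr. Qed.

Lemma inner0l z : ell2_inner 0 z = 0.
Proof. by rewrite -(scale0r (0 : H)) innerZl mul0r. Qed.

Lemma inner0r z : ell2_inner z 0 = 0.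
Proof. by rewrite inner_conj inner0l rmorph0. Qed.

Lemma inner_suml (I : Type) (r : seq I) (f : I -> H) z :
  ell2_inner (\sum_(i <- r) f i) z = \sum_(i <- r) ell2_inner (f i) z.
Proof.
by elim: r => [|i r ih]; rewrite ?big_nil ?inner0l// !big_cons innerDl ih.
Qed.

Lemma inner_sumr (I : Type) (r : seq I) (f : I -> H) z :
  ell2_inner z (\sum_(i <- r) f i) = \sum_(i <- r) ell2_inner z (f i).
Proof.
by elim: r => [|i r ih]; rewrite ?big_nil ?inner0r// !big_cons innerDr ih.
Qed.

Lemma inner_basis x i : ell2_inner x (ell2_basis R i) = x i.
Proof.
apply: cconv_unique (inner_cconv _ _) _.
apply/cvgrPdist_le => e e0; exists i.+1 => // n /= ni.
rewrite /partial_inner (bigD1 (Ordinal ni))//= eqxx conjC1 mulr1 big1 ?addr0.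
  by rewrite subrr modc0 subrr normr0 ltW.
by move=> k; rewrite -val_eqE/= => /negbTE ->; rewrite conjC0 mulr0.
Qed.

Lemma ell2_normD x y : ell2_norm (x + y) <= ell2_norm x + ell2_norm y.
Proof.
rewrite -(@ler_pXn2r _ 2)// ?nnegrE ?addr_ge0 ?ell2_norm_ge0//.
have e : ell2_norm (x + y) ^+ 2 = ell2_norm x ^+ 2 + ell2_norm y ^+ 2 +
    (complex.Re (ell2_inner x y) + complex.Re (ell2_inner x y)).
  apply: (@complexI R); rewrite -inner_self innerDl !innerDr !inner_self.
  have -> : ell2_inner y x = 2%:R * (complex.Re (ell2_inner x y))%:C
      - ell2_inner x y by rewrite -addcJ (inner_conj x y) addrAC subrr add0r.
  by rewrite !rmorphD/=; ring.
rewrite e sqrrD -mulr_natl.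
have := inner_cauchy_schwarz x y; have := Re_le_modc (ell2_inner x y).
have := ler_norm (complex.Re (ell2_inner x y)); lra.
Qed.

Lemma ell2_normZ a x : ell2_norm (a *: x) = modc a * ell2_norm x.
Proof.
apply/eqP; rewrite -(@eqrXn2 _ 2)// ?mulr_ge0 ?modc_ge0 ?ell2_norm_ge0//.
apply/eqP/(@complexI R); rewrite -inner_self innerZl innerZr inner_self.
rewrite exprMn [RHS]rmorphM/= mulrA; congr (_ * _); exact/esym/sqr_modcC.
Qed.

Lemma ell2_normN x : ell2_norm (- x) = ell2_norm x.
Proof. by rewrite -scaleN1r ell2_normZ modcN modc1 mul1r. Qed.

Lemma ell2_norm_subC x y : ell2_norm (x - y) = ell2_norm (y - x).
Proof. by rewrite -ell2_normN opprB. Qed.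

Lemma ell2_norm0 : ell2_norm (0 : H) = 0.
Proof. by rewrite -(scale0r (0 : H)) ell2_normZ modc0 mul0r. Qed.

Lemma ell2_norm_eq0 x : ell2_norm x = 0 -> x = 0.
Proof.
move=> x0; apply: ell2P => k; apply/eqP; rewrite ell2_0E -modc_eq0.
by rewrite eq_le modc_ge0 andbT -x0 coord_le_norm.
Qed.

Lemma ell2_norm_basis i : ell2_norm (ell2_basis R i) = 1.
Proof.
apply/eqP; rewrite -(@eqrXn2 _ 2)// ?ell2_norm_ge0// expr1n.
by apply/eqP/(@complexI R); rewrite -inner_self inner_basis/= eqxx.
Qed.

Definition truncate n x : H := \sum_(i < n) x i *: ell2_basis R i.

Lemma truncateE n x k : truncate n x k = if (k < n)%N then x k else 0.
Proof.
rewrite /truncate ell2_sumE; under eq_bigr do rewrite ell2ZE ell2_basisE.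
case: ltnP => kn; last first.
  apply: big1 => i _; rewrite gtn_eqF ?mulr0//; exact: leq_trans (ltn_ord i) kn.
rewrite (bigD1 (Ordinal kn))//= eqxx mulr1 [X in _ + X]big1 ?addr0// => i.
by rewrite -val_eqE/= eq_sym => /negbTE ->; rewrite mulr0.
Qed.

(** The squared norm of the tail is the tail of the squared norm. *)
Lemma truncate_cvg x : (fun n => ell2_norm (x - truncate n x)) @ \oo --> (0 : R).
Proof.
have h n : ell2_norm (x - truncate n x) <=
    Num.sqrt (ell2_norm x ^+ 2 - \sum_(k < n) modc (x k) ^+ 2).
  have d0 : 0 <= ell2_norm x ^+ 2 - \sum_(k < n) modc (x k) ^+ 2.
    by rewrite subr_ge0 partial_sum_le_norm.
  apply: norm_le_partial_sum; first exact: sqrtr_ge0.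
  move=> m; rewrite sqr_sqrtr// lerBrDr.
  apply: le_trans (partial_sum_le_norm x (m + n)).
  have z k : modc ((x - truncate n x) k) ^+ 2 =
      if (k < n)%N then 0 else modc (x k) ^+ 2.
    rewrite ell2DE ell2NE truncateE; case: ifP => _.
      by rewrite subrr modc0 expr0n.
    by rewrite subr0.
  under eq_bigr do rewrite z.
  rewrite (big_ord_widen (m + n) (fun k => modc (x k) ^+ 2) (leq_addl m n)).
  rewrite [X in _ + X]big_mkcond/=.
  apply: (@le_trans _ _ (\sum_(k < m + n)
      ((if (k < n)%N then 0 else modc (x k) ^+ 2) +
       (if (k < n)%N then modc (x k) ^+ 2 else 0)))).
    rewrite big_split/= lerD2r big_split_ord/= lerDl sumr_ge0// => i _.
    by case: ifP => _ //; exact: sqr_ge0.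
  by apply: ler_sum => i _; case: ifP; rewrite ?addr0 ?add0r.
apply: (@squeeze0 _ _ (fun n => Num.sqrt (ell2_norm x ^+ 2 -
   \sum_(k < n) modc (x k) ^+ 2))).
  by move=> n; rewrite ell2_norm_ge0 h.
have hc : (fun n => ell2_norm x ^+ 2 - \sum_(k < n) modc (x k) ^+ 2) @ \oo -->
    (0 : R).
  rewrite -[X in _ --> X](subrr (ell2_norm x ^+ 2)).
  by apply: cvgB; [exact: cvg_cst|exact: (partial_sum_cvg_norm x)].
by rewrite -[X in _ --> X](sqrtr0 R); apply: continuous_cvg hc; exact: sqrt_continuous.
Qed.

Lemma ell2_complete (u : nat -> H) (c : nat -> R) : c @ \oo --> (0 : R) ->
  (forall m n, (n <= m)%N -> ell2_norm (u m - u n) <= c n) ->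
  exists x, forall n, ell2_norm (x - u n) <= c n.
Proof.
move=> c0 hu.
have real_lim (f : nat -> R) :
    (forall m n, (n <= m)%N -> `|f m - f n| <= c n) -> cvgn f.
  move=> hf; apply: cauchy_cvg; apply/cauchyP => e e0 /=.
  move/cvgrPdist_lt : c0 => /(_ e e0)[N _ /(_ N (leqnn N))].
  rewrite sub0r normrN => cN; exists (f N); exists N => // m /= Nm.
  rewrite /ball/= distrC; apply: le_lt_trans (hf _ _ Nm) _.
  exact: le_lt_trans (ler_norm _) cN.
have coord k m n : (n <= m)%N -> modc (u m k - u n k) <= c n.
  by move=> nm; apply: le_trans (hu _ _ nm); exact: (coord_le_norm (u m - u n)).
pose v k : R[i]^o := limn (fun n => complex.Re (u n k)) +i*
                     limn (fun n => complex.Im (u n k)).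
have vE k : cconv (fun n => u n k) (v k).
  apply: cconv_ReIm; apply: real_lim => m n nm.
    by rewrite -ReB; apply: le_trans (coord k _ _ nm); exact: Re_le_modc.
  by rewrite -ImB; apply: le_trans (coord k _ _ nm); exact: Im_le_modc.
have part n N : \sum_(k < N) modc (v k - u n k) ^+ 2 <= c n ^+ 2.
  have lims : (fun m => \sum_(k < N) modc (u m k - u n k) ^+ 2) @ \oo -->
      \sum_(k < N) modc (v k - u n k) ^+ 2.
    elim: (index_enum 'I_N) => [|k s ih].
      by rewrite big_nil; apply: cvg_ext (@cvg_cst _ (0 : R) _ _ _) => m; rewrite big_nil.
    rewrite big_cons; apply: (@cvg_ext _ (fun m => modc (u m k - u n k) ^+ 2 +
       \sum_(j <- s) modc (u m j - u n j) ^+ 2)); first by move=> m; rewrite big_cons.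
    apply: cvgD => //; rewrite expr2; under eq_fun do rewrite expr2.
    by apply: cvgM; apply: cconv_modc; apply: cconvB => //; exact: cconv_cst.
  rewrite -(cvg_lim _ lims)//; apply: limr_le; first by apply/cvg_ex; eexists; exact: lims.
  exists n => // m /= nm; apply: le_trans (partial_sum_le_norm (u m - u n) N) _.
  rewrite ler_pXn2r ?nnegrE ?ell2_norm_ge0 ?hu//.
  exact: le_trans (ell2_norm_ge0 _) (hu _ _ nm).
pose w : H := Ell2 (@bounded_partial_sums_ell2 (fun k => v k - u 0%N k) _ (part 0%N)).
exists (w + u 0%N) => n.
have c_ge0 : 0 <= c n by exact: le_trans (ell2_norm_ge0 _) (hu n n (leqnn n)).
apply: norm_le_partial_sum => // N; apply: le_trans (part n N).
apply: ler_sum => k _; rewrite ell2DE ell2NE ell2DE /=.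
by rewrite subrK.
Qed.

End Ell2.

(** * Norm convergence *)

Section NormConvergence.
Variable R : realType.
Local Notation H := (ell2 R).
Implicit Types (x y z : H) (u v : nat -> H).

Definition nconv u x := (fun n => ell2_norm (u n - x)) @ \oo --> (0 : R).

Lemma nconv_cst x : nconv (fun=> x) x.
Proof.
by apply: cvg_ext (@cvg_cst _ (0 : R) _ _ _) => n; rewrite subrr ell2_norm0.
Qed.

Lemma nconv_ext u v x : (forall n, v n = u n) -> nconv u x -> nconv v x.
Proof. by move=> /funext ->. Qed.

Lemma nconvD u v x y : nconv u x -> nconv v y ->
  nconv (fun n => u n + v n) (x + y).
Proof.
move=> ux vy.
apply: (@squeeze0 _ _ (fun n => ell2_norm (u n - x) + ell2_norm (v n - y))).
  by move=> n; rewrite ell2_norm_ge0/= opprD addrACA ell2_normD.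
by rewrite -[0]addr0; exact: cvgD.
Qed.

Lemma nconvZ (a : R[i]) u x : nconv u x -> nconv (fun n => a *: u n) (a *: x).
Proof.
move=> ux; apply: (@cvg_ext _ (fun n => modc a * ell2_norm (u n - x))) => [n|].
  by rewrite -scalerBr ell2_normZ.
by rewrite -[0](mulr0 (modc a)); apply: cvgM => //; exact: cvg_cst.
Qed.

Lemma nconvB u v x y : nconv u x -> nconv v y ->
  nconv (fun n => u n - v n) (x - y).
Proof.
move=> ux vy; rewrite -scaleN1r.
by apply: (nconv_ext _ (nconvD ux (@nconvZ (-1) _ _ vy))) => n; rewrite scaleN1r.
Qed.

Lemma nconv_le u x (f : nat -> R) : f @ \oo --> (0 : R) ->
  (forall n, ell2_norm (u n - x) <= f n) -> nconv u x.
Proof.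
by move=> f0 h; apply: squeeze0 f0 => n; rewrite ell2_norm_ge0 h.
Qed.

Lemma nconv_unique u x y : nconv u x -> nconv u y -> x = y.
Proof.
move=> ux uy; apply/eqP; rewrite -subr_eq0; apply/eqP/ell2_norm_eq0.
have := nconvB ux uy; rewrite /nconv.
under eq_fun do rewrite subrr sub0r ell2_normN.
by move=> /(cvg_unique _ (@cvg_cst _ _ _ _ _))-> //; exact: norm_hausdorff.
Qed.

Lemma nconv_inner u x y : nconv u x ->
  cconv (fun n => ell2_inner (u n) y) (ell2_inner x y).
Proof.
move=> ux; apply: (@squeeze0 _ _ (fun n => ell2_norm (u n - x) * ell2_norm y)).
  by move=> n; rewrite modc_ge0/= -innerBl inner_cauchy_schwarz.
by rewrite -[0](mul0r (ell2_norm y)); apply: cvgM => //; exact: cvg_cst.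
Qed.

Lemma nconv_norm_le u x (M : R) : nconv u x -> (forall n, ell2_norm (u n) <= M) ->
  ell2_norm x <= M.
Proof.
move=> ux h; apply/ler_addgt0Pr => e e0.
move/cvgrPdist_le : ux => /(_ e e0)[N _ /(_ N (leqnn N))].
rewrite sub0r normrN ger0_norm ?ell2_norm_ge0// => hN.
rewrite -(subrK (u N) x); apply: (le_trans (ell2_normD _ _)).
by rewrite addrC lerD// ell2_norm_subC.
Qed.

Lemma nconv_truncate x : nconv (fun n => truncate n x) x.
Proof.
by apply: cvg_ext (truncate_cvg x) => n; rewrite ell2_norm_subC.
Qed.

End NormConvergence.

(** * Bounded operators and their matrices *)

Section Operators.
Variable R : realType.
Local Notation H := (ell2 R).
Implicit Types (x y z : H) (S T P : H -> H) (M : R).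

Definition op_bound T M := forall x, ell2_norm (T x) <= M * ell2_norm x.

Lemma opDE S T x : (S + T) x = S x + T x. Proof. by []. Qed.

Lemma opZE (c : R[i]) T x : (c *: T) x = c *: T x. Proof. by []. Qed.

Lemma opNE T x : (- T) x = - T x. Proof. by []. Qed.

Lemma op0E x : (0 : H -> H) x = 0. Proof. by []. Qed.

Lemma op_sumE (I : Type) (r : seq I) (T : I -> H -> H) x :
  (\sum_(i <- r) T i) x = \sum_(i <- r) T i x.
Proof. by elim: r => [|i r ih]; rewrite ?big_nil// !big_cons opDE ih. Qed.

Lemma bounded_op_linear T : bounded_op T -> linear T.
Proof. by case. Qed.

Lemma linear_add T : linear T -> forall x y, T (x + y) = T x + T y.
Proof. by move=> lT x y; have := lT 1 x y; rewrite !scale1r. Qed.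

Lemma linear_zero T : linear T -> T 0 = 0.
Proof.
move=> lT; have := linear_add lT 0 0; rewrite addr0 => /eqP.
by rewrite -subr_eq0 opprD addrA subrr sub0r oppr_eq0 => /eqP.
Qed.

Lemma linear_scale T : linear T -> forall a x, T (a *: x) = a *: T x.
Proof. by move=> lT a x; have := lT a x 0; rewrite (linear_zero lT) !addr0. Qed.

Lemma linear_opp T : linear T -> forall x, T (- x) = - T x.
Proof. by move=> lT x; rewrite -scaleN1r (linear_scale lT) scaleN1r. Qed.

Lemma linear_sub T : linear T -> forall x y, T (x - y) = T x - T y.
Proof. by move=> lT x y; rewrite (linear_add lT) linear_opp. Qed.

Lemma linear_bigsum T : linear T -> forall (I : Type) (r : seq I) (f : I -> H),
  T (\sum_(i <- r) f i) = \sum_(i <- r) T (f i).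
Proof.
move=> lT I r f; elim: r => [|i r ih]; first by rewrite !big_nil (linear_zero lT).
by rewrite !big_cons (linear_add lT) ih.
Qed.

Lemma bounded_op_nonneg_bound T : bounded_op T ->
  exists M, 0 <= M /\ op_bound T M.
Proof.
move=> [_ [M hM]]; exists (Num.max M 0); split; first by rewrite le_max lexx orbT.
move=> x; apply: (le_trans (hM x)).
by rewrite ler_wpM2r ?ell2_norm_ge0// le_max lexx.
Qed.

Lemma bounded_op_nconv T u x : bounded_op T -> nconv u x ->
  nconv (fun n => T (u n)) (T x).
Proof.
move=> bT ux; have [M [M0 hM]] := bounded_op_nonneg_bound bT.
apply: (@nconv_le _ _ _ (fun n => M * ell2_norm (u n - x))).
  by rewrite -[0](mulr0 M); apply: cvgM => //; exact: cvg_cst.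
by move=> n; rewrite -linear_sub; [exact: hM|case: bT].
Qed.

Lemma bounded_op_id : bounded_op (@id H).
Proof. by split; [|exists 1 => x; rewrite mul1r]. Qed.

Lemma bounded_op0 : bounded_op (0 : H -> H).
Proof.
split => [a x y|]; first by rewrite !op0E scaler0 addr0.
by exists 0 => x; rewrite op0E mul0r ell2_norm0.
Qed.

Lemma bounded_op_comp S T : bounded_op S -> bounded_op T -> bounded_op (S \o T).
Proof.
move=> bS bT; split.
  by case: bS bT => lS _ [lT _] a x y /=; rewrite lT lS.
have [M [M0 hM]] := bounded_op_nonneg_bound bS; have [_ [N hN]] := bT.
exists (M * N) => x /=; apply: (le_trans (hM _)).
by rewrite -mulrA ler_wpM2l.
Qed.

Lemma bounded_op_add S T : bounded_op S -> bounded_op T -> bounded_op (S + T).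
Proof.
move=> [lS [M hM]] [lT [N hN]]; split => [a x y|].
  by rewrite !opDE lS lT !scalerDr addrACA.
exists (M + N) => x; rewrite opDE; apply: (le_trans (ell2_normD _ _)).
by rewrite mulrDl lerD.
Qed.

Lemma bounded_op_scale (c : R[i]) T : bounded_op T -> bounded_op (c *: T).
Proof.
move=> [lT [M hM]]; split => [a x y|].
  by rewrite !opZE lT scalerDr !scalerA mulrC.
exists (modc c * M) => x; rewrite opZE ell2_normZ -mulrA.
by rewrite ler_wpM2l ?modc_ge0.
Qed.

Lemma bounded_op_sub S T : bounded_op S -> bounded_op T -> bounded_op (S - T).
Proof.
by move=> bS bT; rewrite -scaleN1r; apply: bounded_op_add => //;
  exact: bounded_op_scale.
Qed.

Lemma bounded_op_sum (I : Type) (r : seq I) (T : I -> H -> H) :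
  (forall i, bounded_op (T i)) -> bounded_op (\sum_(i <- r) T i).
Proof.
move=> bT; elim: r => [|i r ih]; rewrite ?big_nil ?big_cons.
  exact: bounded_op0.
exact: bounded_op_add.
Qed.

Lemma bounded_op_iter T n : bounded_op T -> bounded_op (iter n T).
Proof.
move=> bT; elim: n => [|n ih]; first exact: bounded_op_id.
exact: (bounded_op_comp bT ih).
Qed.

Lemma op_norm_le T M : 0 <= M -> op_bound T M -> op_norm T <= M.
Proof.
move=> M0 hM; apply: ge_sup.
  by exists (ell2_norm (T 0)), 0 => //=; rewrite ell2_norm0.
move=> _ [x /= x1 <-]; apply: (le_trans (hM x)).
by rewrite -[leRHS]mulr1 ler_wpM2l.
Qed.

(** Homogeneity: normalize [x]. *)
Lemma op_norm_bound T : bounded_op T -> op_bound T (op_norm T).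
Proof.
move=> bT x; have [M [M0 hM]] := bounded_op_nonneg_bound bT.
have lT := bounded_op_linear bT.
have [->|x0] := eqVneq x 0; first by rewrite (linear_zero lT) ell2_norm0 mulr0.
have nx : 0 < ell2_norm x.
  rewrite lt_def ell2_norm_ge0 andbT; apply: contraNneq x0 => h.
  exact/eqP/ell2_norm_eq0.
rewrite -ler_pdivrMr//; apply: ub_le_sup.
  exists M => _ [y /= y1 <-]; apply: (le_trans (hM y)).
  by rewrite -[leRHS]mulr1 ler_wpM2l.
have nV : modc ((ell2_norm x)^-1%:C) = (ell2_norm x)^-1.
  by rewrite modc_real ger0_norm// invr_ge0 ltW.
exists ((ell2_norm x)^-1%:C *: x) => /=.
  by rewrite ell2_normZ nV mulVf// gt_eqF.
by rewrite (linear_scale lT) ell2_normZ nV mulrC.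
Qed.

Lemma op_norm_ge0 T : bounded_op T -> 0 <= op_norm T.
Proof.
move=> bT; have := op_norm_bound bT (ell2_basis R 0).
by rewrite ell2_norm_basis mulr1; apply: le_trans; exact: ell2_norm_ge0.
Qed.

Lemma op_entryE T i j : op_entry T i j = T (ell2_basis R j) i.
Proof. exact: inner_basis. Qed.

Definition finite_vector n (xi : 'I_n -> R[i]) : H :=
  \sum_i xi i *: ell2_basis R i.

Lemma finite_vectorE n (xi : 'I_n -> R[i]) (i : 'I_n) :
  finite_vector xi i = xi i.
Proof.
rewrite /finite_vector ell2_sumE; under eq_bigr do rewrite ell2ZE ell2_basisE.
rewrite (bigD1 i)//= eqxx mulr1 [X in _ + X]big1 ?addr0// => j.
by rewrite -val_eqE/= eq_sym => /negbTE ->; rewrite mulr0.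
Qed.

Lemma finite_vector_norm n (xi : 'I_n -> R[i]) :
  ell2_norm (finite_vector xi) = l2norm xi.
Proof.
apply/eqP; rewrite -(@eqrXn2 _ 2)// ?ell2_norm_ge0 ?l2norm_ge0//.
apply/eqP/(@complexI R); rewrite -inner_self {2}/finite_vector inner_sumr.
rewrite sqr_l2norm rmorph_sum/=; apply: eq_bigr => i _.
by rewrite innerZr inner_basis finite_vectorE mulrC -sqr_modcC.
Qed.

Lemma finite_section_bound T M n : 0 <= M -> linear T -> op_bound T M ->
  form_bound M (fun i j : 'I_n => T (ell2_basis R j) i).
Proof.
move=> M0 lT hM; apply: form_bound_row => // eta.
pose y := T (finite_vector eta).
have e (i : 'I_n) : \sum_(j < n) T (ell2_basis R j) i * eta j = y i.
  rewrite /y (linear_bigsum lT) ell2_sumE; apply: eq_bigr => j _.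
  by rewrite (linear_scale lT) ell2ZE mulrC.
under eq_bigr do rewrite e.
apply: (le_trans (partial_sum_le_norm y n)).
rewrite -sqr_l2norm -finite_vector_norm -exprMn.
by rewrite ler_pXn2r ?nnegrE ?mulr_ge0 ?ell2_norm_ge0//; exact: hM.
Qed.

Lemma form_bound_tr (I J : finType) M (Y : I -> J -> R[i]) :
  form_bound M Y -> form_bound M (fun j i => Y i j).
Proof.
move=> h xi eta; rewrite exchange_big/= mulrAC.
by under eq_bigr do under eq_bigr do rewrite mulrAC; exact: h.
Qed.

Lemma cvg_sum_sqr_modc m (f : nat -> nat -> R[i]) (a : nat -> R[i]) :
  (forall k, cconv (f k) (a k)) ->
  (fun n => \sum_(k < m) modc (f k n) ^+ 2) @ \oo -->
    \sum_(k < m) modc (a k) ^+ 2.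
Proof.
move=> h; elim: (index_enum 'I_m) => [|k s ih].
  by rewrite big_nil; apply: cvg_ext (@cvg_cst _ (0 : R) _ _ _) => n; rewrite big_nil.
rewrite big_cons; apply: (@cvg_ext _ (fun n => modc (f k n) ^+ 2 +
   \sum_(j <- s) modc (f j n) ^+ 2)); first by move=> n; rewrite big_cons.
apply: cvgD => //; rewrite expr2; under eq_fun do rewrite expr2.
by apply: cvgM; exact: cconv_modc.
Qed.

(** The rows are square summable, hence define the coordinates of the image by
    inner products; the bounds on the finite sections pass to the limit. *)
Lemma op_of_matrix (a : nat -> nat -> R[i]) M : 0 <= M ->
  (forall n, form_bound M (fun i j : 'I_n => a i j)) ->
  exists S, [/\ bounded_op S, forall i j, S (ell2_basis R j) i = a i j &
    op_bound S M].
Proof.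
move=> M0 hM.
have rows i n : \sum_(j < n) modc ((a i j)^* : R[i]^o) ^+ 2 <= M ^+ 2.
  pose N := (i + n).+1; have iN : (i < N)%N by rewrite ltnS leq_addr.
  have nN : (n <= N)%N by rewrite leqW// leq_addl.
  have := form_boundP M0 (form_bound_tr (hM N)) (fun k => (k == Ordinal iN)%:R).
  rewrite [X in _ * X](bigD1 (Ordinal iN))//= eqxx modc1 expr1n.
  rewrite [X in 1 + X]big1 ?addr0 ?mulr1 => [|k /negbTE ->]; last first.
    by rewrite modc0 expr0n.
  apply: le_trans.
  rewrite (big_ord_widen N (fun j => modc ((a i j)^* : R[i]^o) ^+ 2) nN).
  rewrite big_mkcond/=; apply: ler_sum => j _.
  have -> : \sum_(k < N) a k j * (k == Ordinal iN)%:R = a i j.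
    rewrite (bigD1 (Ordinal iN))//= eqxx mulr1 big1 ?addr0// => k /negbTE ->.
    by rewrite mulr0.
  by case: ifP => _; rewrite ?sqr_ge0// modcJ.
pose r i : H := Ell2 (@bounded_partial_sums_ell2 _ (fun j => (a i j)^*) _ (rows i)).
pose s x i : R[i]^o := ell2_inner x (r i).
have s_sum x m : \sum_(i < m) modc (s x i) ^+ 2 <= (M * ell2_norm x) ^+ 2.
  have lims := @cvg_sum_sqr_modc m _ _ (fun i => @inner_cconv _ x (r i)).
  rewrite -(cvg_lim _ lims)//; apply: limr_le.
    by apply/cvg_ex; eexists; exact: lims.
  exists m => // n /= mn.
  have h := form_boundP M0 (hM n) (fun j => x j).
  apply: (@le_trans _ _ (\sum_(i < n) modc (\sum_(j < n) a i j * x j) ^+ 2)).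
    rewrite (big_ord_widen n (fun i => modc (partial_inner x (r i) n) ^+ 2) mn).
    rewrite big_mkcond/=; apply: ler_sum => i _; case: ifP => _; last exact: sqr_ge0.
    rewrite le_eqVlt; apply/orP; left; apply/eqP; congr (modc _ ^+ 2).
    apply: eq_bigr => j _; rewrite mulrC; congr (_ * _); exact: conjCK.
  apply: (le_trans h); rewrite exprMn ler_wpM2l ?sqr_ge0//.
  exact: partial_sum_le_norm.
pose S x : H := Ell2 (@bounded_partial_sums_ell2 _ (s x) _ (s_sum x)).
have SM : op_bound S M.
  move=> x; apply: norm_le_partial_sum; rewrite ?mulr_ge0 ?ell2_norm_ge0//.
  exact: s_sum.
exists S; split => //.
  split; last by exists M.
  move=> c x y; apply: ell2P => k; rewrite ell2DE ell2ZE /= /s.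
  by rewrite innerDl innerZl.
move=> i j; rewrite /= /s inner_conj inner_basis /=; exact: conjCK.
Qed.

(** The coordinates of the adjoint at [y] are the conjugates of [<T e_i, y>];
    testing on the vector of the first [n] of them bounds their norm. *)
Lemma adjoint_exists T : bounded_op T -> exists S, bounded_op S /\
  forall x y, ell2_inner (T x) y = ell2_inner x (S y).
Proof.
move=> bT; have [M [M0 hM]] := bounded_op_nonneg_bound bT.
have lT := bounded_op_linear bT.
pose s y i : R[i]^o := (ell2_inner (T (ell2_basis R i)) y)^*.
have s_sum y n : \sum_(i < n) modc (s y i) ^+ 2 <= (M * ell2_norm y) ^+ 2.
  pose v := finite_vector (fun i : 'I_n => s y i).
  have e : ell2_inner (T v) y = (l2norm (fun i : 'I_n => s y i) ^+ 2)%:C.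
    rewrite /v /finite_vector (linear_bigsum lT) inner_suml sqr_l2norm rmorph_sum/=.
    apply: eq_bigr => i _; rewrite (linear_scale lT) innerZl sqr_modcC.
    by congr (_ * _); exact: (esym (conjCK _)).
  have := inner_cauchy_schwarz (T v) y.
  rewrite e modc_real ger0_norm ?sqr_ge0// => h.
  have {}h : l2norm (fun i : 'I_n => s y i) ^+ 2 <=
      l2norm (fun i : 'I_n => s y i) * (M * ell2_norm y).
    apply: (le_trans h); rewrite mulrCA mulrA ler_wpM2r ?ell2_norm_ge0//.
    by rewrite -finite_vector_norm; exact: hM.
  rewrite -sqr_l2norm ler_pXn2r// ?nnegrE ?l2norm_ge0 ?mulr_ge0 ?ell2_norm_ge0//.
  have [->|n0] := eqVneq (l2norm (fun i : 'I_n => s y i)) 0.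
    by rewrite mulr_ge0 ?ell2_norm_ge0.
  by rewrite -(ler_pM2l (_ : 0 < l2norm (fun i : 'I_n => s y i))) -?expr2//
     lt_def n0 l2norm_ge0.
pose S y : H := Ell2 (@bounded_partial_sums_ell2 _ (s y) _ (s_sum y)).
exists S; split; first split.
- move=> a x y; apply: ell2P => k; rewrite ell2DE ell2ZE /= /s.
  rewrite innerDr innerZr rmorphD/= rmorphM/=; congr (_ * _ + _).
  exact: conjCK.
- exists M => y; apply: norm_le_partial_sum; rewrite ?mulr_ge0 ?ell2_norm_ge0//.
  exact: s_sum.
- move=> x y; have h1 := nconv_inner y (bounded_op_nconv bT (nconv_truncate x)).
  have h2 := nconv_inner (S y) (nconv_truncate x).
  apply: (cconv_unique h1); apply: (cconv_ext _ h2) => n.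
  rewrite /truncate (linear_bigsum lT) !inner_suml; apply: eq_bigr => i _.
  rewrite (linear_scale lT) !innerZl; congr (_ * _).
  by rewrite (inner_conj (S y)) inner_basis /= /s; exact: (esym (conjCK _)).
Qed.

Lemma op_adjointP T : bounded_op T -> bounded_op (op_adjoint T) /\
  forall x y, ell2_inner (T x) y = ell2_inner x (op_adjoint T y).
Proof.
move=> bT; rewrite /op_adjoint; case: xgetP => [S _ []//|h].
by have [S hS] := adjoint_exists bT; have := h S hS.
Qed.

End Operators.

(** * Positive operators *)

Section PositiveOperators.
Variable R : realType.
Local Notation H := (ell2 R).
Implicit Types (x y z : H) (S T P A : H -> H) (M : R).

Definition quad_form T x : R := complex.Re (ell2_inner (T x) x).

Definition self_adjoint T := forall x y, ell2_inner (T x) y = ell2_inner x (T y).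

Lemma positive_quad_formE P x : positive_op P ->
  ell2_inner (P x) x = (quad_form P x)%:C.
Proof.
move=> [_ /(_ x)]; rewrite /quad_form; case: (ell2_inner _ _) => a b.
by move=> /ger0_Im /= ->.
Qed.

Lemma positive_quad_form_ge0 P x : positive_op P -> 0 <= quad_form P x.
Proof. by move=> hP; rewrite -lecR -positive_quad_formE//; exact: hP.2. Qed.

(** Polarization: the imaginary parts of [<P (x + y), x + y>] and of
    [<P (x + i y), x + i y>] vanish. *)
Lemma positive_self_adjoint P : positive_op P -> self_adjoint P.
Proof.
move=> hP x y; have lP := bounded_op_linear hP.1.
have e1 : complex.Im (ell2_inner (P (x + y)) (x + y)) = 0.
  by rewrite positive_quad_formE.
have e2 : complex.Im (ell2_inner (P (x + 'i%C *: y)) (x + 'i%C *: y)) = 0.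
  by rewrite positive_quad_formE.
move: e1 e2; rewrite (inner_conj (P y) x) !(linear_add lP) (linear_scale lP).
rewrite !innerDl !innerDr !innerZl !innerZr !(positive_quad_formE _ hP).
case: (ell2_inner (P x) y) => a b; case: (ell2_inner (P y) x) => c d /=.
rewrite !(mul0r, mul1r, addr0, add0r, mulr0, subr0, sub0r, oppr0, mulN1r, mulNr).
move=> e1 e2; congr (_ +i* _); lra.
Qed.

Lemma self_adjoint_positive P : bounded_op P -> self_adjoint P ->
  (forall x, 0 <= quad_form P x) -> positive_op P.
Proof.
move=> bP sP qP; split => // x.
have : ell2_inner (P x) x = (ell2_inner (P x) x)^* by rewrite -inner_conj sP.
have := qP x; rewrite /quad_form; case: (ell2_inner _ _) => a b /= a0 [h].
by rewrite lecE/= a0 andbT; apply/eqP; lra.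
Qed.

Definition positive_contraction A :=
  positive_op A /\ forall x, quad_form A x <= ell2_norm x ^+ 2.

(** Positivity at [x - A x] gives [2 |A x|^2 <= <A x, x> + <A (A x), A x>], and
    the last term is at most [|A x|^2]. *)
Lemma positive_contraction_sqr A x : positive_contraction A ->
  ell2_norm (A x) ^+ 2 <= quad_form A x.
Proof.
move=> [hA cA]; have lA := bounded_op_linear hA.1.
have e : quad_form A (x - A x) = quad_form A x - ell2_norm (A x) ^+ 2
    - ell2_norm (A x) ^+ 2 + quad_form A (A x).
  apply: (@complexI R); rewrite rmorphD/= !rmorphB/= -!positive_quad_formE//.
  rewrite (linear_sub lA) innerBl !innerBr -inner_self.
  by rewrite (positive_self_adjoint hA (A x) x); ring.
have := positive_quad_form_ge0 (x - A x) hA; rewrite e.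
have := cA (A x); lra.
Qed.

Lemma positive_contraction_bound A : positive_contraction A -> op_bound A 1.
Proof.
move=> hA x; rewrite mul1r -(@ler_pXn2r _ 2)// ?nnegrE ?ell2_norm_ge0//.
exact: le_trans (positive_contraction_sqr x hA) (hA.2 x).
Qed.

Lemma positive_contraction_compl A : positive_contraction A ->
  positive_contraction (id - A).
Proof.
move=> [hA cA].
have e x : quad_form (id - A) x = ell2_norm x ^+ 2 - quad_form A x.
  by rewrite /quad_form opDE opNE innerBl ReB inner_self.
split; last by move=> x; rewrite e lerBlDr lerDl positive_quad_form_ge0.
apply: self_adjoint_positive.
- by apply: bounded_op_sub; [exact: bounded_op_id|exact: hA.1].
- move=> x y; rewrite !opDE !opNE innerBl innerBr; congr (_ - _).
  exact: positive_self_adjoint.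
- by move=> x; rewrite e subr_ge0.
Qed.

Lemma self_adjoint_iter A n : self_adjoint A -> self_adjoint (iter n A).
Proof.
move=> sA; elim: n => [//|n ih] x y.
by rewrite iterS sA ih -iterSr.
Qed.

Lemma positive_contraction_iter_double A n : positive_contraction A ->
  positive_contraction (iter (n + n) A).
Proof.
move=> hA; have sA := positive_self_adjoint hA.1.
have e x : quad_form (iter (n + n) A) x = ell2_norm (iter n A x) ^+ 2.
  apply: (@complexI R); rewrite -inner_self /quad_form iterD.
  by rewrite (self_adjoint_iter n sA) inner_self.
have bn : op_bound (iter n A) 1.
  elim: n {e} => [x|n ih x]; first by rewrite mul1r.
  rewrite iterS; apply: (le_trans (positive_contraction_bound hA _)).
  by rewrite mul1r.
split.
  apply: self_adjoint_positive.
  - by apply: bounded_op_iter; exact: hA.1.1.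
  - exact: self_adjoint_iter.
  - by move=> x; rewrite e sqr_ge0.
move=> x; rewrite e ler_pXn2r ?nnegrE ?ell2_norm_ge0//.
by have := bn x; rewrite mul1r.
Qed.

(** Telescoping: [|y - A y|^2 <= |y|^2 - |A y|^2] for [y = A^l x], and [|A^l x|]
    decreases. *)
Lemma positive_contraction_iter_diff A x : positive_contraction A ->
  nconv (fun l => iter l A x - iter l.+1 A x) 0.
Proof.
move=> hA; pose a l := ell2_norm (iter l A x) ^+ 2.
have a_decr l : a l.+1 <= a l.
  rewrite ler_pXn2r ?nnegrE ?ell2_norm_ge0//.
  by have := positive_contraction_bound hA (iter l A x); rewrite mul1r.
have diff l : ell2_norm (iter l A x - iter l.+1 A x) ^+ 2 <= a l - a l.+1.
  rewrite /a iterS; set y := iter l A x.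
  have e : ell2_norm (y - A y) ^+ 2 = ell2_norm y ^+ 2 - quad_form A y
     - quad_form A y + ell2_norm (A y) ^+ 2.
    apply: (@complexI R); rewrite rmorphD/= !rmorphB/= -!inner_self.
    rewrite -positive_quad_formE; last exact: hA.1.
    rewrite innerBl !innerBr (positive_self_adjoint hA.1 y y); ring.
  by have := positive_contraction_sqr y hA; rewrite e; lra.
have a_cvg : cvgn a.
  apply: (@nonincreasing_is_cvgn R).
    by apply/nonincreasing_seqP.
  by exists 0 => _ [l _ <-]; exact: sqr_ge0.
have hs : (fun l => a l - a l.+1) @ \oo --> (0 : R).
  rewrite -[X in _ --> X](subrr (limn a)); apply: cvgB => //.
  by have := a_cvg; rewrite -(cvg_shiftS a).
have hd : (fun l => Num.sqrt (a l - a l.+1)) @ \oo --> (0 : R).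
  by rewrite -[X in _ --> X](sqrtr0 R); apply: continuous_cvg hs; exact: sqrt_continuous.
apply: nconv_le hd _ => l; rewrite subr0 -[leLHS]ger0_norm ?ell2_norm_ge0//.
by rewrite -sqrtr_sqr ler_wsqrtr.
Qed.

End PositiveOperators.

(** * Square roots and absolute values *)

Lemma cvg_succ (R : realType) (f : nat -> R) (l : R) :
  f @ \oo --> l -> (fun n => f n.+1) @ \oo --> l.
Proof. by move=> h; rewrite (cvg_shiftS f). Qed.

Lemma nconv_shift (R : realType) (u : nat -> ell2 R) x :
  nconv u x -> nconv (fun n => u n.+1) x.
Proof. exact: (@cvg_succ R (fun n => ell2_norm (u n - x))). Qed.

Section SquareRoot.
Variable R : realType.
Local Notation H := (ell2 R).
Implicit Types (x y z : H) (S T P A : H -> H) (M : R).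

(** With [X = 1 - T], a fixed point [Y] of [Y |-> (X + Y^2) / 2] yields
    [(1 - Y)^2 = T]. *)
Section Iteration.
Variable X : H -> H.
Hypotheses (lX : linear X) (bX : op_bound X 1) (sX : self_adjoint X).

Let half : R[i] := (2^-1)%:C.

Fixpoint sqrt_iter n x : H :=
  if n is m.+1 then half *: (X x + sqrt_iter m (sqrt_iter m x)) else 0.

(** The same iteration for the scalar [X = 1]: its increments dominate those of
    [sqrt_iter] for any contraction [X], whence convergence. *)
Fixpoint sqrt_scalar n : R :=
  if n is m.+1 then (1 + sqrt_scalar m ^+ 2) / 2 else 0.

Let sqrt_scalar_bound n : 0 <= sqrt_scalar n <= 1.
Proof. by elim: n => [|n /andP[h0 h1]] /=; [lra|nra]. Qed.

Let sqrt_scalar_incr n : sqrt_scalar n <= sqrt_scalar n.+1.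
Proof.
have := sqrt_scalar_bound n => /andP[h0 h1] /=.
have := sqr_ge0 (sqrt_scalar n - 1); nra.
Qed.

Let sqrt_iter_linear n : linear (sqrt_iter n).
Proof.
elim: n => [|n ih] a x y /=; first by rewrite scaler0 addr0.
rewrite lX ih ih !scalerDr !scalerA (mulrC half a).
by rewrite addrACA.
Qed.

Let modc_half : modc half = 2^-1.
Proof. by rewrite modc_real ger0_norm// invr_ge0. Qed.

Let sqrt_iter_bound n : op_bound (sqrt_iter n) (sqrt_scalar n).
Proof.
elim: n => [|n ih] x /=; first by rewrite ell2_norm0 mul0r.
rewrite ell2_normZ modc_half mulrC mulrAC ler_pM2r ?invr_gt0//.
apply: (le_trans (ell2_normD _ _)); rewrite mulrDl lerD//.
apply: (le_trans (ih _)); rewrite expr2 -mulrA ler_wpM2l//.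
by have /andP[] := sqrt_scalar_bound n.
Qed.

Let sqrt_iter_step n :
  op_bound (fun x => sqrt_iter n.+1 x - sqrt_iter n x)
           (sqrt_scalar n.+1 - sqrt_scalar n).
Proof.
elim: n => [|n ih] x.
  rewrite [sqrt_iter 0 x]/= [sqrt_scalar 0]/= !subr0; exact: sqrt_iter_bound.
set Y1 := sqrt_iter n.+1 in ih *; set Y0 := sqrt_iter n in ih *.
have -> : sqrt_iter n.+2 x - Y1 x =
    half *: (Y1 (Y1 x - Y0 x) + (Y1 (Y0 x) - Y0 (Y0 x))).
  have lY1 u v : Y1 (u - v) = Y1 u - Y1 v := linear_sub (sqrt_iter_linear n.+1) u v.
  have E2 : sqrt_iter n.+2 x = half *: (X x + Y1 (Y1 x)) by [].
  have E1 : Y1 x = half *: (X x + Y0 (Y0 x)) by [].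
  rewrite lY1 addrA subrK E2 [X in _ - X = _]E1.
  by rewrite -scalerBr opprD addrACA subrr add0r.
rewrite ell2_normZ modc_half.
apply: (@le_trans _ _ (2^-1 * ((sqrt_scalar n.+1 - sqrt_scalar n) *
    (sqrt_scalar n.+1 + sqrt_scalar n) * ell2_norm x))); last first.
  rewrite mulrA ler_wpM2r ?ell2_norm_ge0// le_eqVlt; apply/orP; left; apply/eqP.
  rewrite [sqrt_scalar n.+2]/= -/(sqrt_scalar n.+1).
  set s1 := sqrt_scalar n.+1; set s0 := sqrt_scalar n.
  have -> : (1 + s1 ^+ 2) / 2 - s1 = (1 + s1 ^+ 2) / 2 - (1 + s0 ^+ 2) / 2.
    by [].
  by field.
rewrite ler_pM2l ?invr_gt0//.
have -> : (sqrt_scalar n.+1 - sqrt_scalar n) * (sqrt_scalar n.+1 + sqrt_scalar n)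
     * ell2_norm x = sqrt_scalar n.+1 * ((sqrt_scalar n.+1 - sqrt_scalar n) *
  ell2_norm x) + (sqrt_scalar n.+1 - sqrt_scalar n) * (sqrt_scalar n * ell2_norm x).
  by ring.
apply: (le_trans (ell2_normD _ _)); apply: lerD.
  apply: (le_trans (sqrt_iter_bound _ _)).
  apply: ler_wpM2l; last exact: ih.
  by have /andP[] := sqrt_scalar_bound n.+1.
apply: (le_trans (ih _)); apply: ler_wpM2l; first by rewrite subr_ge0.
exact: sqrt_iter_bound.
Qed.

Let sqrt_iter_cauchy m n x : (n <= m)%N ->
  ell2_norm (sqrt_iter m x - sqrt_iter n x) <=
    (sqrt_scalar m - sqrt_scalar n) * ell2_norm x.
Proof.
move=> /subnK <-; elim: (m - n)%N => [|k ih].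
  by rewrite !subrr ell2_norm0 mul0r.
rewrite addSn -(subrK (sqrt_iter (k + n) x) (sqrt_iter (k + n).+1 x)) -addrA.
apply: (le_trans (ell2_normD _ _)).
have := sqrt_iter_step (k + n) x; move: ih; lra.
Qed.

Let sqrt_iter_self_adjoint n : self_adjoint (sqrt_iter n).
Proof.
elim: n => [|n ih] x y /=; first by rewrite inner0l inner0r.
rewrite innerZl innerZr !innerDl !innerDr sX ih ih; congr (_ * _).
exact: (esym (conj_real _)).
Qed.

Lemma sqrt_iteration_limit : exists Y,
  [/\ linear Y, op_bound Y 1, self_adjoint Y &
      forall x, Y x + Y x = X x + Y (Y x)].
Proof.
have scvg : cvgn sqrt_scalar.
  apply: (@nondecreasing_is_cvgn R); first by apply/nondecreasing_seqP.
  by exists 1 => _ [n _ <-]; have /andP[] := sqrt_scalar_bound n.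
pose l := limn sqrt_scalar.
have sl n : sqrt_scalar n <= l.
  by apply: nondecreasing_cvgn_le => //; apply/nondecreasing_seqP.
have lim_at x : exists y, nconv (fun n => sqrt_iter n x) y.
  have c0 : (fun n => (l - sqrt_scalar n) * ell2_norm x) @ \oo --> (0 : R).
    rewrite -[X in _ --> X](mul0r (ell2_norm x)) -[X in X * _](subrr l).
    by apply: cvgM; [apply: cvgB => //; exact: cvg_cst|exact: cvg_cst].
  have [|y hy] := ell2_complete (u := fun n => sqrt_iter n x) c0.
    move=> m n nm; apply: (le_trans (sqrt_iter_cauchy x nm)).
    by rewrite ler_wpM2r ?ell2_norm_ge0// lerD2r.
  by exists y; apply: nconv_le c0 _ => n; rewrite ell2_norm_subC.
have [Y hY] := choice lim_at.
exists Y; split.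
- move=> a x y; apply: (nconv_unique (hY _)).
  apply: (nconv_ext _ (nconvD (@nconvZ _ a _ _ (hY x)) (hY y))) => n.
  exact: sqrt_iter_linear.
- move=> x; apply: (nconv_norm_le (hY x)) => n.
  apply: (le_trans (sqrt_iter_bound n x)); rewrite ler_wpM2r ?ell2_norm_ge0//.
  by have /andP[] := sqrt_scalar_bound n.
- move=> x y; apply: (cconv_unique (nconv_inner y (hY x))).
  rewrite (inner_conj (Y y) x).
  apply: (cconv_ext _ (cconvJ (nconv_inner x (hY y)))) => n.
  by rewrite sqrt_iter_self_adjoint; exact: inner_conj.
- move=> x.
  have YY : nconv (fun n => sqrt_iter n (sqrt_iter n x)) (Y (Y x)).
    have h : (fun n => ell2_norm (sqrt_iter n x - Y x) +
        ell2_norm (sqrt_iter n (Y x) - Y (Y x))) @ \oo --> (0 : R).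
      by rewrite -[0]addr0; apply: cvgD; [exact: (hY x)|exact: (hY (Y x))].
    apply: nconv_le h _ => n.
    rewrite -(subrK (sqrt_iter n (Y x)) (sqrt_iter n (sqrt_iter n x))) -addrA.
    apply: (le_trans (ell2_normD _ _)); rewrite lerD2r.
    rewrite -(linear_sub (sqrt_iter_linear n)).
    apply: (le_trans (sqrt_iter_bound n _)).
    by rewrite ler_piMl ?ell2_norm_ge0//; have /andP[] := sqrt_scalar_bound n.
  have h1 : nconv (fun n => sqrt_iter n.+1 x) (Y x).
    exact: nconv_shift (hY x).
  apply: (nconv_unique (nconvD h1 h1)).
  apply: (nconv_ext _ (nconvD (nconv_cst (X x)) YY)) => n.
  have hh : half + half = 1.
    by rewrite -rmorphD/= (_ : 2^-1 + 2^-1 = 1 :> R)//; lra.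
  by rewrite [sqrt_iter _ _]/= -scalerDl hh scale1r.
Qed.

End Iteration.

(** Rescale [T] to a positive contraction [B]; then [1 - Y] is a root of [B],
    where [Y] is the limit of the iteration for [X = 1 - B]. *)
Lemma square_root_exists T : positive_op T ->
  exists P, positive_op P /\ P \o P = T.
Proof.
move=> hT; have [M0 [M00 hM0]] := bounded_op_nonneg_bound hT.1.
pose M := M0 + 1; have Mp : 0 < M by rewrite ltr_wpDl.
have lT := bounded_op_linear hT.1.
pose B := (M^-1%:C : R[i]) *: T.
have qB x : quad_form B x = M^-1 * quad_form T x.
  by rewrite {1}/quad_form /B opZE innerZl positive_quad_formE// -rmorphM.
have cB : positive_contraction B.
  split; first apply: self_adjoint_positive.
  - by apply: bounded_op_scale; exact: hT.1.
  - move=> x y; rewrite /B !opZE innerZl innerZr (positive_self_adjoint hT).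
    congr (_ * _); exact: (esym (conj_real _)).
  - by move=> x; rewrite qB mulr_ge0 ?invr_ge0 ?(ltW Mp)// positive_quad_form_ge0.
  move=> x; rewrite qB mulrC ler_pdivrMr//.
  apply: (@le_trans _ _ (modc (ell2_inner (T x) x))).
    exact: le_trans (ler_norm _) (Re_le_modc _).
  apply: (le_trans (inner_cauchy_schwarz _ _)).
  rewrite expr2 -mulrA mulrC ler_wpM2l ?ell2_norm_ge0//.
  apply: (le_trans (hM0 x)); rewrite mulrC ler_wpM2l ?ell2_norm_ge0//.
  by rewrite lerDl.
have cX := positive_contraction_compl cB.
have [Y [lY bY sY eY]] := sqrt_iteration_limit (bounded_op_linear cX.1.1)
  (positive_contraction_bound cX) (positive_self_adjoint cX.1).
pose s := Num.sqrt M.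
exists ((s%:C : R[i]) *: (id - Y)); split.
  apply: self_adjoint_positive.
  - apply: bounded_op_scale; apply: bounded_op_sub; first exact: bounded_op_id.
    by split => //; exists 1.
  - move=> x y; rewrite !opZE !opDE !opNE innerZl innerZr innerBl innerBr sY.
    congr (_ * _); exact: (esym (conj_real _)).
  - move=> x; rewrite /quad_form opZE opDE opNE innerZl innerBl inner_self.
    have -> : complex.Re (s%:C * ((ell2_norm x ^+ 2)%:C - ell2_inner (Y x) x)) =
       s * (ell2_norm x ^+ 2 - complex.Re (ell2_inner (Y x) x)).
      by case: (ell2_inner _ _) => a b /=; rewrite mul0r subr0.
    rewrite mulr_ge0 ?sqrtr_ge0// subr_ge0.
    apply: (@le_trans _ _ (modc (ell2_inner (Y x) x))).
      exact: le_trans (ler_norm _) (Re_le_modc _).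
    apply: (le_trans (inner_cauchy_schwarz _ _)).
    by rewrite expr2 ler_wpM2r ?ell2_norm_ge0//; have := bY x; rewrite mul1r.
apply/funext => x /=.
have e : x - Y x - (Y x - Y (Y x)) = B x.
  have := eY x; rewrite opDE opNE => h.
  have -> : x - Y x - (Y x - Y (Y x)) = x - (Y x + Y x) + Y (Y x).
    by rewrite opprB opprD !addrA addrAC.
  by rewrite h opprD opprB !addrA [_ + _ - x]addrAC subrr add0r -addrA addNr addr0.
rewrite !opZE !opDE !opNE (linear_scale lY) (linear_sub lY) -scalerBr scalerA.
rewrite e /B opZE scalerA -!rmorphM/= -expr2 sqr_sqrtr ?ltW//.
by rewrite divff ?gt_eqF// scale1r.
Qed.

Lemma op_absP T : bounded_op T -> positive_op (op_abs T) /\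
  forall x, op_abs T (op_abs T x) = op_adjoint T (T x).
Proof.
move=> bT; rewrite /op_abs; case: xgetP => [P _ [hP hPP]|h].
  by split => // x; have := congr1 (@^~ x) hPP.
have [bS hS] := op_adjointP bT.
have [|P hP] := @square_root_exists (op_adjoint T \o T).
  split; first exact: bounded_op_comp.
  move=> x; rewrite /= inner_conj -hS inner_self.
  rewrite (_ : (_ ^*) = (ell2_norm (T x) ^+ 2)%:C); last exact: conj_real.
  by rewrite ler0c sqr_ge0.
by have := h P hP.
Qed.

End SquareRoot.

(** * The dual of the operator norm on matrices *)

Section DualNorm.
Variable R : realType.
Implicit Types (m : nat -> nat -> R[i]) (d : nat).

Definition pairing d (Y : 'I_d -> 'I_d -> R[i]) m : R[i] :=
  \sum_(i < d) \sum_(j < d) Y i j * m i j.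

(** The trace norm of the upper left [d x d] corner of [m], as a norm dual to
    the operator norm. *)
Definition dual_norm d m : R :=
  sup [set modc (pairing Y m) | Y in [set Y : 'I_d -> 'I_d -> R[i] | form_bound 1 Y]].

Lemma form_bound_zero d (c : R) : 0 <= c ->
  form_bound c (fun _ _ : 'I_d => 0 : R[i]).
Proof.
move=> c0 xi eta; rewrite big1 ?modc0 ?mulr_ge0 ?l2norm_ge0// => i _.
by rewrite big1// => j _; rewrite !mul0r.
Qed.

Lemma l2norm_delta (I : finType) (i : I) :
  l2norm (fun k => (k == i)%:R : R[i]) = 1.
Proof.
rewrite /l2norm (bigD1 i)//= eqxx modc1 expr1n big1 ?addr0 ?sqrtr1// => k.
by move=> /negbTE ->; rewrite modc0 expr0n.
Qed.

Lemma form_bound_entry (I J : finType) (c : R) (Y : I -> J -> R[i]) i j :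
  form_bound c Y -> modc (Y i j) <= c.
Proof.
move=> hY; have := hY (fun k => (k == i)%:R) (fun k => (k == j)%:R).
rewrite !l2norm_delta !mulr1 (bigD1 i)//= [X in _ + X]big1; last first.
  by move=> k /negbTE ->; apply: big1 => l _; rewrite mulr0 mul0r.
rewrite addr0 (bigD1 j)//= [X in _ + X]big1 ?addr0; last first.
  by move=> l /negbTE ->; rewrite mulr0.
by rewrite !eqxx !mulr1.
Qed.

Lemma pairing_le_entries d Y m : form_bound 1 Y ->
  modc (@pairing d Y m) <= \sum_(i < d) \sum_(j < d) modc (m i j).
Proof.
move=> hY; apply: (le_trans (modc_sum _ _ _)); apply: ler_sum => i _.
apply: (le_trans (modc_sum _ _ _)); apply: ler_sum => j _.
by rewrite modcM ler_piMl ?modc_ge0// form_bound_entry.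
Qed.

Lemma dual_norm_has_sup d m : has_sup
  [set modc (pairing Y m) | Y in [set Y : 'I_d -> 'I_d -> R[i] | form_bound 1 Y]].
Proof.
split; first by exists (modc (pairing (fun _ _ : 'I_d => 0) m)), (fun _ _ => 0);
  [exact: form_bound_zero|].
exists (\sum_(i < d) \sum_(j < d) modc (m i j)) => _ [Y hY <-].
exact: pairing_le_entries.
Qed.

Lemma pairing_le_dual_norm d Y m : form_bound 1 Y ->
  modc (@pairing d Y m) <= dual_norm d m.
Proof.
by move=> hY; apply: ub_le_sup; [case: (dual_norm_has_sup d m)|exists Y].
Qed.

Lemma dual_norm_le d m (B : R) :
  (forall Y, form_bound 1 Y -> modc (@pairing d Y m) <= B) -> dual_norm d m <= B.
Proof.
move=> h; apply: ge_sup; first by case: (dual_norm_has_sup d m).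
by move=> _ [Y hY <-]; exact: h.
Qed.

Lemma dual_norm_le_entries d m :
  dual_norm d m <= \sum_(i < d) \sum_(j < d) modc (m i j).
Proof. by apply: dual_norm_le => Y; exact: pairing_le_entries. Qed.

Lemma dual_norm_ge0 d m : 0 <= dual_norm d m.
Proof.
have h := @form_bound_zero d 1 ler01.
exact: le_trans (modc_ge0 _) (pairing_le_dual_norm m h).
Qed.

Lemma eq_dual_norm d m m' : (forall i j, (i < d)%N -> (j < d)%N -> m i j = m' i j) ->
  dual_norm d m = dual_norm d m'.
Proof.
move=> h; have e Y : @pairing d Y m = pairing Y m'.
  by apply: eq_bigr => i _; apply: eq_bigr => j _; rewrite h.
by rewrite /dual_norm; congr sup; apply/seteqP; split => _ [Y hY <-]; exists Y => //; rewrite e.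
Qed.

Lemma pairingD d Y m m' :
  @pairing d Y (fun i j => m i j + m' i j) = pairing Y m + pairing Y m'.
Proof.
rewrite -big_split; apply: eq_bigr => i _; rewrite -big_split.
by apply: eq_bigr => j _; rewrite mulrDr.
Qed.

Lemma pairingZ d Y c m :
  @pairing d Y (fun i j => c * m i j) = c * pairing Y m.
Proof.
rewrite mulr_sumr; apply: eq_bigr => i _; rewrite mulr_sumr.
by apply: eq_bigr => j _; rewrite mulrCA.
Qed.

Lemma dual_normD d m m' :
  dual_norm d (fun i j => m i j + m' i j) <= dual_norm d m + dual_norm d m'.
Proof.
apply: dual_norm_le => Y hY; rewrite pairingD; apply: (le_trans (modcD _ _)).
by rewrite lerD// pairing_le_dual_norm.
Qed.

Lemma dual_normZ d c m :
  dual_norm d (fun i j => c * m i j) <= modc c * dual_norm d m.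
Proof.
apply: dual_norm_le => Y hY; rewrite pairingZ modcM.
by rewrite ler_wpM2l ?modc_ge0// pairing_le_dual_norm.
Qed.

Lemma dual_norm_dist d m m' : `|dual_norm d m - dual_norm d m'| <=
  dual_norm d (fun i j => m i j - m' i j).
Proof.
have h (a b : nat -> nat -> R[i]) :
    dual_norm d a - dual_norm d b <= dual_norm d (fun i j => a i j - b i j).
  rewrite lerBlDr; apply: le_trans (dual_normD _ _ _).
  rewrite le_eqVlt; apply/orP; left; apply/eqP; apply: eq_dual_norm => i j _ _.
  by rewrite subrK.
rewrite ler_norml h andbT lerNl opprB; apply: (le_trans (h m' m)).
have := dual_normZ d (-1) (fun i j => m i j - m' i j).
rewrite modcN modc1 mul1r; apply: le_trans.
rewrite le_eqVlt; apply/orP; left; apply/eqP; apply: eq_dual_norm => i j _ _.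
by rewrite mulN1r opprB.
Qed.

End DualNorm.

(** * The trace norm as a dual norm *)

Lemma cvg_double (R : realType) (f : nat -> R) (l : R) :
  f @ \oo --> l -> (fun n => f (n + n)%N) @ \oo --> l.
Proof.
move=> /cvgrPdist_le hf; apply/cvgrPdist_le => e e0.
have [N _ hN] := hf e e0; exists N => // n Nn; apply: hN.
exact: leq_trans Nn (leq_addr _ _).
Qed.

Section TraceNorm.
Variable R : realType.
Local Notation H := (ell2 R).
Local Notation e_ := (ell2_basis R).
Implicit Types (x y z : H) (S T P A U : H -> H).

Definition op_matrix T (i j : nat) : R[i] := T (e_ j) i.

(** An approximation of the partial isometry of the polar decomposition, which
    avoids inverting [|T|] on its range.  With [A = 1 - |T|/c] for a large [c], the
    operators [U_l = c^-1 T (1 + A + ... + A^(2l-1))] are contractions, because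
    [|T| (1 + A + ... + A^(2l-1)) = c (1 - A^(2l))], and
    [U_l |T| = T (1 - A^(2l))] tends to [T]. *)
Lemma approximate_polar T : bounded_op T -> exists U : nat -> H -> H,
  [/\ forall l, linear (U l), forall l, op_bound (U l) 1,
      forall x, nconv (fun l => U l (op_abs T x)) (T x) &
      forall x, cconv (fun l => ell2_inner (T x) (U l x))
                      (ell2_inner (op_abs T x) x)].
Proof.
move=> bT; have [hP hPP] := op_absP bT; set P := op_abs T in hP hPP *.
have [_ hS] := op_adjointP bT.
have lT := bounded_op_linear bT; have lP := bounded_op_linear hP.1.
have sP := positive_self_adjoint hP.
have TP x y : ell2_inner (T x) (T y) = ell2_inner (P x) (P y).
  by rewrite sP hPP hS.
have nTP x : ell2_norm (T x) = ell2_norm (P x).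
  apply/eqP; rewrite -(@eqrXn2 _ 2)// ?ell2_norm_ge0//.
  by apply/eqP/(@complexI R); rewrite -!inner_self TP.
have [c0 [c00 hc0]] := bounded_op_nonneg_bound hP.1.
pose c := c0 + 1; have cp : 0 < c by rewrite ltr_wpDl.
have cN0 : c%:C != 0 :> R[i] by rewrite fmorph_eq0 gt_eqF.
pose Q := (c^-1%:C : R[i]) *: P.
have cQ : positive_contraction Q.
  have qQ x : quad_form Q x = c^-1 * quad_form P x.
    by rewrite {1}/quad_form /Q opZE innerZl positive_quad_formE// -rmorphM.
  split; first apply: self_adjoint_positive.
  - by apply: bounded_op_scale; exact: hP.1.
  - move=> x y; rewrite /Q !opZE innerZl innerZr sP.
    congr (_ * _); exact: (esym (conj_real _)).
  - by move=> x; rewrite qQ mulr_ge0 ?invr_ge0 ?(ltW cp)// positive_quad_form_ge0.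
  move=> x; rewrite qQ mulrC ler_pdivrMr//.
  apply: (@le_trans _ _ (modc (ell2_inner (P x) x))).
    exact: le_trans (ler_norm _) (Re_le_modc _).
  apply: (le_trans (inner_cauchy_schwarz _ _)).
  rewrite expr2 -mulrA mulrC ler_wpM2l ?ell2_norm_ge0//.
  apply: (le_trans (hc0 x)); rewrite mulrC ler_wpM2l ?ell2_norm_ge0//.
  by rewrite lerDl.
pose A := id - Q; have cA : positive_contraction A := positive_contraction_compl cQ.
have lA := bounded_op_linear cA.1.1.
have bA n : bounded_op (iter n A) := bounded_op_iter n cA.1.1.
have lAn n := bounded_op_linear (bA n).
have QE x : Q x = x - A x by rewrite /A opDE opNE opprB addrC subrK.
have PE x : P x = c%:C *: (x - A x).
  by rewrite -QE /Q opZE scalerA -rmorphM/= divff ?gt_eqF// scale1r.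
pose G k x : H := \sum_(i < k) iter i A x.
have telescope k x : \sum_(i < k) (iter i A x - iter i.+1 A x) = x - iter k A x.
  elim: k => [|k ih]; first by rewrite big_ord0 subrr.
  by rewrite big_ord_recr/= ih addrA subrK.
have PG k x : P (G k x) = c%:C *: (x - iter k A x).
  rewrite PE; congr (_ *: _); rewrite -telescope /G (linear_bigsum lA) -sumrB.
  by [].
have GP k x : G k (P x) = c%:C *: (x - iter k A x).
  rewrite -telescope /G scaler_sumr; apply: eq_bigr => i _.
  by rewrite PE (linear_scale (lAn i)) (linear_sub (lAn i)) -iterSr.
have lG k : linear (G k).
  move=> a x y; rewrite /G scaler_sumr -big_split/=; apply: eq_bigr => i _.
  exact: lAn.
pose U l x : H := (c^-1%:C : R[i]) *: T (G (l + l)%N x).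
have Ac x : nconv (fun l => P (iter (l + l) A x)) 0.
  have h : nconv (fun k => P (iter k A x)) 0.
    rewrite -(scaler0 _ (c%:C : R[i])).
    by apply: (nconv_ext _ (nconvZ (c%:C) (positive_contraction_iter_diff x cA))) => n;
      rewrite PE.
  exact: (@cvg_double _ (fun k => ell2_norm (P (iter k A x) - 0))).
exists U; split.
- by move=> l a x y; rewrite /U lG lT scalerDr !scalerA mulrC.
- move=> l x; rewrite /U ell2_normZ nTP -ell2_normZ PG scalerA -rmorphM/=.
  rewrite mulVf ?gt_eqF// scale1r.
  have := positive_contraction_compl (positive_contraction_iter_double l cA).
  by move=> /positive_contraction_bound/(_ x).
- move=> x.
  have e l : U l (P x) = T x - T (iter (l + l) A x).
    rewrite /U GP (linear_scale lT) scalerA -rmorphM/= mulVf ?gt_eqF// scale1r.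
    exact: linear_sub.
  apply: (nconv_ext e); rewrite -[X in nconv _ X]subr0.
  apply: nconvB; first exact: nconv_cst.
  by apply: cvg_ext (Ac x) => n; rewrite !subr0 nTP.
- move=> x.
  have e l : ell2_inner (T x) (U l x) =
      ell2_inner (P x) x - ell2_inner x (P (iter (l + l) A x)).
    rewrite /U -(linear_scale lT) TP (linear_scale lP) PG scalerA -rmorphM/=.
    by rewrite mulVf ?gt_eqF// scale1r innerBr; congr (_ - _); exact: sP.
  apply: (cconv_ext e); rewrite -[X in cconv _ X]subr0.
  apply: cconvB; first exact: cconv_cst.
  have <- : (ell2_inner 0 x)^* = 0 by rewrite inner0l; exact: conjC0.
  by apply: (cconv_ext _ (cconvJ (nconv_inner x (Ac x)))) => n; exact: inner_conj.
Qed.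

Lemma pos_trace_ge P n : positive_op P ->
  ((\sum_(k < n) quad_form P (e_ k))%:E <= pos_trace P)%E.
Proof.
move=> hP; rewrite -sumEFin.
have := @nneseries_lim_ge R (fun k => (quad_form P (e_ k))%:E) xpredT 0 n.
rewrite big_mkord; apply => k _ _.
by rewrite lee_fin positive_quad_form_ge0.
Qed.

(** Writing [|T| = Q^2], the pairing of [Y] with [U_l |T|] is a Hilbert-Schmidt
    pairing of [Q] with [Y U_l Q], and the squared Hilbert-Schmidt norm of [Q] is
    the trace of [|T|]. *)
Lemma pairing_le_trace_norm T d (Y : 'I_d -> 'I_d -> R[i]) : bounded_op T ->
  form_bound 1 Y -> ((modc (pairing Y (op_matrix T)))%:E <= trace_norm T)%E.
Proof.
move=> bT hY; have [hP _] := op_absP bT.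
rewrite /trace_norm; set P := op_abs T in hP *.
have tr0 n := pos_trace_ge n hP.
case E: (pos_trace P) => [tau| |]; rewrite ?leey//; last first.
  by have := tr0 0%N; rewrite big_ord0 E leeNy_eq.
have {}tr0 n : \sum_(k < n) quad_form P (e_ k) <= tau.
  by have := tr0 n; rewrite E lee_fin.
have tau0 : 0 <= tau by have := tr0 0%N; rewrite big_ord0.
rewrite lee_fin.
have [Q [hQ QQ]] := square_root_exists hP.
have lQ := bounded_op_linear hQ.1.
have qQ x : quad_form P x = ell2_norm (Q x) ^+ 2.
  apply: (@complexI R); rewrite -positive_quad_formE// -QQ /= -inner_self.
  exact: positive_self_adjoint.
have [U [lU bU UP _]] := approximate_polar bT; rewrite -/P in UP.
have bUop l : bounded_op (U l) by split; [exact: lU|exists 1; exact: bU].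
have lims : cconv (fun l => pairing Y (op_matrix (U l \o P)))
    (pairing Y (op_matrix T)).
  apply: cconv_sum => i; apply: cconv_sum => j; apply: cconvZ.
  rewrite /op_matrix -inner_basis.
  apply: (cconv_ext _ (nconv_inner (e_ i) (UP (e_ j)))) => l.
  by rewrite inner_basis.
apply: cconv_le lims _ => l.
pose V := U l \o Q; have bV : bounded_op V by apply: bounded_op_comp; [|exact: hQ.1].
have lims2 : cconv (fun N => pairing Y (fun i j => V (truncate N (Q (e_ j))) i))
    (pairing Y (op_matrix (U l \o P))).
  apply: cconv_sum => i; apply: cconv_sum => j; apply: cconvZ.
  rewrite /op_matrix -inner_basis -QQ.
  apply: (cconv_ext _ (nconv_inner (e_ i)
    (bounded_op_nconv bV (nconv_truncate (Q (e_ j)))))) => N.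
  by rewrite inner_basis.
apply: cconv_le lims2 _ => N.
have -> : pairing Y (fun i j => V (truncate N (Q (e_ j))) i) =
    \sum_(p : 'I_N * 'I_d) (Q (e_ p.2) p.1 *
       \sum_(i < d) Y i p.2 * V (e_ p.1) i).
  rewrite sum_pair /pairing exchange_big/= [RHS]exchange_big/=.
  apply: eq_bigr => j _; under [RHS]eq_bigr do rewrite mulr_sumr.
  rewrite [RHS]exchange_big/=; apply: eq_bigr => i _.
  rewrite /truncate (linear_bigsum (bounded_op_linear bV)) ell2_sumE mulr_sumr.
  apply: eq_bigr => k _.
  by rewrite (linear_scale (bounded_op_linear bV)) ell2ZE mulrCA.
apply: (le_trans (l2norm_cauchy_schwarz _ _)).
have -> : tau = Num.sqrt tau * Num.sqrt tau by rewrite -expr2 sqr_sqrtr.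
apply: ler_pM; rewrite ?l2norm_ge0//; apply: ler_wsqrtr; rewrite sum_pair/=.
  rewrite exchange_big/=; apply: le_trans (tr0 d); apply: ler_sum => j _.
  by rewrite qQ partial_sum_le_norm.
apply: le_trans (tr0 N); apply: ler_sum => k _.
have := form_boundP ler01 (form_bound_tr hY) (fun i => V (e_ k) i).
rewrite expr1n mul1r => /le_trans; apply.
apply: (le_trans (partial_sum_le_norm _ _)); rewrite qQ.
rewrite ler_pXn2r ?nnegrE ?ell2_norm_ge0//.
by have := bU l (Q (e_ k)); rewrite mul1r.
Qed.

Lemma cconv_le_near (u : nat -> R[i]) (a : R[i]) (B : R) N : cconv u a ->
  (forall n, (N <= n)%N -> modc (u n) <= B) -> modc a <= B.
Proof.
move=> /cconv_modc ua h; rewrite -(cvg_lim _ ua)//.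
by apply: limr_le; [apply/cvg_ex; exists (modc a)|exists N].
Qed.

(** The partial traces of [|T|] are the limits of the pairings of [T] with the
    adjoints of the contractions [U_l], truncated to finite matrices. *)
Lemma trace_norm_le T (B : R) : bounded_op T ->
  (forall d, dual_norm d (op_matrix T) <= B) -> (trace_norm T <= B%:E)%E.
Proof.
move=> bT hB; have [hP _] := op_absP bT.
rewrite /trace_norm; set P := op_abs T in hP *.
apply: lime_le; first by apply: is_cvg_nneseries => n _ _;
  rewrite lee_fin positive_quad_form_ge0.
near=> d; rewrite big_mkord sumEFin lee_fin.
have [U [lU bU _ hU]] := approximate_polar bT; rewrite -/P in hU.
have lims : cconv (fun l => \sum_(n < d) ell2_inner (T (e_ n)) (U l (e_ n)))
    (\sum_(n < d) ell2_inner (P (e_ n)) (e_ n)).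
  by apply: cconv_sum => n; exact: hU.
apply: (@le_trans _ _ (modc (\sum_(n < d) ell2_inner (P (e_ n)) (e_ n)))).
  apply: le_trans (le_trans (ler_norm _) (Re_le_modc _)).
  by rewrite (raddf_sum (@complex.Re R : Rcomplex R -> R)).
apply: cconv_le lims _ => l.
have lims2 : cconv (fun m => \sum_(n < d) partial_inner (T (e_ n)) (U l (e_ n)) m)
    (\sum_(n < d) ell2_inner (T (e_ n)) (U l (e_ n))).
  by apply: cconv_sum => n; exact: inner_cconv.
apply: (cconv_le_near (N := d) lims2) => m dm.
pose Y (i j : 'I_m) : R[i] := if (j < d)%N then (U l (e_ j) i)^* else 0.
have hY : form_bound 1 Y.
  move=> xi eta.
  have := finite_section_bound ler01 (lU l) (bU l) (n := m) (fun i => (xi i)^*)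
    (fun j => if (j < d)%N then (eta j)^* else 0).
  rewrite l2normJ mul1r -modcJ => h.
  have e : (\sum_(i < m) \sum_(j < m) U l (e_ j) i * (xi i)^* *
      (if (j < d)%N then (eta j)^* else 0))^* =
      \sum_i \sum_j Y i j * xi i * eta j.
    rewrite rmorph_sum; apply: eq_bigr => i _; rewrite rmorph_sum.
    apply: eq_bigr => j _; rewrite /Y; case: ifP => _.
      by rewrite !rmorphM; congr (_ * _ * _); exact: conjCK.
    by rewrite mulr0 !mul0r rmorph0.
  rewrite -e; apply: (le_trans h).
  rewrite ler_wpM2l ?l2norm_ge0//; apply: ler_l2norm; apply: ler_sum => j _.
  by case: ifP => _; rewrite ?modcJ// modc0 expr0n sqr_ge0.
apply: le_trans (hB m); apply: le_trans (pairing_le_dual_norm _ hY).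
rewrite le_eqVlt; apply/orP; left; apply/eqP; congr modc.
rewrite /pairing [RHS]exchange_big/=.
transitivity (\sum_(n < m | (n < d)%N) partial_inner (T (e_ n)) (U l (e_ n)) m).
  exact: (big_ord_widen m (fun n => partial_inner (T (e_ n)) (U l (e_ n)) m) dm).
rewrite big_mkcond/=; apply: eq_bigr => j _; rewrite /Y; case: ifP => _.
  by apply: eq_bigr => i _; rewrite mulrC.
by rewrite big1// => i _; rewrite mul0r.
Unshelve. all: by end_near. Qed.

Lemma trace_normE T : bounded_op T ->
  trace_norm T = ereal_sup (range (fun d => (dual_norm d (op_matrix T))%:E)).
Proof.
move=> bT; apply/eqP; rewrite eq_le; apply/andP; split; last first.
  apply: ge_ereal_sup => _ [d _ <-].
  case E : (trace_norm T) => [t| |]; rewrite ?leey//.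
    rewrite lee_fin; apply: dual_norm_le => Y hY.
    by have := pairing_le_trace_norm bT hY; rewrite E lee_fin.
  have := pairing_le_trace_norm bT (@form_bound_zero R 0 1 ler01).
  by rewrite E leeNy_eq.
set s := ereal_sup _.
have ub d : ((dual_norm d (op_matrix T))%:E <= s)%E.
  by apply: ereal_sup_ubound; exists d.
case E : s => [t| |]; rewrite ?leey//.
  by apply: trace_norm_le => // d; have := ub d; rewrite E lee_fin.
by have := ub 0%N; rewrite E leeNy_eq.
Qed.

End TraceNorm.

(** * Integrals over the circle and roots of unity *)

Section CircleIntegral.
Variable R : realType.
Local Notation mu := (@lebesgue_measure R).
Implicit Types (h : R -> R).

Lemma continuous_measurable_EFin h (D : set R) : measurable D -> continuous h ->
  measurable_fun D (EFin \o h).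
Proof.
move=> mD ch; apply/measurable_EFinP; apply: measurable_funTS.
exact: continuous_measurable_fun.
Qed.

Lemma integral_translate h (s b : R) : 0 < b -> continuous h ->
  (\int[mu]_(x in `[s, (b + s)%R]) (h x)%:E = \int[mu]_(x in `[0%R, b]) (h (x + s)%R)%:E)%E.
Proof.
move=> b0 ch; pose F (x : R) := x + s.
have dF (x : R) : is_derive x 1 F 1.
  by rewrite -[X in is_derive _ _ _ X]addr0; apply: is_deriveD.
have F1 : derive1 F = cst 1 by apply/funext => x; rewrite derive1E; exact: derive_val.
have cF : continuous F by move=> x; apply: cvgD; [exact: cvg_id|exact: cvg_cst].
have -> : `[s, b + s]%classic = `[F 0, F b]%classic by rewrite /F add0r.
rewrite integration_by_substitution_increasing ?ltW//.
- by apply: eq_integral => x _; rewrite F1 /F /= mulr1.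
- by move=> x y _ _ xy; rewrite ltrD2r.
- by rewrite F1 => x _; exact: cvg_cst.
- by rewrite F1; exact: is_cvg_cst.
- by rewrite F1; exact: is_cvg_cst.
- split; first by move=> x _; exact: (@ex_derive _ _ _ _ _ _ _ (dF x)).
  + by apply: cvg_at_right_filter; exact: cF.
  + by apply: cvg_at_left_filter; exact: cF.
- by apply: continuous_subspaceT.
Qed.

Lemma integral_itv_split h (a b c : R) : a <= b -> b <= c -> continuous h ->
  (forall t, 0 <= h t) ->
  (\int[mu]_(x in `[a, c]) (h x)%:E =
    \int[mu]_(x in `[a, b]) (h x)%:E + \int[mu]_(x in `[b, c]) (h x)%:E)%E.
Proof.
move=> ab bc ch h0; have mh D (mD : measurable D) := @continuous_measurable_EFin h D mD ch.
rewrite -(@integral_itv_bndo_bndc _ (BLeft a) b); last by apply: mh.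
have -> : `[a, c]%classic = `[a, b[%classic `|` `[b, c]%classic.
  by rewrite -itv_bndbnd_setU// bnd_simp.
rewrite ge0_integral_setU//.
- by apply: mh; apply: measurableU.
- by move=> x _; rewrite lee_fin.
- apply/disj_setPLR => x /=; rewrite !in_itv/= => /andP[_ xb].
  by apply/negP; rewrite negb_and -ltNge xb.
Qed.

Lemma circle_int_roots h (K : nat) : (0 < K)%N -> continuous h ->
  (forall t, 0 <= h t) ->
  circle_int (fun t => (h t)%:E) =
    (\int[mu]_(t in `[0%R, K%:R^-1%R]) (\sum_(q < K) h (t + q%:R / K%:R))%R%:E)%E.
Proof.
move=> K0 ch h0; have KR : 0 < K%:R :> R by rewrite ltr0n.
have mh D (mD : measurable D) := @continuous_measurable_EFin h D mD ch.
have step n : (\int[mu]_(x in `[0%R, (n%:R / K%:R)%R]) (h x)%:E =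
    \sum_(q < n) \int[mu]_(x in `[0%R, K%:R^-1%R]) (h (x + q%:R / K%:R)%R)%:E)%E.
  elim: n => [|n ih].
    by rewrite big_ord0 mul0r set_itv1 integral_set1.
  rewrite big_ord_recr/= -ih -integral_translate ?invr_gt0//.
  have -> : K%:R^-1 + n%:R / K%:R = n.+1%:R / K%:R :> R.
    by rewrite -natr1 mulrDl mul1r addrC.
  apply: integral_itv_split => //.
  by rewrite ler_pM2r ?invr_gt0// ler_nat.
rewrite /circle_int; have := step K; rewrite divff ?gt_eqF// => ->.
under [RHS]eq_integral do rewrite -sumEFin.
rewrite ge0_integral_sum//.
- move=> q; apply: continuous_measurable_EFin => // x.
  by apply: continuous_comp; [apply: cvgD; [exact: cvg_id|exact: cvg_cst]|exact: ch].
- by move=> q x _; rewrite lee_fin.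
Qed.

(** Averaging over the cosets of the [K]-th roots of unity preserves the
    integral, so inequalities between coset sums integrate. *)
Lemma circle_int_le_roots h1 h2 (K : nat) (c : R) : (0 < K)%N -> 0 <= c ->
  continuous h1 -> continuous h2 -> (forall t, 0 <= h1 t) -> (forall t, 0 <= h2 t) ->
  (forall t, \sum_(q < K) h1 (t + q%:R / K%:R) <=
       c * \sum_(q < K) h2 (t + q%:R / K%:R)) ->
  (circle_int (fun t => (h1 t)%:E) <= c%:E * circle_int (fun t => (h2 t)%:E))%E.
Proof.
move=> K0 c0 ch1 ch2 h10 h20 le12.
rewrite (circle_int_roots K0 ch1 h10) (circle_int_roots K0 ch2 h20).
have csum h : continuous h -> continuous (fun t : R => \sum_(q < K) h (t + q%:R / K%:R)).
  move=> ch; elim: (index_enum _) => [|q s ih] x.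
    by under eq_fun do rewrite big_nil; exact: cvg_cst.
  under eq_fun do rewrite big_cons; apply: cvgD; last exact: ih.
  by apply: continuous_comp; [apply: cvgD; [exact: cvg_id|exact: cvg_cst]|exact: ch].
have sum0 h : (forall t, 0 <= h t) -> forall t, 0 <= \sum_(q < K) h (t + q%:R / K%:R).
  by move=> h0 t; apply: sumr_ge0.
rewrite -ge0_integralZl ?lee_fin//; last 2 first.
- by apply: continuous_measurable_EFin => //; exact: csum.
- by move=> t _; rewrite lee_fin sum0.
apply: ge0_le_integral => //.
- by move=> t _; rewrite lee_fin sum0.
- by apply: continuous_measurable_EFin => //; exact: csum.
- apply: measurable_funeM; apply: continuous_measurable_EFin => //; exact: csum.
- by move=> t _; rewrite -EFinM lee_fin.
Qed.

Lemma circle_int_cst (v : R) : circle_int (fun=> v%:E) = v%:E.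
Proof.
rewrite /circle_int integral_cst//= lebesgue_measure_itv/= lte_fin ltr01.
by rewrite oppr0 adde0 mule1.
Qed.

Lemma circle_int_ge_roots h (K : nat) (v : R) : (0 < K)%N -> 0 <= v ->
  continuous h -> (forall t, 0 <= h t) ->
  (forall t, K%:R * v <= \sum_(q < K) h (t + q%:R / K%:R)) ->
  (v%:E <= circle_int (fun t => (h t)%:E))%E.
Proof.
move=> K0 v0 ch h0 hv.
have := @circle_int_le_roots (fun=> v) h K 1 K0 ler01 _ ch (fun=> v0) h0.
rewrite circle_int_cst mul1e; apply; first by move=> x; exact: cvg_cst.
by move=> t; rewrite mul1r sumr_const card_ord -[v *+ K]mulr_natl; exact: hv.
Qed.

Lemma circle_int_le_roots_cst h (K : nat) (v : R) : (0 < K)%N -> 0 <= v ->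
  continuous h -> (forall t, 0 <= h t) ->
  (forall t, \sum_(q < K) h (t + q%:R / K%:R) <= K%:R * v) ->
  (circle_int (fun t => (h t)%:E) <= v%:E)%E.
Proof.
move=> K0 v0 ch h0 hv.
have := @circle_int_le_roots h (fun=> v) K 1 K0 ler01 ch _ h0 (fun=> v0).
rewrite circle_int_cst mul1e; apply; first by move=> x; exact: cvg_cst.
by move=> t; rewrite mul1r sumr_const card_ord -[v *+ K]mulr_natl; exact: hv.
Qed.

Lemma circle_ptD (s t : R) : circle_pt (s + t) = circle_pt s * circle_pt t.
Proof.
rewrite /circle_pt mulrDr cosD sinD; congr (_ +i* _).
by ring.
Qed.

Lemma circle_pt0 : circle_pt 0 = 1 :> R[i].
Proof. by rewrite /circle_pt mulr0 cos0 sin0. Qed.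

Lemma circle_ptX (t : R) n : circle_pt (n%:R * t) = circle_pt t ^+ n.
Proof.
elim: n => [|n ih]; first by rewrite mul0r circle_pt0.
by rewrite -natr1 mulrDl mul1r circle_ptD ih exprSr.
Qed.

Lemma modc_circle_pt (t : R) : modc (circle_pt t) = 1.
Proof.
apply/eqP; rewrite -(@eqrXn2 _ 2) ?modc_ge0// expr1n.
by rewrite sqr_modc /circle_pt/= cos2Dsin2.
Qed.

Lemma circle_pt1 : circle_pt 1 = 1 :> R[i].
Proof. by rewrite /circle_pt mulr1 mulr_natl cos2pi sin2pi. Qed.

Lemma circle_pt_neq1 (t : R) : 0 < t < 1 -> circle_pt t != 1.
Proof.
move=> /andP[t0 t1]; apply/negP => /eqP/(congr1 (@complex.Re R)) /=.
rewrite -mulrA mulr_natl cos_mulr2n.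
have : 0 < sin (pi * t) by rewrite sin_gt0_pi// mulr_gt0 ?pi_gt0//= gtr_pMr ?pi_gt0.
have := cos2Dsin2 (pi * t); rewrite -mulr_natl; nra.
Qed.

(** Geometric sums. *)
Lemma root_orthogonal_powers K : (0 < K)%N ->
  orthogonal_powers K (circle_pt (K%:R^-1 : R)).
Proof.
move=> K0 i j iK jK; have KR : 0 < K%:R :> R by rewrite ltr0n.
set w := circle_pt _.
have w1 : modc w = 1 by exact: modc_circle_pt.
have [<-|ij] := eqVneq i j.
  under eq_bigr do rewrite unit_pow_conj//.
  by rewrite sumr_const card_ord.
pose z := w ^+ i * (w ^+ j)^*.
have zE q : w ^+ (q * i) * (w ^+ (q * j))^* = z ^+ q.
  by rewrite /z exprMn -rmorphXn/= -!exprM ![(_ * q)%N]mulnC.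
under eq_bigr do rewrite zE.
have zK : z ^+ K = 1.
  rewrite -zE exprM exprM -(circle_ptX K%:R^-1 K) divff ?gt_eqF// circle_pt1.
  by rewrite !expr1n mul1r; exact: conjC1.
have wpow n : w ^+ n = circle_pt (n%:R / K%:R) by rewrite circle_ptX.
have wneq k l : (k < l)%N -> (l < K)%N -> w ^+ k != w ^+ l.
  move=> kl lK; rewrite -(subnKC (ltnW kl)) exprD; apply/negP => /eqP h.
  have : w ^+ (l - k) = 1.
    have wk : w ^+ k != 0 by rewrite -modc_eq0 modcX w1 expr1n oner_eq0.
    by apply: (mulfI wk); rewrite -h mulr1.
  move=> /eqP; rewrite wpow; apply/negP/circle_pt_neq1.
  rewrite divr_gt0 ?ltr0n ?subn_gt0//= ltr_pdivrMr// mul1r ltr_nat.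
  exact: leq_ltn_trans (leq_subr _ _) lK.
have z1 : z != 1.
  apply/negP => /eqP h; have : w ^+ i = w ^+ j.
    by rewrite -[LHS]mulr1 -(unit_pow_conj w1 j) mulrCA -/z h mulr1.
  move/eqP; case: ltngtP ij => // ij _; first exact/negP/wneq.
  by rewrite eq_sym; exact/negP/wneq.
have := subrX1 z K; rewrite zK subrr => /esym/eqP.
by rewrite mulf_eq0 subr_eq0 (negbTE z1)/= => /eqP.
Qed.

Lemma circle_pt_root (t : R) K q :
  circle_pt (t + q%:R / K%:R) = circle_pt t * circle_pt (K%:R^-1) ^+ q.
Proof. by rewrite circle_ptD circle_ptX. Qed.

Lemma continuous_cos_sin_line (t : R) :
  {for t, continuous (fun t : R => cos (2 * pi * t))} /\
  {for t, continuous (fun t : R => sin (2 * pi * t))}.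
Proof.
have cl : {for t, continuous (fun t : R => 2 * pi * t)}.
  by apply: cvgM; [exact: cvg_cst|exact: cvg_id].
split; first by apply: continuous_comp => //; exact: continuous_cos.
by apply: continuous_comp => //; exact: continuous_sin.
Qed.

End CircleIntegral.

(** * Continuity in the circle variable *)

Section ComplexContinuity.
Variable R : realType.
Implicit Types f g : R -> R[i].

Definition ccontinuous f := continuous (fun t => complex.Re (f t)) /\
  continuous (fun t => complex.Im (f t)).

Lemma ccontinuous_cst (a : R[i]) : ccontinuous (fun=> a).
Proof. by split => x; exact: cvg_cst. Qed.

Lemma ccontinuousD f g : ccontinuous f -> ccontinuous g ->
  ccontinuous (fun t => f t + g t).
Proof.
move=> [fr fi] [gr gi]; split => x.
  rewrite (_ : (fun t => _) = (fun t => complex.Re (f t) + complex.Re (g t))).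
    by apply: cvgD; [exact: fr|exact: gr].
  by apply/funext => t; case: (f t) (g t) => ? ? [? ?].
rewrite (_ : (fun t => _) = (fun t => complex.Im (f t) + complex.Im (g t))).
  by apply: cvgD; [exact: fi|exact: gi].
by apply/funext => t; case: (f t) (g t) => ? ? [? ?].
Qed.

Lemma ccontinuousM f g : ccontinuous f -> ccontinuous g ->
  ccontinuous (fun t => f t * g t).
Proof.
move=> [fr fi] [gr gi]; split => x.
  rewrite (_ : (fun t => _) = (fun t => complex.Re (f t) * complex.Re (g t) -
      complex.Im (f t) * complex.Im (g t))).
    by apply: cvgB; apply: cvgM; [exact: fr|exact: gr|exact: fi|exact: gi].
  by apply/funext => t; case: (f t) (g t) => ? ? [? ?].
rewrite (_ : (fun t => _) = (fun t => complex.Re (f t) * complex.Im (g t) +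
    complex.Im (f t) * complex.Re (g t))).
  by apply: cvgD; apply: cvgM; [exact: fr|exact: gi|exact: fi|exact: gr].
by apply/funext => t; case: (f t) (g t) => ? ? [? ?].
Qed.

Lemma ccontinuousX f n : ccontinuous f -> ccontinuous (fun t => f t ^+ n).
Proof.
move=> cf; elim: n => [|n ih]; first exact: (ccontinuous_cst 1).
by under eq_fun do rewrite exprS; exact: ccontinuousM.
Qed.

Lemma ccontinuous_sum (I : Type) (r : seq I) (f : I -> R -> R[i]) :
  (forall i, ccontinuous (f i)) -> ccontinuous (fun t => \sum_(i <- r) f i t).
Proof.
move=> cf; elim: r => [|i r ih].
  by under eq_fun do rewrite big_nil; exact: ccontinuous_cst.
by under eq_fun do rewrite big_cons; exact: ccontinuousD.
Qed.

Lemma ccontinuous_circle_pt : ccontinuous (@circle_pt R).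
Proof. by split => t; have [] := continuous_cos_sin_line t. Qed.

Lemma ccontinuous_modc f : ccontinuous f -> continuous (fun t => modc (f t)).
Proof.
move=> [fr fi] x; pose s t := complex.Re (f t) * complex.Re (f t)
   + complex.Im (f t) * complex.Im (f t).
have -> : (fun t => modc (f t)) = Num.sqrt \o s.
  by apply/funext => t; rewrite /modc normc_def !expr2.
apply: continuous_comp; last exact: sqrt_continuous.
by apply: cvgD; apply: cvgM; by [exact: fr|exact: fi].
Qed.

Lemma continuous_real_sum (I : Type) (r : seq I) (f : I -> R -> R) :
  (forall i, continuous (f i)) -> continuous (fun t => \sum_(i <- r) f i t).
Proof.
move=> cf; elim: r => [|i r ih] x.
  by under eq_fun do rewrite big_nil; exact: cvg_cst.
by under eq_fun do rewrite big_cons; apply: cvgD; [exact: cf|exact: ih].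
Qed.

(** A norm is Lipschitz with respect to the sum of the moduli of the entries. *)
Lemma continuous_dual_norm d (m : R -> nat -> nat -> R[i]) :
  (forall i j, ccontinuous (fun t => m t i j)) ->
  continuous (fun t => dual_norm d (m t)).
Proof.
move=> cm s; pose g t := \sum_(i < d) \sum_(j < d) modc (m t i j - m s i j).
have gc : {for s, continuous g}.
  apply: continuous_real_sum => i; apply: continuous_real_sum => j.
  by apply: ccontinuous_modc; apply: ccontinuousD => //; exact: ccontinuous_cst.
have gs : g s = 0.
  by apply: big1 => i _; apply: big1 => j _; rewrite subrr modc0.
apply/cvgrPdist_le => e e0.
have /cvgrPdist_le/(_ e e0) : g t @[t --> s] --> 0 by rewrite -gs.
apply: filterS => t; rewrite sub0r normrN => gt.
apply: le_trans (le_trans (ler_norm _) gt); rewrite distrC.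
exact: le_trans (dual_norm_dist _ _ _) (dual_norm_le_entries _ _).
Qed.

End ComplexContinuity.

(** * Corners and nearly optimal forms *)

Section DualNormMore.
Variable R : realType.
Implicit Types (m : nat -> nat -> R[i]) (d : nat).

Lemma form_bound_mono (I J : finType) (c c' : R) (Y : I -> J -> R[i]) :
  c <= c' -> form_bound c Y -> form_bound c' Y.
Proof.
move=> cc h xi eta; apply: (le_trans (h xi eta)); rewrite -!mulrA.
by rewrite ler_wpM2r// mulr_ge0 ?l2norm_ge0.
Qed.

Lemma dual_norm_mono d d' m : (d <= d')%N -> dual_norm d m <= dual_norm d' m.
Proof.
case: d => [|d] dd'.
  apply: dual_norm_le => Y _; rewrite /pairing big_ord0 modc0; exact: dual_norm_ge0.
apply: dual_norm_le => Y hY.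
pose Y' (i j : 'I_d') : R[i] :=
  if (i < d.+1)%N && (j < d.+1)%N then Y (inord i) (inord j) else 0.
have widen (V : nmodType) (f : 'I_d.+1 -> V) :
    \sum_i f i = \sum_(i < d' | (i < d.+1)%N) f (inord i).
  rewrite -(big_ord_widen d' (fun i => f (inord i)) dd').
  by apply: eq_bigr => i _; rewrite inord_val.
have sumE (F : 'I_d' -> 'I_d' -> R[i]) (G : 'I_d.+1 -> 'I_d.+1 -> R[i]) :
   (forall i j, F i j = if (i < d.+1)%N && (j < d.+1)%N then G (inord i) (inord j) else 0) ->
   \sum_i \sum_j F i j = \sum_i \sum_j G i j.
  move=> h; rewrite widen [RHS]big_mkcond/=; apply: eq_bigr => i _.
  case: ifP => id; last by apply: big1 => j _; rewrite h id.
  rewrite widen [RHS]big_mkcond/=; apply: eq_bigr => j _.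
  by rewrite h id.
have hY' : form_bound 1 Y'.
  move=> xi eta.
  pose x (i : 'I_d.+1) := xi (widen_ord dd' i).
  pose y (j : 'I_d.+1) := eta (widen_ord dd' j).
  have winord (i : 'I_d') : (i < d.+1)%N -> widen_ord dd' (inord i) = i.
    by move=> id; apply: val_inj; rewrite /= inordK.
  rewrite (sumE _ (fun i j => Y i j * x i * y j)); last first.
    move=> i j; rewrite /Y' /x /y; case: ifP => [/andP[id jd]|_].
      by rewrite !winord.
    by rewrite !mul0r.
  have le (z : 'I_d' -> R[i]) : l2norm (fun i => z (widen_ord dd' i)) <= l2norm z.
    apply: ler_l2norm; rewrite widen.
    under eq_bigr => i id do rewrite winord//.
    rewrite big_mkcond/=; apply: ler_sum => i _; case: ifP => _ //.
    exact: sqr_ge0.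
  apply: (le_trans (hY x y)); rewrite !mul1r.
  by apply: ler_pM; rewrite ?l2norm_ge0// le.
have <- : pairing Y' m = pairing Y m.
  rewrite /pairing (sumE _ (fun i j => Y i j * m i j))// => i j.
  rewrite /Y'; case: ifP => [/andP[id jd]|_]; last by rewrite mul0r.
  by rewrite !inordK.
exact: pairing_le_dual_norm.
Qed.

(** A nearly optimal form, rotated so that its value is real and nonnegative:
    such values can be added up over several matrices without cancellation. *)
Lemma dual_norm_approx d m (e : R) : 0 < e -> exists Y r,
  [/\ form_bound 1 Y, @pairing R d Y m = r%:C, 0 <= r & dual_norm d m - e <= r].
Proof.
move=> e0; have [_ [Y hY <-] lt] := sup_adherent e0 (dual_norm_has_sup d m).
set p := pairing Y m in lt.
have [p0|p0] := eqVneq p 0.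
  exists (fun _ _ => 0), 0; split => //; first exact: form_bound_zero.
    by rewrite /pairing big1// => i _; rewrite big1// => j _; rewrite mul0r.
  by move: lt; rewrite p0 modc0; exact: ltW.
have mp : modc p != 0 by rewrite modc_eq0.
pose u : R[i] := p^* / (modc p)%:C.
have u1 : modc u = 1.
  rewrite /u modcM modcJ -fmorphV modc_real ger0_norm ?invr_ge0 ?modc_ge0//.
  by rewrite divff.
exists (fun i j => u * Y i j), (modc p); split.
- by have := form_boundZ u hY; rewrite u1 mul1r.
- have -> : pairing (fun i j => u * Y i j) m = u * p.
    rewrite mulr_sumr; apply: eq_bigr => i _; rewrite mulr_sumr.
    by apply: eq_bigr => j _; rewrite mulrA.
  rewrite /u mulrAC [p^* * p]mulrC -sqr_modcC expr2 rmorphM/= mulfK//.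
  by rewrite fmorph_eq0.
- exact: modc_ge0.
- exact: ltW.
Qed.

End DualNormMore.

(** * The norm of operator valued polynomials *)

Section OperatorPolynomials.
Variable R : realType.
Local Notation H := (ell2 R).
Local Notation e_ := (ell2_basis R).
Implicit Types (T : H -> H) (a : nat -> H -> H) (N : nat).

Definition opoly N a (z : R[i]) : H -> H := \sum_(n < N) z ^+ n *: a n.

Lemma bounded_op_opoly N a z : (forall n, bounded_op (a n)) ->
  bounded_op (opoly N a z).
Proof. by move=> ba; apply: bounded_op_sum => n; exact: bounded_op_scale. Qed.

Lemma op_matrix_opoly N a z i j :
  op_matrix (opoly N a z) i j = \sum_(n < N) z ^+ n * op_matrix (a n) i j.
Proof. by rewrite /op_matrix /opoly op_sumE ell2_sumE. Qed.

Definition corner_norm d N a (t : R) : R :=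
  dual_norm d (op_matrix (opoly N a (circle_pt t))).

Lemma continuous_corner_norm d N a : continuous (corner_norm d N a).
Proof.
apply: continuous_dual_norm => i j.
rewrite (_ : (fun t => _) = (fun t => \sum_(n < N) circle_pt t ^+ n * op_matrix (a n) i j)).
  apply: ccontinuous_sum => n; apply: ccontinuousM; last exact: ccontinuous_cst.
  exact/ccontinuousX/ccontinuous_circle_pt.
by apply/funext => t; rewrite op_matrix_opoly.
Qed.

Lemma corner_norm_ge0 d N a t : 0 <= corner_norm d N a t.
Proof. exact: dual_norm_ge0. Qed.

Definition poly_trace_norm N a : \bar R :=
  circle_int (fun t => trace_norm (opoly N a (circle_pt t))).

Section Integrals.
Variables (N : nat) (a : nat -> H -> H).
Hypothesis ba : forall n, bounded_op (a n).

Lemma trace_norm_opoly_lim t : trace_norm (opoly N a (circle_pt t)) =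
  limn (fun d => (corner_norm d N a t)%:E).
Proof.
have nd : nondecreasing_seq (fun d => (corner_norm d N a t)%:E).
  by move=> d d' dd'; rewrite lee_fin dual_norm_mono.
rewrite trace_normE; last exact: bounded_op_opoly.
exact/esym/cvg_lim/ereal_nondecreasing_cvgn.
Qed.

Lemma corner_norm_le_trace_norm d t :
  ((corner_norm d N a t)%:E <= trace_norm (opoly N a (circle_pt t)))%E.
Proof.
rewrite trace_normE; last exact: bounded_op_opoly.
by apply: ereal_sup_ubound; exists d.
Qed.

Lemma measurable_corner_norm d (D : set R) : measurable D ->
  measurable_fun D (fun t => (corner_norm d N a t)%:E).
Proof.
by move=> mD; apply: continuous_measurable_EFin => //; exact: continuous_corner_norm.
Qed.

Lemma measurable_trace_norm_opoly :
  measurable_fun `[0%R : R, 1%R] (fun t => trace_norm (opoly N a (circle_pt t))).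
Proof.
rewrite (_ : (fun t => _) = (fun t => limn (fun d => (corner_norm d N a t)%:E))).
  2: by apply/funext => t; exact: trace_norm_opoly_lim.
apply: (@emeasurable_fun_cvg _ _ _ _ (fun d t => (corner_norm d N a t)%:E)).
  by move=> d; exact: measurable_corner_norm.
move=> t _; apply: ereal_nondecreasing_is_cvgn.
by move=> d d' dd'; rewrite lee_fin dual_norm_mono.
Qed.

Lemma circle_int_corner_norm_le d :
  (circle_int (fun t => (corner_norm d N a t)%:E) <= poly_trace_norm N a)%E.
Proof.
apply: ge0_le_integral => //.
- by move=> t _; rewrite lee_fin corner_norm_ge0.
- exact: measurable_corner_norm.
- exact: measurable_trace_norm_opoly.
- by move=> t _; exact: corner_norm_le_trace_norm.
Qed.

(** Monotone convergence along the corners. *)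
Lemma poly_trace_norm_le (B : \bar R) :
  (forall d, (circle_int (fun t => (corner_norm d N a t)%:E) <= B)%E) ->
  (poly_trace_norm N a <= B)%E.
Proof.
move=> h; rewrite /poly_trace_norm /circle_int.
rewrite (_ : (fun t => _) = (fun t => limn (fun d => (corner_norm d N a t)%:E))).
  2: by apply/funext => t; exact: trace_norm_opoly_lim.
rewrite monotone_convergence//.
- apply: lime_le; last by near=> d; exact: h.
  apply: ereal_nondecreasing_is_cvgn => d d' dd'; apply: ge0_le_integral => //.
  + by move=> t _; rewrite lee_fin corner_norm_ge0.
  + exact: measurable_corner_norm.
  + exact: measurable_corner_norm.
  + by move=> t _; rewrite lee_fin dual_norm_mono.
- by move=> d; exact: measurable_corner_norm.
- by move=> d t _; rewrite lee_fin corner_norm_ge0.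
- by move=> t _ d d' dd'; rewrite lee_fin dual_norm_mono.
Unshelve. all: by end_near. Qed.

End Integrals.
End OperatorPolynomials.

(** * Multipliers of trace class valued polynomials *)

Section MultiplierBound.
Variable R : realType.
Local Notation H := (ell2 R).
Local Notation e_ := (ell2_basis R).
Implicit Types (S T : H -> H) (a : nat -> H -> H) (N : nat).

(** Choose nearly optimal forms for the values of [M_phi a] at all the roots and
    apply [discrete_multiplier] to them. *)
Lemma corner_norm_multiplier d N a (phi : nat -> R[i]) (C t : R) (K := N.*2) :
  (0 < N)%N -> 0 <= C -> hankel_schur_bound phi C ->
  \sum_(q < K) corner_norm d N (fun n => phi n *: a n) (t + q%:R / K%:R) <=
    2 * C * \sum_(q < K) corner_norm d N a (t + q%:R / K%:R).
Proof.
move=> N0 C0 hphi.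
have K0 : (0 < K)%N by rewrite double_gt0.
have KR : 0 < K%:R :> R by rewrite ltr0n.
pose w := circle_pt (K%:R^-1 : R).
pose c n i j := circle_pt t ^+ n * op_matrix (a n) i j.
have powE (q n : nat) : circle_pt (t + q%:R / K%:R) ^+ n = w ^+ (q * n) * circle_pt t ^+ n.
  by rewrite circle_pt_root exprMn -exprM mulrC.
apply/ler_addgt0Pr => e e0.
have e'0 : 0 < e / K%:R by rewrite divr_gt0.
pose m (q : 'I_K) := op_matrix (opoly N (fun n => phi n *: a n)
  (circle_pt (t + q%:R / K%:R))).
have ex q : exists Yr : ('I_d -> 'I_d -> R[i]) * R,
    [/\ form_bound 1 Yr.1, pairing Yr.1 (m q) = Yr.2%:C, 0 <= Yr.2 &
      dual_norm d (m q) - e / K%:R <= Yr.2].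
  by have [Y [r hYr]] := dual_norm_approx d (m q) e'0; exists (Y, r).
have [Yr hYr] := choice ex.
have hY q : form_bound 1 (Yr q).1 by have [] := hYr q.
have htau q (Y : 'I_d -> 'I_d -> R[i]) : form_bound 1 Y ->
    modc (\sum_(i < d) \sum_(j < d) Y i j * \sum_(n < N) w ^+ (q * n) * c n i j) <=
    corner_norm d N a (t + q%:R / K%:R).
  move=> hY'; apply: le_trans (pairing_le_dual_norm _ hY').
  rewrite le_eqVlt; apply/orP; left; apply/eqP; congr modc.
  apply: eq_bigr => i _; apply: eq_bigr => j _; congr (_ * _).
  by rewrite op_matrix_opoly; apply: eq_bigr => n _; rewrite powE mulrA.
have := @discrete_multiplier R K w (modc_circle_pt _) (root_orthogonal_powers R K0)
  'I_d 'I_d N (fun n i j => c n i j) phi C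
  (fun q => corner_norm d N a (t + q%:R / K%:R)) (erefl K) N0 C0 hphi
  (fun q : 'I_K => @htau q) (fun q => (Yr q).1) hY.
have -> : \sum_q \sum_(i < d) \sum_(j < d) (Yr q).1 i j *
    (\sum_(n < N) phi n * w ^+ (q * n) * c n i j) = (\sum_q (Yr q).2)%:C.
  rewrite rmorph_sum/=; apply: eq_bigr => q _; have [_ <- _ _] := hYr q.
  apply: eq_bigr => i _; apply: eq_bigr => j _; congr (_ * _).
  rewrite /m op_matrix_opoly; apply: eq_bigr => n _.
  by rewrite powE /c /op_matrix opZE ell2ZE; ring.
rewrite modc_real ger0_norm; last by apply: sumr_ge0 => q _; have [] := hYr q.
move=> h; apply: (@le_trans _ _ (\sum_q (Yr q).2 + e)); last by rewrite lerD2r.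
have -> : e = \sum_(q < K) e / K%:R.
  by rewrite sumr_const card_ord -[_ *+ K]mulr_natl mulrCA divff ?mulr1// gt_eqF.
rewrite -big_split/=; apply: ler_sum => q _; rewrite -lerBlDr.
by have [] := hYr q.
Qed.

Lemma poly_trace_norm_multiplier N a (phi : nat -> R[i]) (C : R) : (0 < N)%N ->
  0 <= C -> hankel_schur_bound phi C -> (forall n, bounded_op (a n)) ->
  (poly_trace_norm N (fun n => phi n *: a n)%R <= (2 * C)%:E * poly_trace_norm N a)%E.
Proof.
move=> N0 C0 hphi ba; apply: poly_trace_norm_le => [n|d].
  exact: bounded_op_scale.
have C20 : 0 <= 2 * C by rewrite mulr_ge0.
apply: (@le_trans _ _ ((2 * C)%:E *
    circle_int (fun t => (corner_norm d N a t)%:E))%E).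
  apply: (@circle_int_le_roots _ _ _ N.*2) => //; rewrite ?double_gt0//.
  - exact: continuous_corner_norm.
  - exact: continuous_corner_norm.
  - by move=> t; exact: corner_norm_ge0.
  - by move=> t; exact: corner_norm_ge0.
  - by move=> t; exact: corner_norm_multiplier.
by rewrite lee_wpmul2l ?lee_fin// circle_int_corner_norm_le.
Qed.

Lemma trace_norm_ge0 T : bounded_op T -> (0 <= trace_norm T)%E.
Proof.
move=> bT; rewrite trace_normE//.
apply: (@le_trans _ _ (dual_norm 0 (op_matrix T))%:E).
  by rewrite lee_fin dual_norm_ge0.
by apply: ereal_sup_ubound; exists 0%N.
Qed.

Lemma dual_norm_le_trace_norm T d : bounded_op T ->
  ((dual_norm d (op_matrix T))%:E <= trace_norm T)%E.
Proof. by move=> bT; rewrite trace_normE//; apply: ereal_sup_ubound; exists d. Qed.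

Lemma trace_classP T : trace_class T -> exists r : R, 0 <= r /\ trace_norm T = r%:E.
Proof.
move=> [bT lt]; have := trace_norm_ge0 bT; move: lt.
by case: (trace_norm T) => [r _|//|//]; rewrite lee_fin => r0; exists r.
Qed.

Lemma trace_normD S T : bounded_op S -> bounded_op T ->
  (trace_norm (S + T)%R <= trace_norm S + trace_norm T)%E.
Proof.
move=> bS bT; rewrite trace_normE; last exact: bounded_op_add.
apply: ge_ereal_sup => _ [d _ <-].
apply: (@le_trans _ _ ((dual_norm d (op_matrix S))%:E +
    (dual_norm d (op_matrix T))%:E)%E).
  by rewrite -EFinD lee_fin; exact: dual_normD.
by apply: leeD; exact: dual_norm_le_trace_norm.
Qed.

Lemma trace_normZ (c : R[i]) T : trace_class T ->
  (trace_norm (c *: T)%R <= (modc c)%:E * trace_norm T)%E.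
Proof.
move=> hT; have [r [r0 rE]] := trace_classP hT; rewrite rE -EFinM.
apply: trace_norm_le => [|d]; first by apply: bounded_op_scale; case: hT.
have h := dual_normZ d c (op_matrix T); apply: (le_trans h).
rewrite ler_wpM2l ?modc_ge0// -lee_fin -rE.
by apply: dual_norm_le_trace_norm; case: hT.
Qed.

Lemma trace_class_scale (c : R[i]) T : trace_class T -> trace_class (c *: T).
Proof.
move=> hT; split; first by apply: bounded_op_scale; case: hT.
apply: le_lt_trans (trace_normZ c hT) _.
by have [r [_ ->]] := trace_classP hT; rewrite -EFinM ltry.
Qed.

Lemma trace_class_add S T : trace_class S -> trace_class T -> trace_class (S + T).
Proof.
move=> hS hT; split; first by apply: bounded_op_add; [case: hS|case: hT].
apply: le_lt_trans (trace_normD _ _) _; [by case: hS|by case: hT|].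
have [r [_ ->]] := trace_classP hS; have [s [_ ->]] := trace_classP hT.
by rewrite -EFinD ltry.
Qed.

(** A contractive form is at most [x y] on a pair of vectors of norms [x], [y]. *)
Lemma trace_norm_rank_one T (u v : nat -> R[i]) (x y : R) : bounded_op T ->
  (forall i j, op_matrix T i j = u i * v j) -> 0 <= x -> 0 <= y ->
  (forall d, l2norm (fun i : 'I_d => u i) <= x) ->
  (forall d, l2norm (fun i : 'I_d => v i) <= y) ->
  (trace_norm T <= (x * y)%:E)%E.
Proof.
move=> bT TE x0 y0 hu hv; apply: trace_norm_le => // d; apply: dual_norm_le => Y hY.
have := hY (fun i => u i) (fun j => v j); rewrite mul1r => h.
apply: (@le_trans _ _ (l2norm (fun i : 'I_d => u i) * l2norm (fun i : 'I_d => v i))).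
  apply: le_trans h; rewrite le_eqVlt; apply/orP; left; apply/eqP; congr modc.
  by apply: eq_bigr => i _; apply: eq_bigr => j _; rewrite TE mulrA.
by apply: ler_pM; rewrite ?l2norm_ge0.
Qed.

Lemma l2norm_zero (I : finType) : l2norm (fun _ : I => 0 : R[i]) = 0.
Proof. by rewrite /l2norm big1 ?sqrtr0// => i _; rewrite modc0 expr0n. Qed.

Lemma trace_norm0 : trace_norm (0 : H -> H) = 0%E.
Proof.
apply/eqP; rewrite eq_le trace_norm_ge0 ?andbT; last exact: bounded_op0.
have hz d : l2norm (fun _ : 'I_d => 0 : R[i]) <= 0 by rewrite l2norm_zero.
have : (trace_norm (0%R : H -> H) <= (0 * 0)%:E)%E.
  apply: (@trace_norm_rank_one 0 (fun=> 0) (fun=> 0) 0 0 (@bounded_op0 R)) => // i j.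
  by rewrite mul0r.
by rewrite mul0r.
Qed.

Lemma trace_class0 : trace_class (0 : H -> H).
Proof. by split; [exact: bounded_op0|rewrite trace_norm0 ltry]. Qed.

Lemma trace_class_sum (I : Type) (r : seq I) (T : I -> H -> H) :
  (forall i, trace_class (T i)) -> trace_class (\sum_(i <- r) T i).
Proof.
move=> hT; elim: r => [|i r ih]; rewrite ?big_nil ?big_cons.
  exact: trace_class0.
exact: (trace_class_add (hT i) ih).
Qed.

Lemma trace_norm_sum_lt (I : Type) (r : seq I) (c : I -> R[i]) (T : I -> H -> H) :
  (forall i, trace_class (T i)) -> (forall i, modc (c i) <= 1) ->
  (trace_norm (\sum_(i <- r) c i *: T i)%R <= \sum_(i <- r) trace_norm (T i))%E.
Proof.
move=> hT hc; elim: r => [|i r ih]; first by rewrite !big_nil trace_norm0.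
rewrite !big_cons; apply: le_trans (trace_normD _ _) _.
- by apply: bounded_op_scale; case: (hT i).
- by apply: bounded_op_sum => j; apply: bounded_op_scale; case: (hT j).
apply: leeD => //; apply: (le_trans (trace_normZ _ (hT i))).
have [s [s0 ->]] := trace_classP (hT i).
by rewrite -EFinM lee_fin ler_piMl.
Qed.

Lemma entry_le_trace_norm T i j : bounded_op T ->
  ((modc (op_matrix T i j))%:E <= trace_norm T)%E.
Proof.
move=> bT; pose d := (i + j).+1.
have id : (i < d)%N by rewrite ltnS leq_addr.
have jd : (j < d)%N by rewrite ltnS leq_addl.
pose Y (k l : 'I_d) : R[i] := (k == Ordinal id)%:R * (l == Ordinal jd)%:R.
have pE (F : 'I_d -> 'I_d -> R[i]) :
    \sum_k \sum_l Y k l * F k l = F (Ordinal id) (Ordinal jd).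
  rewrite (bigD1 (Ordinal id))//= [X in _ + X]big1 ?addr0; last first.
    by move=> k /negbTE kn; apply: big1 => l _; rewrite /Y kn !mul0r.
  rewrite (bigD1 (Ordinal jd))//= big1 ?addr0 => [|l /negbTE ln]; last first.
    by rewrite /Y ln mulr0 mul0r.
  by rewrite /Y !eqxx !mul1r.
have hY : form_bound 1 Y.
  move=> xi eta.
  have -> : \sum_k \sum_l Y k l * xi k * eta l = xi (Ordinal id) * eta (Ordinal jd).
    by rewrite -(pE (fun k l => xi k * eta l)); apply: eq_bigr => k _; apply: eq_bigr => l _; rewrite mulrA.
  have le1 (z : 'I_d -> R[i]) k : modc (z k) <= l2norm z.
    rewrite -(@ler_pXn2r _ 2)// ?nnegrE ?modc_ge0 ?l2norm_ge0// sqr_l2norm.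
    by rewrite (bigD1 k)//= lerDl sumr_ge0// => l _; rewrite sqr_ge0.
  by rewrite modcM mul1r; apply: ler_pM; rewrite ?modc_ge0.
by have := pairing_le_trace_norm bT hY; rewrite /pairing (pE (fun k l => op_matrix T k l)).
Qed.

Implicit Types p q : seq (H -> H).

Lemma bpoly_eval_opoly p N z : (size p <= N)%N ->
  bpoly_eval p z = opoly N (nth 0 p) z.
Proof.
move=> pN; rewrite /bpoly_eval /opoly (big_ord_widen N (fun n => z ^+ n *: p`_n) pN).
rewrite big_mkcond/=; apply: eq_bigr => n _; case: ifP => // /negbT.
by rewrite -leqNgt => sn; rewrite nth_default// scaler0.
Qed.

Lemma bpoly_norm_opoly p N : (size p <= N)%N ->
  bpoly_norm (@trace_norm R) p = poly_trace_norm N (nth 0 p).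
Proof.
move=> pN; rewrite /bpoly_norm /poly_trace_norm; congr circle_int.
by apply/funext => t; rewrite (bpoly_eval_opoly _ pN).
Qed.

Lemma bpoly_dist_opoly p q N : (size p <= N)%N -> (size q <= N)%N ->
  bpoly_dist (@trace_norm R) p q = poly_trace_norm N (fun n => p`_n - q`_n).
Proof.
move=> pN qN; rewrite /bpoly_dist /poly_trace_norm; congr circle_int.
apply/funext => t; rewrite (bpoly_eval_opoly _ pN) (bpoly_eval_opoly _ qN).
rewrite /opoly -sumrB; congr trace_norm; apply: eq_bigr => n _.
by rewrite scalerBr.
Qed.

Lemma poly_trace_norm_fin N a : (forall n, trace_class (a n)) ->
  poly_trace_norm N a \is a fin_num.
Proof.
move=> ha; have ba n : bounded_op (a n) by case: (ha n).
pose r n := fine (trace_norm (a n)).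
have rE n : trace_norm (a n) = (r n)%:E.
  by rewrite /r; have [x [_ ->]] := trace_classP (ha n).
rewrite ge0_fin_numE; last first.
  by apply: integral_ge0 => t _; apply: trace_norm_ge0; exact: bounded_op_opoly.
apply: (@le_lt_trans _ _ (\sum_(n < N) r n)%:E); last exact: ltry.
rewrite -[leRHS]circle_int_cst; apply: ge0_le_integral => //.
- by move=> t _; apply: trace_norm_ge0; exact: bounded_op_opoly.
- exact: measurable_trace_norm_opoly.
- move=> t _; have hc (n : 'I_N) : modc (circle_pt t ^+ n) <= 1.
    by rewrite modcX modc_circle_pt expr1n.
  have h := @trace_norm_sum_lt _ (index_enum 'I_N) _ (fun n => a n) (fun n => ha n) hc.
  apply: (le_trans h); rewrite -sumEFin; apply: lee_sum => n _.
  by rewrite rE.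
Qed.

Lemma poly_trace_norm_triangle N a b : (forall n, bounded_op (a n)) ->
  (forall n, bounded_op (b n)) -> (poly_trace_norm N a <=
   poly_trace_norm N b + poly_trace_norm N (fun n => a n - b n)%R)%E.
Proof.
move=> ba bb; have bab n : bounded_op (a n - b n) by exact: bounded_op_sub.
rewrite /poly_trace_norm /circle_int -ge0_integralD//; last 4 first.
- by move=> t _; apply: trace_norm_ge0; exact: bounded_op_opoly.
- exact: measurable_trace_norm_opoly.
- by move=> t _; apply: trace_norm_ge0; exact: bounded_op_opoly.
- exact: measurable_trace_norm_opoly.
apply: ge0_le_integral => //.
- by move=> t _; apply: trace_norm_ge0; exact: bounded_op_opoly.
- exact: measurable_trace_norm_opoly.
- by apply: emeasurable_funD; exact: measurable_trace_norm_opoly.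
- move=> t _; set z := circle_pt t.
  have e : opoly N a z = opoly N b z + opoly N (fun n => a n - b n) z.
    rewrite /opoly -big_split/=; apply: eq_bigr => n _.
    by rewrite -scalerDr addrC subrK.
  by rewrite e; apply: trace_normD; exact: bounded_op_opoly.
Qed.

End MultiplierBound.

(** * Completely bounded multipliers and Hankel Schur multipliers *)

Section Equivalence.
Variable R : realType.
Local Notation H := (ell2 R).
Local Notation e_ := (ell2_basis R).
Local Notation tr := (@trace_norm R).
Local Notation TC := (@trace_class R).
Implicit Types (S T : H -> H) (p q : seq (H -> H)) (F G : nat -> seq (H -> H)).

Lemma bpoly_bounded p n : bpoly TC p -> bounded_op p`_n.
Proof. by move=> hp; case: (hp n). Qed.

Lemma bpoly_norm_fin p : bpoly TC p -> bpoly_norm tr p \is a fin_num.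
Proof.
move=> hp; rewrite (@bpoly_norm_opoly _ p (size p))//.
exact: poly_trace_norm_fin.
Qed.

Lemma bpoly_dist_ge0 p q : bpoly TC p -> bpoly TC q -> (0 <= bpoly_dist tr p q)%E.
Proof.
move=> hp hq; rewrite (@bpoly_dist_opoly _ p q (maxn (size p) (size q))) ?leq_max ?leqnn ?orbT//.
apply: integral_ge0 => t _; apply: trace_norm_ge0; apply: bounded_op_opoly => n.
by apply: bounded_op_sub; exact: bpoly_bounded.
Qed.

Lemma bpoly_norm_dist p q : bpoly TC p -> bpoly TC q ->
  (bpoly_norm tr p <= bpoly_norm tr q + bpoly_dist tr p q)%E.
Proof.
move=> hp hq; pose N := maxn (size p) (size q).
have pN : (size p <= N)%N by rewrite leq_max leqnn.
have qN : (size q <= N)%N by rewrite leq_max leqnn orbT.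
rewrite (bpoly_norm_opoly pN) (bpoly_norm_opoly qN) (bpoly_dist_opoly pN qN).
by apply: poly_trace_norm_triangle => n; exact: bpoly_bounded.
Qed.

Lemma bpoly_norm_fine_dist p q (e : R) : bpoly TC p -> bpoly TC q ->
  (bpoly_dist tr p q < e%:E)%E ->
  fine (bpoly_norm tr p) - fine (bpoly_norm tr q) < e.
Proof.
move=> hp hq; have := bpoly_norm_dist hp hq; have := bpoly_dist_ge0 hp hq.
move: (bpoly_norm_fin hp) (bpoly_norm_fin hq).
move: (bpoly_norm tr p) (bpoly_norm tr q) (bpoly_dist tr p q).
move=> [x| |] [y| |] [z| |] //= _ _ _; rewrite -EFinD !lee_fin lte_fin; lra.
Qed.

(** The norms of a Cauchy sequence of polynomials form a Cauchy sequence, so the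
    limit defining [hardy1_norm] exists and is finite. *)
Lemma hardy1_norm_cvg F : hardy1 TC tr F -> exists l : R,
  [/\ (fun k => fine (bpoly_norm tr (F k))) @ \oo --> l,
      hardy1_norm tr F = l%:E & forall k, bpoly_norm tr (F k) =
        (fine (bpoly_norm tr (F k)))%:E].
Proof.
move=> [hF cF]; pose u k := fine (bpoly_norm tr (F k)).
have uE k : bpoly_norm tr (F k) = (u k)%:E by rewrite fineK// bpoly_norm_fin.
have cu : cvgn u.
  apply: cauchy_cvg; apply/cauchyP => e e0 /=.
  have [K hK] := cF e e0; exists (u K); exists K => // m /= Km.
  have h j k : (K <= j)%N -> (K <= k)%N -> u j - u k < e.
    by move=> Kj Kk; apply: bpoly_norm_fine_dist; [exact: hF|exact: hF|exact: hK].
  by rewrite /ball/= ltr_norml h// andbT ltrNl opprB h.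
exists (limn u); split => //.
rewrite /hardy1_norm; apply/cvg_lim => //.
rewrite (_ : (fun k => _) = (fun k => (u k)%:E)); last by apply/funext.
by apply: cvg_EFin => //; near=> n.
Unshelve. all: by end_near. Qed.

Definition multiply_coefs (phi : nat -> R[i]) p : seq (H -> H) :=
  mkseq (fun n => phi n *: p`_n) (size p).

Lemma nth_multiply_coefs phi p n : (multiply_coefs phi p)`_n = phi n *: p`_n.
Proof.
have [np|pn] := ltnP n (size p); first by rewrite nth_mkseq.
by rewrite !nth_default ?size_mkseq// scaler0.
Qed.

(** Multiplying the coefficients of an approximating sequence by [phi] gives
    again a Cauchy sequence, since the polynomial estimate applies to
    differences. *)
Lemma hankel_schur_bound_cb (phi : nat -> R[i]) C : 0 <= C ->
  hankel_schur_bound phi C -> completely_bounded_on_H1 phi.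
Proof.
move=> C0 hphi; have C20 : 0 <= 2 * C by rewrite mulr_ge0.
exists (2 * C) => F hF; pose G k := multiply_coefs phi (F k).
have [bF cF] := hF.
have bG k : bpoly TC (G k).
  by move=> n; rewrite nth_multiply_coefs; apply: trace_class_scale; exact: bF.
have dG j k : (bpoly_dist tr (G j) (G k) <= (2 * C)%:E * bpoly_dist tr (F j) (F k))%E.
  pose N := (maxn (size (F j)) (size (F k))).+1.
  have jN : (size (F j) <= N)%N by rewrite leqW// leq_max leqnn.
  have kN : (size (F k) <= N)%N by rewrite leqW// leq_max leqnn orbT.
  rewrite (bpoly_dist_opoly jN kN) (@bpoly_dist_opoly _ _ _ N) ?size_mkseq//.
  have -> : (fun n => (G j)`_n - (G k)`_n) = (fun n => phi n *: ((F j)`_n - (F k)`_n)).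
    by apply/funext => n; rewrite !nth_multiply_coefs scalerBr.
  apply: poly_trace_norm_multiplier => // n.
  by apply: bounded_op_sub; apply: bpoly_bounded; exact: bF.
have nG k : (bpoly_norm tr (G k) <= (2 * C)%:E * bpoly_norm tr (F k))%E.
  have kN : (size (F k) <= (size (F k)).+1)%N by [].
  rewrite (bpoly_norm_opoly kN) (@bpoly_norm_opoly _ _ (size (F k)).+1) ?size_mkseq//.
  have -> : nth 0 (G k) = (fun n => phi n *: (F k)`_n).
    by apply/funext => n; rewrite nth_multiply_coefs.
  apply: poly_trace_norm_multiplier => // n.
  by apply: bpoly_bounded; exact: bF.
have hG : hardy1 TC tr G.
  split; first exact: bG.
  move=> e e0; have e'0 : 0 < e / (2 * C + 1) by rewrite divr_gt0// ltr_wpDl.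
  have [K hK] := cF _ e'0; exists K => j k Kj Kk.
  apply: le_lt_trans (dG j k) _.
  apply: (@le_lt_trans _ _ ((2 * C)%:E * (e / (2 * C + 1))%:E)%E).
    by rewrite lee_wpmul2l ?lee_fin// ltW// hK.
  rewrite -EFinM lte_fin mulrA ltr_pdivrMr ?ltr_wpDl//.
  by rewrite mulrC ltr_pM2l// ltrDl.
exists G; split; first exact: hG.
  move=> n; rewrite (_ : (fun k => _) = fun=> 0%E); first exact: cvg_cst.
  by apply/funext => k; rewrite nth_multiply_coefs subrr trace_norm0.
have [l [ul -> lE]] := hardy1_norm_cvg hF.
have [m [um -> mE]] := hardy1_norm_cvg hG.
rewrite -EFinM lee_fin.
have ul' : (fun k => 2 * C * fine (bpoly_norm tr (F k))) @ \oo --> 2 * C * l.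
  by apply: cvgM => //; exact: cvg_cst.
apply: (ler_cvg_to um ul'); near=> k.
have := nG k; rewrite (lE k) (mE k) -EFinM lee_fin; exact.
Unshelve. all: by end_near. Qed.

(** Extend a finite matrix by zero to an operator of norm at most 1. *)
Lemma schur_hankel_bound (phi : nat -> R[i]) :
  schur_multiplier (fun i j => phi (i + j)%N) ->
  exists C, 0 <= C /\ hankel_schur_bound phi C.
Proof.
move=> [C0 hC]; exists (Num.max C0 0); split; first by rewrite le_max lexx orbT.
set C := Num.max C0 0 => n Y hY.
pose T (x : H) : H := finite_vector (fun i : 'I_n => \sum_j Y i j * x j).
have lT : linear T.
  move=> a x y; rewrite /T /finite_vector scaler_sumr -big_split/=.
  apply: eq_bigr => i _; rewrite scalerA -scalerDl; congr (_ *: _).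
  rewrite mulr_sumr -big_split/=; apply: eq_bigr => j _.
  transitivity (Y i j * (a * x j + y j)); [by []|ring].
have bT1 : op_bound T 1.
  move=> x; rewrite mul1r finite_vector_norm.
  rewrite -(@ler_pXn2r _ 2)// ?nnegrE ?l2norm_ge0 ?ell2_norm_ge0// sqr_l2norm.
  apply: (le_trans (form_boundP ler01 hY (fun j => x j))).
  by rewrite expr1n mul1r partial_sum_le_norm.
have bT : bounded_op T by split => //; exists 1.
have TE (i j : 'I_n) : T (e_ j) i = Y i j.
  rewrite /T finite_vectorE (bigD1 j)//= eqxx mulr1 big1 ?addr0// => k.
  by rewrite -val_eqE/= => /negbTE ->; rewrite mulr0.
have [S [bS SE nS]] := hC T bT.
apply: (@eq_form_bound _ _ _ _ (fun i j : 'I_n => S (e_ j) i)).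
  by move=> i j; rewrite -op_entryE SE op_entryE TE.
apply: (@form_bound_mono _ _ _ (op_norm S)).
  apply: (le_trans nS); apply: (@le_trans _ _ (C * op_norm T)).
    by rewrite ler_wpM2r ?op_norm_ge0// le_max lexx.
  rewrite -[leRHS]mulr1 ler_wpM2l ?le_max ?lexx ?orbT//.
  exact: op_norm_le.
apply: finite_section_bound; first exact: op_norm_ge0.
  exact: bounded_op_linear.
exact: op_norm_bound.
Qed.

Lemma hankel_bound_schur (a : nat -> nat -> R[i]) C : 0 <= C ->
  (forall T n, bounded_op T ->
    form_bound (C * op_norm T) (fun i j : 'I_n => a i j * T (e_ j) i)) ->
  schur_multiplier a.
Proof.
move=> C0 h; exists C => T bT.
have M0 : 0 <= C * op_norm T by rewrite mulr_ge0 ?op_norm_ge0.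
have [S [bS SE nS]] :=
  @op_of_matrix R (fun i j => a i j * T (e_ j) i) _ M0 (fun n => h T n bT).
exists S; split => //; last exact: op_norm_le.
by move=> i j; rewrite !op_entryE SE.
Qed.

Section RankOne.
Variables (n : nat) (xi eta : 'I_n -> R[i]).

Definition unit_op (i j : nat) : H -> H := fun x => x j *: e_ i.

Lemma bounded_unit_op i j : bounded_op (unit_op i j).
Proof.
split; first by move=> a x y; rewrite /unit_op ell2DE ell2ZE scalerDl scalerA.
exists 1 => x; rewrite /unit_op ell2_normZ ell2_norm_basis mulr1 mul1r.
exact: coord_le_norm.
Qed.

Lemma unit_op_matrix i j k l :
  op_matrix (unit_op i j) k l = (k == i)%:R * (l == j)%:R.
Proof. by rewrite /op_matrix /unit_op ell2ZE !ell2_basisE (eq_sym j l) mulrC. Qed.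

Lemma l2norm_delta_le d (i : nat) : l2norm (fun k : 'I_d => (k == i :> nat)%:R : R[i]) <= 1.
Proof.
have [id|di] := ltnP i d.
  rewrite (@eq_l2norm _ _ _ (fun k => (k == Ordinal id)%:R)) ?l2norm_delta//.
rewrite (@eq_l2norm _ _ _ (fun=> 0)) ?l2norm_zero ?ler01// => k.
by rewrite ltn_eqF// (leq_trans (ltn_ord k)).
Qed.

Lemma trace_class_unit_op i j : trace_class (unit_op i j).
Proof.
have bU := bounded_unit_op i j; split => //.
apply: (@le_lt_trans _ _ (1 * 1)%:E); last exact: ltry.
apply: (@trace_norm_rank_one _ _ (fun k => (k == i)%:R) (fun l => (l == j)%:R)) => //.
- exact: unit_op_matrix.
- by move=> d; exact: l2norm_delta_le.
- by move=> d; exact: l2norm_delta_le.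
Qed.

(** The coefficient of [z^m] in [(sum_i z^i xi_i e_i) (x) (sum_j z^j eta_j e_j)]. *)
Definition rank_one_coef (m : nat) : H -> H :=
  \sum_(i < n) \sum_(j < n) ((i + j == m)%N%:R * xi i * eta j) *: unit_op i j.

Definition rank_one_poly : seq (H -> H) := mkseq rank_one_coef (n + n).

Lemma trace_class_rank_one_coef m : trace_class (rank_one_coef m).
Proof.
apply: trace_class_sum => i; apply: trace_class_sum => j.
by apply: trace_class_scale; exact: trace_class_unit_op.
Qed.

Lemma rank_one_coef_matrix m k l : op_matrix (rank_one_coef m) k l =
  \sum_(i < n) \sum_(j < n)
    (i + j == m)%N%:R * xi i * eta j * ((k == i)%:R * (l == j)%:R).
Proof.
rewrite /op_matrix /rank_one_coef op_sumE ell2_sumE; apply: eq_bigr => i _.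
rewrite op_sumE ell2_sumE; apply: eq_bigr => j _.
by rewrite opZE ell2ZE -[unit_op _ _ _ _]/(op_matrix (unit_op i j) k l) unit_op_matrix.
Qed.

Lemma rank_one_coef_entry m (i j : 'I_n) :
  op_matrix (rank_one_coef m) i j = (i + j == m)%N%:R * xi i * eta j.
Proof.
rewrite rank_one_coef_matrix (bigD1 i)//= [X in _ + X]big1 ?addr0; last first.
  move=> k ki; apply: big1 => l _.
  by rewrite (_ : (i == k :> nat) = false) ?mul0r ?mulr0//; apply/negbTE; rewrite eq_sym.
rewrite (bigD1 j)//= [X in _ + X]big1 ?addr0 ?eqxx ?mulr1// => l lj.
by rewrite (_ : (j == l :> nat) = false) ?mulr0//; apply/negbTE; rewrite eq_sym.
Qed.

Lemma nth_rank_one_poly m : rank_one_poly`_m = rank_one_coef m.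
Proof.
have [mn|nm] := ltnP m (n + n); first by rewrite nth_mkseq.
rewrite nth_default ?size_mkseq//; apply/esym.
rewrite /rank_one_coef big1// => i _; rewrite big1// => j _.
rewrite (_ : (i + j == m)%N = false) ?mul0r ?scale0r//.
apply: ltn_eqF; apply: leq_trans nm.
by rewrite -addSn leq_add// ltnW.
Qed.

Lemma rank_one_poly_matrix z k l :
  op_matrix (opoly (n + n) (nth 0 rank_one_poly) z) k l =
  finite_vector (fun i => z ^+ i * xi i) k * finite_vector (fun j => z ^+ j * eta j) l.
Proof.
rewrite op_matrix_opoly /finite_vector !ell2_sumE mulr_suml.
under eq_bigr do rewrite nth_rank_one_poly rank_one_coef_matrix mulr_sumr.
rewrite exchange_big/=; apply: eq_bigr => i _.
under eq_bigr do rewrite mulr_sumr.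
rewrite exchange_big/= mulr_sumr; apply: eq_bigr => j _.
have ijn : (i + j < n + n)%N by rewrite -addSn leq_add// ltnW.
rewrite (bigD1 (Ordinal ijn))//= [X in _ + X]big1 ?addr0; last first.
  move=> m /negbTE mij; rewrite (_ : (i + j == m)%N = false) ?mul0r ?mulr0//.
  by rewrite eq_sym -mij.
transitivity (z ^+ i * xi i * (k == i)%:R * (z ^+ j * eta j * (l == j)%:R)).
  by rewrite eqxx exprD [true%:R]mulr1n; ring.
by [].
Qed.

Lemma rank_one_poly_norm :
  (bpoly_norm tr rank_one_poly <= (l2norm xi * l2norm eta)%:E)%E.
Proof.
have norm_pow (f : 'I_n -> R[i]) t d :
    l2norm (fun k : 'I_d => finite_vector (fun i => circle_pt t ^+ i * f i) k) <= l2norm f.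
  rewrite (_ : l2norm f = ell2_norm (finite_vector (fun i => circle_pt t ^+ i * f i))).
    rewrite -(@ler_pXn2r _ 2)// ?nnegrE ?l2norm_ge0 ?ell2_norm_ge0// sqr_l2norm.
    exact: partial_sum_le_norm.
  rewrite finite_vector_norm /l2norm; congr Num.sqrt; apply: eq_bigr => i _.
  by rewrite modcM modcX modc_circle_pt expr1n mul1r.
have bP m : bounded_op rank_one_poly`_m.
  by rewrite nth_rank_one_poly; case: (trace_class_rank_one_coef m).
rewrite (@bpoly_norm_opoly _ _ (n + n)) ?size_mkseq//.
rewrite -[leRHS]circle_int_cst /poly_trace_norm; apply: ge0_le_integral => //.
- by move=> t _; apply: trace_norm_ge0; exact: bounded_op_opoly.
- exact: measurable_trace_norm_opoly.
move=> t _; apply: (trace_norm_rank_one _ (rank_one_poly_matrix (circle_pt t))).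
- exact: bounded_op_opoly.
- exact: l2norm_ge0.
- exact: l2norm_ge0.
- exact: norm_pow.
- exact: norm_pow.
Qed.

End RankOne.

Lemma form_bound_unimodular (I J : finType) (c : R) (Y : I -> J -> R[i])
    (u : I -> R[i]) (v : J -> R[i]) : (forall i, modc (u i) = 1) ->
  (forall j, modc (v j) = 1) -> form_bound c Y ->
  form_bound c (fun i j => u i * v j * Y i j).
Proof.
move=> hu hv hY xi eta.
have := hY (fun i => u i * xi i) (fun j => v j * eta j).
rewrite (_ : l2norm (fun i => u i * xi i) = l2norm xi); last first.
  by congr Num.sqrt; apply: eq_bigr => i _; rewrite modcM hu mul1r.
rewrite (_ : l2norm (fun j => v j * eta j) = l2norm eta); last first.
  by congr Num.sqrt; apply: eq_bigr => i _; rewrite modcM hv mul1r.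
apply: le_trans; rewrite le_eqVlt; apply/orP; left; apply/eqP; congr modc.
by apply: eq_bigr => i _; apply: eq_bigr => j _; ring.
Qed.

(** Fourier coefficients by averaging: at the root [z], pair the value of [p]
    with the contractive form [z^-(i+j) Y i j].  There are more roots than the
    degrees [size p] and [i + j], so the average over them isolates the
    coefficient of index [i + j]. *)
Lemma hankel_pairing_le p n (Y : 'I_n -> 'I_n -> R[i]) : bpoly TC p ->
  form_bound 1 Y ->
  ((modc (\sum_(i < n) \sum_(j < n) Y i j * op_matrix p`_(i + j) i j))%:E <=
   bpoly_norm tr p)%E.
Proof.
move=> hp hY; pose N := size p; pose K := (N + (n + n)).+1.
set v := modc _.
have K0 : (0 < K)%N by [].
have bp m : bounded_op p`_m by exact: bpoly_bounded.
rewrite (@bpoly_norm_opoly _ p N)//.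
apply: le_trans (circle_int_corner_norm_le N bp n).
apply: (@circle_int_ge_roots _ (corner_norm n N (nth 0 p)) K v K0 (modc_ge0 _)).
- exact: continuous_corner_norm.
- by move=> t; exact: corner_norm_ge0.
move=> t; pose w := circle_pt (K%:R^-1 : R); pose z := circle_pt t.
have ow := root_orthogonal_powers R K0.
pose u (q i : nat) : R[i] := (w ^+ (q * i) * z ^+ i)^*.
have u1 (q i : nat) : modc (u q i) = 1.
  by rewrite /u modcJ modcM !modcX !modc_circle_pt !expr1n mulr1.
pose Yq (q : nat) (i j : 'I_n) := u q i * u q j * Y i j.
have hYq (q : nat) : form_bound 1 (Yq q) by apply: form_bound_unimodular.
have powE (q m : nat) : circle_pt (t + q%:R / K%:R) ^+ m = w ^+ (q * m) * z ^+ m.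
  by rewrite circle_pt_root exprMn -exprM mulrC.
apply: (@le_trans _ _ (\sum_(q < K) modc (pairing (Yq q)
    (op_matrix (opoly N (nth 0 p) (circle_pt (t + q%:R / K%:R))))))); last first.
  by apply: ler_sum => q _; exact: pairing_le_dual_norm.
apply: le_trans (modc_sum _ _ _).
have -> : K%:R * v = modc (K%:R * \sum_(i < n) \sum_(j < n) Y i j * op_matrix p`_(i + j) i j).
  by rewrite modcM -(rmorph_nat (real_complex R)) modc_real ger0_norm.
rewrite le_eqVlt; apply/orP; left; apply/eqP; congr modc.
rewrite mulr_sumr exchange_big/=; apply: eq_bigr => i _.
rewrite mulr_sumr exchange_big/=; apply: eq_bigr => j _.
have ijK : (i + j < K)%N by rewrite ltnS (leq_trans (leq_add (ltnW (ltn_ord i)) (ltnW (ltn_ord j))))// leq_addl.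
under eq_bigr do rewrite op_matrix_opoly mulr_sumr.
rewrite exchange_big/=.
transitivity (\sum_(m < N) if m == (i + j)%N :> nat then K%:R * (Y i j * op_matrix p`_m i j) else 0).
  have [lt|ge] := ltnP (i + j) N.
    rewrite (bigD1 (Ordinal lt))//= eqxx [X in _ + X]big1 ?addr0// => m.
    by rewrite -val_eqE/= => /negbTE ->.
  rewrite big1.
    by rewrite nth_default// /op_matrix op0E mulr0 mulr0.
  by move=> m _; rewrite ltn_eqF// (leq_trans (ltn_ord m)).
apply: eq_bigr => m _; have mK : (m < K)%N by rewrite ltnS ltnW// ltn_addr.
transitivity (Y i j * op_matrix p`_m i j * z ^+ m * (z ^+ (i + j))^* *
    \sum_(q < K) (w ^+ (q * m)) * (w ^+ (q * (i + j)))^*).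
  rewrite ow//; case: eqP => [->|_]; last by rewrite mulr0.
  by rewrite -(mulrA _ (z ^+ _)) (unit_pow_conj (modc_circle_pt t)) mulr1 mulrC.
rewrite mulr_sumr; apply: eq_bigr => q _; rewrite powE /Yq /u.
have jM (a b : R[i]) : (a * b)^* = a^* * b^* by exact: rmorphM.
by rewrite mulnDr !exprD !jM; ring.
Qed.

(** Apply the multiplier to the constant sequence of the rank one polynomial of
    [xi] and [eta]. *)
Lemma cb_hankel_bound (phi : nat -> R[i]) : completely_bounded_on_H1 phi ->
  exists C, 0 <= C /\ forall n (Y : 'I_n -> 'I_n -> R[i]), form_bound 1 Y ->
    form_bound C (fun i j : 'I_n => phi (i + j)%N * Y i j).
Proof.
move=> [C0 hC]; exists (Num.max C0 0); split; first by rewrite le_max lexx orbT.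
set C := Num.max C0 0 => n Y hY xi eta.
pose p := rank_one_poly xi eta.
have hp : bpoly TC p.
  by move=> m; rewrite nth_rank_one_poly; exact: trace_class_rank_one_coef.
pose F (_ : nat) := p.
have hF : hardy1 TC tr F.
  split=> [k|e e0]; first exact: hp.
  exists 0%N => j k _ _; rewrite (@bpoly_dist_opoly _ p p (size p))//.
  rewrite /poly_trace_norm (_ : (fun t => _) = fun=> 0%:E).
    by rewrite circle_int_cst lte_fin.
  apply/funext => t; rewrite /opoly big1 ?trace_norm0// => m _.
  by rewrite subrr scaler0.
have [G [hG hmul hle]] := hC F hF.
have [l [ul lG lE]] := hardy1_norm_cvg hG.
have [bG _] := hG.
have FE : hardy1_norm tr F = bpoly_norm tr p.
  have cst : (fun _ : nat => bpoly_norm tr p) @ \oo --> bpoly_norm tr p by exact: cvg_cst.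
  rewrite /hardy1_norm /F; apply: cvg_lim cst; exact: ereal_hausdorff.
have lC : l <= C * l2norm xi * l2norm eta.
  rewrite -lee_fin -lG; apply: (le_trans hle); rewrite FE.
  have [r rE] : exists r, bpoly_norm tr p = r%:E.
    by exists (fine (bpoly_norm tr p)); rewrite fineK// bpoly_norm_fin.
  have r0 : 0 <= r.
    rewrite -lee_fin -rE (@bpoly_norm_opoly _ p (size p))//.
    apply: integral_ge0 => t _; apply: trace_norm_ge0; apply: bounded_op_opoly => m.
    exact: bpoly_bounded.
  have := rank_one_poly_norm xi eta; rewrite -/p rE lee_fin => hr.
  rewrite -EFinM lee_fin -mulrA; apply: (@le_trans _ _ (C * r)).
    by rewrite ler_wpM2r// le_max lexx.
  by rewrite ler_wpM2l// le_max lexx orbT.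
apply: le_trans lC.
pose s k := \sum_(i < n) \sum_(j < n) Y i j * op_matrix (G k)`_(i + j) i j.
have sl k : modc (s k) <= fine (bpoly_norm tr (G k)).
  by have := hankel_pairing_le (bG k) hY; rewrite (lE k) lee_fin.
have entry m (i j : 'I_n) : cconv (fun k => op_matrix (G k)`_m i j)
    (phi m * op_matrix (rank_one_coef xi eta m) i j).
  have hD k : trace_class (phi m *: p`_m - (G k)`_m).
    rewrite -scaleN1r; apply: trace_class_add; apply: trace_class_scale.
      exact: hp.
    exact: bG.
  apply: (@squeeze0 _ _ (fun k => fine (tr (phi m *: p`_m - (G k)`_m)%R))).
    move=> k; rewrite modc_ge0/=; have [r [_ rE]] := trace_classP (hD k).
    have := @entry_le_trace_norm _ _ i j (proj1 (hD k)).
    rewrite rE lee_fin/=; apply: le_trans.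
    rewrite -nth_rank_one_poly -/p modcB.
    by rewrite le_eqVlt; apply/orP; left; apply/eqP; congr modc.
  exact: fine_cvg (hmul m).
have scv : cconv s (\sum_(i < n) \sum_(j < n) phi (i + j)%N * Y i j * xi i * eta j).
  apply: cconv_sum => i; apply: cconv_sum => j.
  have -> : phi (i + j)%N * Y i j * xi i * eta j =
      Y i j * (phi (i + j)%N * op_matrix (rank_one_coef xi eta (i + j)) i j).
    by rewrite rank_one_coef_entry eqxx [true%:R]mulr1n; ring.
  exact/cconvZ/entry.
apply: (ler_cvg_to (cconv_modc scv) ul); near=> k; exact: sl.
Unshelve. all: by end_near. Qed.

Theorem completely_bounded_schur (phi : nat -> R[i]) :
  completely_bounded_on_H1 phi <-> schur_multiplier (fun i j => phi (i + j)%N).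
Proof.
split=> [/cb_hankel_bound [C [C0 hC]]|/schur_hankel_bound [C [C0 hC]]]; last first.
  exact: hankel_schur_bound_cb C0 hC.
apply: (hankel_bound_schur C0) => T n bT; have M0 := op_norm_ge0 bT.
have hT : form_bound (op_norm T) (fun i j : 'I_n => T (e_ j) i).
  apply: finite_section_bound => //; first exact: bounded_op_linear.
  exact: op_norm_bound.
have [TE0|Tn0] := eqVneq (op_norm T) 0.
  apply: (@eq_form_bound _ _ _ _ (fun _ _ => 0)); last first.
    by apply: form_bound_zero; rewrite mulr_ge0.
  move=> i j; have := form_bound_entry i j hT; rewrite TE0 => h.
  have /eqP : modc (T (e_ j) i) = 0 by apply/eqP; rewrite eq_le h modc_ge0.
  by rewrite modc_eq0 => /eqP ->; rewrite mulr0.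
pose M := op_norm T; have hM : M != 0 := Tn0.
have hY : form_bound 1 (fun i j : 'I_n => (M^-1)%:C * T (e_ j) i).
  have := form_boundZ (M^-1)%:C hT; rewrite modc_real ger0_norm ?invr_ge0//.
  by rewrite mulVf.
have := form_boundZ M%:C (hC n _ hY); rewrite modc_real ger0_norm// mulrC.
apply: eq_form_bound => i j; rewrite mulrCA; congr (_ * _).
by rewrite mulrA -rmorphM/= divff// mul1r.
Qed.

End Equivalence.

(** * A criterion for Hankel Schur multipliers *)

Section Criterion.
Variable R : realType.

Lemma form_boundD (I J : finType) (c d : R) (Y Z : I -> J -> R[i]) :
  form_bound c Y -> form_bound d Z -> form_bound (c + d) (fun i j => Y i j + Z i j).
Proof.
move=> hY hZ xi eta; rewrite !mulrDl.
apply: le_trans (lerD (hY xi eta) (hZ xi eta)); apply: le_trans (modcD _ _).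
rewrite -big_split/= le_eqVlt; apply/orP; left; apply/eqP; congr modc.
by apply: eq_bigr => i _; rewrite -big_split/=; apply: eq_bigr => j _; ring.
Qed.

(** Each row of a contraction has norm at most 1, so the [i]-th entry of the
    image of [eta] is at most the norm of [(a i j * eta j)_j]; sum the squares
    over [i]. *)
Lemma schur_columns (I J : finType) (s : R) (a Y : I -> J -> R[i]) : 0 <= s ->
  (forall j, \sum_i modc (a i j) ^+ 2 <= s ^+ 2) -> form_bound 1 Y ->
  form_bound s (fun i j => a i j * Y i j).
Proof.
move=> s0 ha hY; apply: form_bound_row => // eta.
apply: (@le_trans _ _ (\sum_i \sum_j modc (a i j) ^+ 2 * modc (eta j) ^+ 2)).
  apply: ler_sum => i _.
  have := form_boundP ler01 hY (fun j => a i j * eta j).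
  rewrite expr1n mul1r; under [leRHS]eq_bigr do rewrite modcM exprMn.
  apply: le_trans; rewrite (bigD1 i)//=.
  rewrite [in leLHS](_ : \sum_j _ = \sum_j Y i j * (a i j * eta j)); last first.
    by apply: eq_bigr => j _; ring.
  by rewrite lerDl sumr_ge0// => k _; rewrite sqr_ge0.
rewrite exchange_big/= mulr_sumr; apply: ler_sum => j _.
by rewrite -mulr_suml ler_wpM2r ?sqr_ge0.
Qed.

(** On or above the diagonal the column [j] of [(phi (i + j))] contains the
    values of [phi] from [j] to [2 j]; below the diagonal the rows do. *)
Lemma hankel_schur_criterion (phi : nat -> R[i]) (s : R) : 0 <= s ->
  (forall j, \sum_(i < j.+1) modc (phi (j + i)%N) ^+ 2 <= s ^+ 2) ->
  hankel_schur_bound phi (s + s).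
Proof.
move=> s0 hphi n Y hY.
pose a (i j : 'I_n) : R[i] := if (i <= j)%N then phi (i + j)%N else 0.
pose b (i j : 'I_n) : R[i] := if (i < j)%N then phi (i + j)%N else 0.
have tail (c : 'I_n -> 'I_n -> R[i]) : (forall i j : 'I_n,
    modc (c i j) <= if (i <= j)%N then modc (phi (i + j)%N) else 0) ->
    forall j, \sum_i modc (c i j) ^+ 2 <= s ^+ 2.
  move=> hc j; apply: le_trans (hphi j).
  rewrite (big_ord_widen n (fun i => modc (phi (j + i)%N) ^+ 2))//.
  rewrite [leRHS]big_mkcond/=; apply: ler_sum => i _; rewrite ltnS.
  have := hc i j; case: ifP => _ h; rewrite ?[(j + i)%N]addnC.
    by rewrite ler_pXn2r ?nnegrE ?modc_ge0.
  have /eqP -> : modc (c i j) == 0 by rewrite eq_le h modc_ge0.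
  by rewrite expr0n.
have ha : form_bound s (fun i j => a i j * Y i j).
  by apply: schur_columns => //; apply: tail => i j; rewrite /a; case: ifP; rewrite ?modc0.
have hb : form_bound s (fun i j => b j i * Y i j).
  apply: (@form_bound_tr _ _ _ _ (fun j i => b j i * Y i j)).
  apply: schur_columns => //; last exact: form_bound_tr.
  apply: tail => i j; rewrite /b; case: ifP => [/ltnW ->//|_].
  by rewrite modc0; case: ifP; rewrite ?modc_ge0.
apply: eq_form_bound (form_boundD ha hb) => i j.
rewrite /a /b -mulrDl; case: leqP => _; first by rewrite addr0.
by rewrite add0r addnC.
Qed.

End Criterion.

(** * The windows *)

Section Windows.

Lemma window_count (j a L n : nat) :
  (\sum_(i < n) (a <= j + i < a + L) <= minn L (n + j - a))%N.
Proof.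
elim: n => [|n ih]; first by rewrite big_ord0.
by rewrite big_ord_recr/=; move: ih; case: andP => /=; lia.
Qed.

(** The indices [2 ^ a * 3 ^ j] share the pattern of code [a], so that every
    pattern occurs at arbitrarily large indices.  A pair of booleans stands for
    the signs of the real and imaginary parts of [+-1 +- i]. *)
Definition pattern (m : nat) : seq (bool * bool) := odflt [::] (unpickle (logn 2 m)).

Lemma pattern_code s j : exists m, (j <= m)%N /\ pattern m = s.
Proof.
exists (2 ^ pickle s * 3 ^ j)%N; split.
  apply: leq_trans (ltnW (ltn_expl j (isT : (1 < 3)%N))) _.
  by rewrite leq_pmull// expn_gt0.
rewrite /pattern lognM ?expn_gt0// pfactorK// lognX (_ : logn 2 3 = 0%N)//.
by rewrite muln0 addn0 pickleK.
Qed.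

Local Notation L m := (size (pattern m)).

(** Common scale of the window [m] and of the block [m] of the test function:
    the window occupies [8 freq m <= n < 8 freq m + L m], and the block
    [freq m <= n < 3 freq m].  The recursion makes the next window begin
    after the double of the end of the window [m]. *)
Fixpoint freq (m : nat) : nat :=
  if m is k.+1 then (16 * freq k + L k)%N else 1%N.

Lemma freq_ge m : (16 ^ m <= freq m)%N.
Proof. by elim: m => //= m ih; rewrite expnS; lia. Qed.

Lemma freq_gt m : (m < freq m)%N.
Proof. exact: leq_trans (ltn_expl m (isT : (1 < 16)%N)) (freq_ge m). Qed.

Lemma freq_lt m m' : (m < m')%N -> (16 * freq m + L m <= freq m')%N.
Proof.
elim: m' => // m' ih; rewrite ltnS leq_eqVlt => /orP[/eqP -> //|/ih] /=; lia.
Qed.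

Definition in_window n m := (8 * freq m <= n < 8 * freq m + L m)%N.

(** A dyadic interval meets at most one window. *)
Lemma window_unique j m m' n n' : (j <= n)%N -> (n' <= 2 * j)%N ->
  (j <= n')%N -> (n <= 2 * j)%N ->
  in_window n m -> in_window n' m' -> m = m'.
Proof.
move=> jn nj jn' nj' /andP[h1 h2] /andP[h3 h4].
by case: (ltngtP m m') => // /freq_lt; lia.
Qed.

(** Blocks shifted by at most [5 freq j] end before [8 freq j], the start of the
    [j]-th window, and start after the end of the previous one. *)
Lemma window_gap j k n m : (k <= 5 * freq j)%N ->
  (freq j <= n)%N -> (n < 3 * freq j)%N -> ~~ in_window (n + k) m.
Proof.
move=> kj jn nj; apply/negP => /andP[h1 h2].
by case: (ltngtP m j) => [/freq_lt|/freq_lt|mj]; last subst m; lia.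
Qed.

(** [n + 8 freq m < 11 freq m] lies before the window following [m]. *)
Lemma window_first j m m' n : (j <= m)%N -> (n < 3 * freq j)%N ->
  in_window (n + 8 * freq m) m' -> m' = m.
Proof.
move=> jm nj /andP[h1 h2].
have sj : (freq j <= freq m)%N.
  by move: jm; rewrite leq_eqVlt => /orP[/eqP ->//|/freq_lt]; lia.
by case: (ltngtP m' m) => [/freq_lt|/freq_lt|//]; lia.
Qed.

End Windows.

(** * The multiplier *)

Section Counterexample.
Variable R : realType.

Definition eighth_root (b : bool * bool) : R[i] :=
  (if b.1 then 1 else -1) +i* (if b.2 then 1 else -1).

Definition toward (z : R[i]) : bool * bool := (0 <= complex.Re z, complex.Im z <= 0).

Lemma sqr_modc_eighth_root b : modc (eighth_root b) ^+ 2 = 2.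
Proof. by rewrite sqr_modc; case: b => [[] []] /=; ring. Qed.

(** [|Re z| + |Im z| >= |z|]. *)
Lemma Re_toward z : modc z = 1 -> 1 <= complex.Re (eighth_root (toward z) * z).
Proof.
move=> h; have := sqr_modc z; rewrite h expr1n => {}h.
case: z h => x y /=; rewrite /toward/=.
have [x0|x0] := leP 0 x; have [y0|y0] := leP y 0 => /= h; nra.
Qed.

Definition window_value (m l : nat) : R[i] :=
  eighth_root (nth (true, true) (pattern m) l) *
  ((Num.sqrt (size (pattern m))%:R)^-1)%:C.

Definition symbol (n : nat) : R[i] :=
  if [pick m : 'I_n.+1 | in_window n m] is Some m
  then window_value m (n - 8 * freq m) else 0.

Variant symbol_spec n : R[i] -> Prop :=
| SymbolWindow m of in_window n m : symbol_spec n (window_value m (n - 8 * freq m))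
| SymbolGap of (forall m, ~~ in_window n m) : symbol_spec n 0.

Lemma symbolP n : symbol_spec n (symbol n).
Proof.
rewrite /symbol; case: pickP => [m hm|h]; first exact: SymbolWindow.
apply: SymbolGap => m; apply/negP => hm.
have mn : (m < n.+1)%N.
  by have := freq_gt m; case/andP: hm; lia.
by have := h (Ordinal mn); rewrite /= hm.
Qed.

Lemma sqr_modc_window_value m l :
  modc (window_value m l) ^+ 2 = 2 / (size (pattern m))%:R.
Proof.
rewrite /window_value modcM exprMn sqr_modc_eighth_root modc_real.
by rewrite ger0_norm ?invr_ge0 ?sqrtr_ge0// exprVn sqr_sqrtr ?ler0n.
Qed.

(** Only one window [m] meets the interval, in at most [L m] points, and the
    squared modulus there is [2 / L m]. *)
Lemma symbol_dyadic j : \sum_(i < j.+1) modc (symbol (j + i)%N) ^+ 2 <= 2.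
Proof.
have [[i0 h0]|h] := pselect (exists i : 'I_j.+1, exists m, in_window (j + i) m); last first.
  rewrite big1// => i _; case: symbolP => [m hm|_]; last by rewrite modc0 expr0n.
  by exfalso; apply: h; exists i, m.
have [m hm] := h0; pose L := size (pattern m).
have L0 : (0 < L)%N by case/andP: hm; rewrite -/L; lia.
have LR : 0 < L%:R :> R by rewrite ltr0n.
apply: (@le_trans _ _ (\sum_(i < j.+1) 2 / L%:R *
    (8 * freq m <= j + i < 8 * freq m + L)%N%:R)).
  apply: ler_sum => i _; case: symbolP => [m' hm'|_]; last first.
    by rewrite modc0 expr0n/= mulr_ge0// divr_ge0// ltW.
  have em : m' = m.
    by apply: (@window_unique j _ _ (j + i) (j + i0)) => //; rewrite ?leq_addr//;
      rewrite mul2n -addnn leq_add2l -ltnS ltn_ord.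
  rewrite em in hm' *; rewrite sqr_modc_window_value -/L.
  by move: hm'; rewrite /in_window -/L => ->; rewrite mulr1.
rewrite -mulr_sumr -natr_sum.
rewrite mulrAC ler_pdivrMr// ler_pM2l// ler_nat.
exact: leq_trans (window_count _ _ _ _) (geq_minl _ _).
Qed.

Lemma symbol_completely_bounded : completely_bounded_on_H1 symbol.
Proof.
have s0 : 0 <= Num.sqrt 2 :> R by exact: sqrtr_ge0.
apply: (hankel_schur_bound_cb (addr_ge0 s0 s0)).
apply: hankel_schur_criterion => // j.
by rewrite sqr_sqrtr//; exact: symbol_dyadic.
Qed.

Local Notation toC := (real_complex R).
Implicit Types (p : {poly R[i]}) (t : R).

(** * The test function *)

Lemma bpoly_eval_horner p (z : R[i]) : bpoly_eval (polyseq p : seq R[i]^o) z = p.[z].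
Proof.
by rewrite /bpoly_eval horner_coef; apply: eq_bigr => n _; rewrite mulrC.
Qed.

Lemma ccontinuous_horner p : ccontinuous (fun t => p.[circle_pt t]).
Proof.
under eq_fun do rewrite horner_coef.
apply: ccontinuous_sum => n; apply: ccontinuousM; first exact: ccontinuous_cst.
exact/ccontinuousX/ccontinuous_circle_pt.
Qed.

Definition block_weight j : R := 2 ^- j / (freq j)%:R.

(** The block [2^-j N^-1 z^N (sum_(n < N) z^n)^2] with [N = freq j]; real
    coefficients make their positivity expressible. *)
Definition real_block j : {poly R} :=
  block_weight j *: ('X^(freq j) * (\poly_(i < freq j) 1) ^+ 2).

Definition block j : {poly R[i]} := map_poly toC (real_block j).

Lemma block_weight_gt0 j : 0 < block_weight j.
Proof.
by rewrite divr_gt0// ?invr_gt0 ?exprn_gt0// ltr0n (leq_ltn_trans _ (freq_gt j)).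
Qed.

Lemma coef_block j n : (block j)`_n = ((real_block j)`_n)%:C.
Proof. by rewrite coef_map. Qed.

Lemma real_block_ge0 j n : 0 <= (real_block j)`_n.
Proof.
rewrite coefZ; apply: mulr_ge0; first exact/ltW/block_weight_gt0.
rewrite coefXnM; case: ifP => // _.
rewrite expr2 coefM sumr_ge0// => i _.
by rewrite !coef_poly; case: ifP; case: ifP; rewrite ?mulr1 ?mulr0 ?mul0r.
Qed.

Lemma real_block_support j n : ~~ (freq j <= n < 3 * freq j)%N -> (real_block j)`_n = 0.
Proof.
move=> h; rewrite coefZ coefXnM; case: ltnP => nj; first by rewrite mulr0.
rewrite nth_default ?mulr0//; apply: (leq_trans (size_polyMleq _ _)).
have : (size (\poly_(i < freq j) (1%R : R)) <= freq j)%N by exact: size_poly.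
by move: (size _) h => s; rewrite nj/= -leqNgt; lia.
Qed.

Lemma real_block_sum j N : (size (real_block j) <= N)%N ->
  \sum_(n < N) (real_block j)`_n = 2 ^- j * (freq j)%:R.
Proof.
move=> h; have := horner_coef_wide 1 h.
under eq_bigr do rewrite expr1n mulr1.
move=> <-; rewrite /real_block hornerZ hornerM hornerXn expr1n mul1r horner_exp.
have -> : (\poly_(i < freq j) (1 : R)).[1] = (freq j)%:R.
  rewrite horner_poly; under eq_bigr do rewrite expr1n mulr1.
  by rewrite sumr_const card_ord.
have f0 : (freq j)%:R != 0 :> R by rewrite pnatr_eq0; have := freq_gt j; case: freq.
by rewrite /block_weight expr2 mulrA mulfVK.
Qed.

Lemma horner_block j (z : R[i]) :
  (block j).[z] = (block_weight j)%:C * (z ^+ freq j * (\sum_(i < freq j) z ^+ i) ^+ 2).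
Proof.
have -> : block j = (block_weight j)%:C *:
    ('X^(freq j) * (\poly_(i < freq j) 1) ^+ 2).
  apply/polyP => n; rewrite coef_block !coefZ rmorphM/=; congr (_ * _).
  rewrite !coefXnM; case: ifP => // _; rewrite !expr2 !coefM rmorph_sum/=.
  apply: eq_bigr => i _; rewrite rmorphM/= !coef_poly.
  by congr (_ * _); case: ifP.
rewrite hornerZ hornerM hornerXn horner_exp horner_poly.
by under eq_bigr do rewrite mul1r.
Qed.

(** Parseval's identity for the Dirichlet kernel on a coset of the [K]-th roots
    of unity *)
Lemma sum_roots_dirichlet K N t : (0 < K)%N -> (N <= K)%N ->
  \sum_(q < K) modc (\sum_(i < N) circle_pt (t + q%:R / K%:R) ^+ i) ^+ 2 =
  K%:R * N%:R :> R.
Proof.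
move=> K0 NK; pose w := circle_pt (K%:R^-1 : R).
have := @parseval R K w (root_orthogonal_powers R K0) 'I_1 N
  (fun x => circle_pt t ^+ x.1) NK.
under eq_bigr do rewrite big_ord1.
have -> : \sum_(p : 'I_N * 'I_1) modc (circle_pt t ^+ p.1) ^+ 2 = N%:R :> R.
  under eq_bigr do rewrite modcX modc_circle_pt !expr1n.
  by rewrite sumr_const card_prod !card_ord muln1.
move=> <-; apply: eq_bigr => q _; congr (modc _ ^+ 2); apply: eq_bigr => i _.
by rewrite circle_pt_root exprMn -exprM mulrC.
Qed.

Definition partial_test k : {poly R[i]} := \sum_(0 <= j < k) block j.

Lemma sum_half a b : \sum_(a <= j < b) 2 ^- j <= 2 * 2 ^- a :> R.
Proof.
have [ab|ba] := leqP a b; last first.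
  rewrite big_geq; last exact: ltnW.
  by rewrite mulr_ge0// invr_ge0 exprn_ge0.
suff -> : \sum_(a <= j < b) 2 ^- j = 2 * 2 ^- a - 2 * 2 ^- b :> R.
  by rewrite gerBl mulr_ge0// invr_ge0 exprn_ge0.
elim: b ab => [|b ih].
  by rewrite leqn0 => /eqP ->; rewrite big_geq// subrr.
rewrite leq_eqVlt => /orP[/eqP <-|ab]; first by rewrite big_geq// subrr.
rewrite big_nat_recr//= ih// exprS invfM; lra.
Qed.

(** Sampled at [K = freq b] roots of unity, all the Dirichlet kernels involved
    have degree less than [K], so that the [j]-th block has mean exactly [2^-j] by
    Parseval. *)
Lemma block_sum_int a b : (a <= b)%N ->
  (circle_int (fun t => (modc (partial_test b - partial_test a).[circle_pt t])%:E)
    <= (2 * 2 ^- a)%:E)%E.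
Proof.
move=> ab; pose K := freq b.
have K0 : (0 < K)%N by exact: leq_ltn_trans (freq_gt b).
apply: (@circle_int_le_roots_cst _ _ K _ K0).
- by rewrite mulr_ge0// invr_ge0 exprn_ge0.
- exact/ccontinuous_modc/ccontinuous_horner.
- by move=> t; exact: modc_ge0.
move=> t; have -> : partial_test b - partial_test a = \sum_(a <= j < b) block j.
  by rewrite /partial_test (big_cat_nat (leq0n a) ab)/= addrAC subrr add0r.
apply: (@le_trans _ _ (\sum_(q < K) \sum_(a <= j < b)
    modc (block j).[circle_pt (t + q%:R / K%:R)])).
  by apply: ler_sum => q _; rewrite horner_sum; exact: modc_sum.
rewrite exchange_big/=; apply: (@le_trans _ _ (\sum_(a <= j < b) K%:R * 2 ^- j)).
  rewrite !big_nat; apply: ler_sum => j /andP[aj jb].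
  have jK : (freq j <= K)%N by have := freq_lt jb; rewrite -/K; lia.
  have f0 : (freq j)%:R != 0 :> R by rewrite pnatr_eq0; have := freq_gt j; case: freq.
  rewrite (eq_bigr (fun q : 'I_K => block_weight j *
     modc (\sum_(i < freq j) circle_pt (t + q%:R / K%:R) ^+ i) ^+ 2)); last first.
    move=> q _; rewrite horner_block !modcM !modcX modc_circle_pt expr1n mul1r.
    by rewrite modc_real ger0_norm// ltW// block_weight_gt0.
  rewrite -mulr_sumr sum_roots_dirichlet// /block_weight.
  by rewrite mulrCA -mulrA mulVf// mulr1.
by rewrite -mulr_sumr ler_wpM2l ?ler0n// sum_half.
Qed.

Definition test_function k : seq R[i]^o := polyseq (partial_test k).

Lemma poly_distE p q :
  bpoly_dist (@cnorm R) (polyseq p : seq R[i]^o) (polyseq q : seq R[i]^o) =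
  circle_int (fun t => (modc (p - q).[circle_pt t])%:E).
Proof.
congr circle_int; apply/funext => t.
by rewrite !bpoly_eval_horner hornerD hornerN.
Qed.

Lemma half_pow_small (e : R) : 0 < e -> exists a, 2 * 2 ^- a < e.
Proof.
move=> e0; have [a ha] : exists a : nat, 2 / e < a%:R.
  exists (Num.truncn (2 / e)).+1; exact: truncnS_gt.
exists a; rewrite ltr_pdivrMr ?exprn_gt0// mulrC -ltr_pdivrMr//.
apply: (lt_trans ha); rewrite -natrX ltr_nat; exact: ltn_expl.
Qed.

Lemma test_function_H1 : H1 test_function.
Proof.
split=> [k n|e e0]; first by [].
have [a ha] := half_pow_small e0; exists a.
suff h j k : (a <= j)%N -> (j <= k)%N ->
    (circle_int (fun t => (modc (partial_test k - partial_test j).[circle_pt t])%:E)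
      < e%:E)%E.
  move=> j k aj ak; rewrite poly_distE; have [jk|kj] := leqP j k; last first.
    by apply: h => //; exact: ltnW.
  rewrite (_ : (fun t => _) = (fun t =>
    (modc (partial_test k - partial_test j).[circle_pt t])%:E)); first exact: h.
  by apply/funext => t; rewrite -opprB hornerN modcN.
move=> aj jk; apply: (le_lt_trans (block_sum_int jk)); rewrite lte_fin.
apply: le_lt_trans ha; rewrite ler_pM2l// lef_pV2 ?posrE ?exprn_gt0//.
by rewrite ler_eXn2l// ltr1n.
Qed.

(** * The maximal function is infinite *)

Lemma Re_sum (I : Type) (r : seq I) (f : I -> R[i]) :
  complex.Re (\sum_(i <- r) f i) = \sum_(i <- r) complex.Re (f i).
Proof. by apply: (big_morph (@complex.Re R)) => // -[? ?] [? ?]. Qed.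

(** The shifted block avoids all windows. *)
Lemma symbol_kills j k n : (k <= 5 * freq j)%N -> symbol (n + k) * (block j)`_n = 0.
Proof.
move=> kj; case: (boolP (freq j <= n < 3 * freq j)%N) => [/andP[jn nj]|h]; last first.
  by rewrite coef_block real_block_support// mulr0.
case: symbolP => [m|_]; last by rewrite mul0r.
by rewrite (negbTE (window_gap m kj jn nj)).
Qed.

Lemma coef_partial_test_large k n : (3 * freq k <= n)%N -> (partial_test k)`_n = 0.
Proof.
move=> kn; rewrite /partial_test coef_sum big_nat big1// => j /andP[_ jk].
rewrite coef_block real_block_support//; apply/negP => /andP[_ h].
by have := freq_lt jk; lia.
Qed.

(** [M_phi (z^k x)] is a polynomial, because [phi] vanishes on the shifts by [k]
    of all blocks but the first [k]. *)
Definition shifted_image k : {poly R[i]} :=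
  'X^k * \poly_(n < 3 * freq k) (symbol (n + k) * (partial_test k)`_n).

Lemma coef_shifted_image k n : (shifted_image k)`_n =
  symbol n * (if (n < k)%N then 0 else (partial_test k)`_(n - k)).
Proof.
rewrite /shifted_image coefXnM; case: ltnP => [_|kn]; first by rewrite mulr0.
rewrite coef_poly subnK//; case: ltnP => // h.
by rewrite coef_partial_test_large// mulr0.
Qed.

Lemma nth_hardy1_shift k b n : (hardy1_shift k test_function b)`_n =
  if (n < k)%N then 0 else (partial_test b)`_(n - k).
Proof.
rewrite /hardy1_shift nth_cat size_nseq; case: ifP => // h.
by rewrite nth_nseq h.
Qed.

Lemma symbol_partial_test k b n : (k <= b)%N ->
  symbol (n + k) * (partial_test b)`_n = symbol (n + k) * (partial_test k)`_n.
Proof.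
move=> kb; rewrite /partial_test (big_cat_nat (leq0n k) kb)/= coefD mulrDr.
rewrite [X in _ + X](_ : _ = 0) ?addr0// coef_sum mulr_sumr big_nat big1// => j /andP[kj _].
by apply: symbol_kills; have := freq_gt j; lia.
Qed.

Lemma shifted_image_multiplier k :
  multiplier_image (@cnorm R) symbol (hardy1_shift k test_function)
    (fun=> polyseq (shifted_image k)).
Proof.
move=> n; apply: cvg_near_cst; exists k => // b /= kb.
rewrite nth_hardy1_shift coef_shifted_image.
rewrite (_ : _ - _ = 0); first by rewrite /cnorm modc0.
apply/eqP; rewrite subr_eq0; apply/eqP; case: ltnP => // kn.
by have := symbol_partial_test (n - k) kb; rewrite subnK.
Qed.

Lemma constant_H1 (p : {poly R[i]}) : H1 (fun=> polyseq p : seq R[i]^o).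
Proof.
split=> [k n|e e0]; first by [].
exists 0%N => j k _ _; rewrite poly_distE subrr.
under eq_fun do rewrite horner0 modc0.
by rewrite circle_int_cst lte_fin.
Qed.

Lemma constant_H1_function (p : {poly R[i]}) :
  H1_function (fun=> polyseq p : seq R[i]^o) (fun t => p.[circle_pt t]).
Proof.
have [cr ci] := ccontinuous_horner p; split.
- by apply: measurable_funTS; exact: continuous_measurable_fun.
- by apply: measurable_funTS; exact: continuous_measurable_fun.
rewrite (_ : (fun k : nat => _) = fun=> 0%E); first exact: cvg_cst.
apply/funext => k; rewrite -[RHS]circle_int_cst; congr circle_int.
by apply/funext => t; rewrite bpoly_eval_horner subrr /cnorm modc0.
Qed.

(** Used for [f = N_j >= 16^j], [a = 2^j] and [r = sqrt(3 f)], the square root of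
    the length of the window. *)
Lemma dyadic_growth (f r a : R) : 0 < r -> 0 < a -> r ^+ 2 = 3 * f ->
  a ^+ 4 <= f -> a / 2 <= r^-1 * (a^-1 * f).
Proof.
move=> rp a0 r2 af; have f0 : 0 < f by apply: lt_le_trans af; rewrite exprn_gt0.
have h : r * a ^+ 2 <= 2 * f.
  have n1 : 0 <= r * a ^+ 2 by apply: mulr_ge0; [exact: ltW|exact: sqr_ge0].
  have n2 : 0 <= 2 * f by lra.
  rewrite -ler_sqr ?nnegrE//.
  have -> : (r * a ^+ 2) ^+ 2 = 3 * (f * a ^+ 4) by rewrite mulrA -r2; ring.
  have : f * a ^+ 4 <= f * f by rewrite ler_pM2l.
  by move: (f * a ^+ 4) => b; rewrite expr2; nra.
have e : r^-1 * (a^-1 * f) = f / (r * a) by rewrite invfM mulrA mulrC.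
rewrite e ler_pdivlMr ?mulr_gt0// mulrAC ler_pdivrMr//.
by move: h; rewrite expr2 mulrCA (mulrC f).
Qed.

(** The pattern [s] turns [z^n] towards the positive axis for all [n] below the
    end [3 freq j] of the block [j].  All terms of the shifted image then have
    nonnegative real part: in the window [m] by the choice of [s], elsewhere
    because [phi] or the coefficient vanishes. *)
Lemma shifted_image_large t j : exists k,
  2 ^+ j / 2 <= modc (shifted_image k).[circle_pt t].
Proof.
set z := circle_pt t; pose L := (3 * freq j)%N.
pose s := mkseq (fun n => toward (z ^+ n)) L.
have [m [jm ms]] := pattern_code s j.
pose k := (8 * freq m)%N; exists k.
have Ls : size (pattern m) = L by rewrite ms size_mkseq.
have L0 : (0 < L)%N by rewrite /L; have := freq_gt j; lia.
have LR : 0 < Num.sqrt L%:R :> R by rewrite sqrtr_gt0 ltr0n.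
have hval n : in_window (n + k) m ->
    (Num.sqrt L%:R)^-1 <= complex.Re (symbol (n + k) * z ^+ n).
  move=> hw; have nL : (n < L)%N by move: hw; rewrite /in_window Ls -/k; lia.
  case: symbolP => [m' hm'|/(_ m)]; last by rewrite hw.
  have -> : m' = m.
    by apply: (@window_unique (n + k) _ _ (n + k) (n + k)) => //; rewrite leq_pmull.
  rewrite -/k addnK /window_value Ls ms nth_mkseq//.
  have : 1 <= complex.Re (eighth_root (toward (z ^+ n)) * z ^+ n).
    by apply: Re_toward; rewrite modcX modc_circle_pt expr1n.
  rewrite mulrAC; case: (_ * _) => x y /= hx.
  by rewrite mulr0 subr0 ler_peMl// invr_ge0 ltW.
pose c n i := complex.Re (symbol (n + k) * z ^+ n) * (real_block i)`_n.
have c0 n i : 0 <= c n i.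
  rewrite /c; case: (boolP (freq i <= n < 3 * freq i)%N) => [/andP[ii ni]|h]; last first.
    by rewrite real_block_support// mulr0.
  apply: mulr_ge0; last exact: real_block_ge0.
  have [/hval|hw] := boolP (in_window (n + k) m).
    by apply: le_trans; rewrite invr_ge0 ltW.
  case: symbolP => [m' hm'|_]; last by rewrite mul0r.
  exfalso; have [le_im|mi] := leqP i m.
    by move: hw; rewrite -(window_first le_im ni hm') hm'.
  have ki : (k <= 5 * freq i)%N by have := freq_lt mi; rewrite /k; lia.
  by have := window_gap m' ki ii ni; rewrite hm'.
have cj n : (Num.sqrt L%:R)^-1 * (real_block j)`_n <= c n j.
  rewrite /c; case: (boolP (freq j <= n < 3 * freq j)%N) => [/andP[_ nj]|h]; last first.
    by rewrite real_block_support// !mulr0.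
  apply: ler_wpM2r; [exact: real_block_ge0|apply: hval].
  by rewrite /in_window Ls /k /L; lia.
have jk : (j < k)%N by have := freq_gt m; rewrite /k; lia.
apply: (@le_trans _ _ ((Num.sqrt L%:R)^-1 * (2 ^- j * (freq j)%:R))).
  apply: dyadic_growth; first exact: LR.
  - by rewrite exprn_gt0.
  - by rewrite sqr_sqrtr ?ler0n// natrM.
  - by rewrite -exprM mulnC exprM -!natrX ler_nat; exact: freq_ge.
rewrite /shifted_image hornerM hornerXn modcM modcX modc_circle_pt expr1n mul1r.
apply: le_trans (le_trans (ler_norm _) (Re_le_modc _)).
rewrite horner_poly Re_sum.
have sz : (size (real_block j) <= 3 * freq k)%N.
  apply/leq_sizeP => n hn; apply: real_block_support; apply/negP => /andP[_ h].
  by have := freq_lt jk; lia.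
rewrite -(real_block_sum sz) mulr_sumr; apply: ler_sum => n _.
rewrite (_ : complex.Re _ = \sum_(0 <= i < k) c n i); last first.
  rewrite /partial_test coef_sum mulr_sumr mulr_suml Re_sum.
  apply: eq_bigr => i _; rewrite coef_block mulrAC /c.
  by case: (symbol _ * _) => x y /=; rewrite mulr0 subr0.
apply: (le_trans (cj n)).
rewrite big_mkord (bigD1 (Ordinal jk))//= lerDl sumr_ge0// => i _; exact: c0.
Qed.

Lemma symbol_not_shift_bounded : ~ shift_bounded_on_H1 symbol.
Proof.
move=> [_ h].
pose G (k _ : nat) : seq R[i]^o := polyseq (shifted_image k).
pose g k t := (shifted_image k).[circle_pt t].
have hG k : [/\ H1 (G k), multiplier_image (@cnorm R) symbol
    (hardy1_shift k test_function) (G k) & H1_function (G k) (g k)].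
  by split; [exact: constant_H1|exact: shifted_image_multiplier|
    exact: constant_H1_function].
have := h _ G g test_function_H1 hG.
rewrite (_ : (fun t => _) = fun=> +oo%E); last first.
  apply/funext => t; apply/eqyP => A A0.
  have [j hj] : exists j, A <= 2 ^+ j / 2.
    exists (Num.truncn (2 * A)).+1; rewrite ler_pdivlMr// mulrC.
    apply: (le_trans (ltW (truncnS_gt _))).
    by rewrite -natrX ler_nat ltnW// ltn_expl.
  have [k hk] := shifted_image_large t j.
  apply: (@le_trans _ _ (cnorm (shifted_image k).[circle_pt t])).
    by rewrite lee_fin; exact: le_trans hk.
  by apply: ereal_sup_ubound; exists k.
by rewrite /circle_int integral_cst//= lebesgue_measure_itv/= lte_fin ltr01 oppr0 adde0 mule1.
Qed.

End Counterexample.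

Theorem mainTheorem3 (R : realType) :
  (forall phi : nat -> R[i],
     completely_bounded_on_H1 phi <->
     schur_multiplier (fun i j => phi (i + j)%N)) /\
  (exists phi : nat -> R[i],
     completely_bounded_on_H1 phi /\ ~ shift_bounded_on_H1 phi).
Proof.
split; first exact: completely_bounded_schur.
exists (symbol R); split; first exact: symbol_completely_bounded.
exact: symbol_not_shift_bounded.
Qed.
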